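(* Let $k>0$ be irrational and let $c,g,\tau$ be real constants. Let $\tilde\eta_0(\alpha_1,\alpha_2)=\sum_{(j_1,j_2)\in\mathbb Z^2}\hat\eta_{j_1,j_2}e^{i(j_1\alpha_1+j_2\alpha_2)}$ be a function on $\mathbb T^2$ such that, for some constants $C$ and $\varepsilon>0$, $$\hat\eta_{-j_1,-j_2}=\overline{\hat\eta_{j_1,j_2}},\qquad |\hat\eta_{j_1,j_2}|\le C e^{-3\varepsilon \max(k,1)\max(|j_1|,|j_2|)},\qquad (j_1,j_2)\in\mathbb Z^2 .$$ Define $\tilde\xi_0=H[\tilde\eta_0]$, $\tilde\zeta_0=\tilde\xi_0+i\tilde\eta_0$, $\tilde\varphi_0=c\,\tilde\xi_0$, and for $\alpha,\theta\in\mathbb R$ let $$\eta_0(\alpha;\theta)=\tilde\eta_0(\alpha,\theta+k\alpha),\quad \varphi_0(\alpha;\theta)=\tilde\varphi_0(\alpha,\theta+k\alpha),\quad \xi_0(\alpha;\theta)=\alpha+\tilde\xi_0(\alpha,\theta+k\alpha),\quad \zeta_0=\xi_0+i\eta_0 .$$ Suppose that for each $\theta\in[0,2\pi)$ the map $\alpha\mapsto\zeta_0(\alpha;\theta)$ is injective from $\mathbb R$ to $\mathbb C$ and $\partial_\alpha\zeta_0(\alpha;\theta)\neq0$ for all $\alpha\in\mathbb R$. Suppose also that $\tilde\eta_0$ satisfies the torus version of the traveling wave equations with constants $c,g,\tau$ (see context). Then for each $\theta\in\mathbb R$, the functions $$\zeta(\alpha,t;\theta)=\zeta_0(\alpha;\theta)+ct,\qquad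 \varphi(\alpha,t;\theta)=\varphi_0(\alpha;\theta)$$ satisfy the one-dimensional conformal water wave evolution equations (see context) with $C_1=c\,P_0[\xi_\alpha/J]$.
   Context: $\mathbb T^2=\mathbb R^2/2\pi\mathbb Z^2$, and $k>0$ is a fixed irrational number. Torus operators. For $\tilde u(\alpha_1,\alpha_2)=\sum_{j_1,j_2}\hat u_{j_1,j_2}e^{i(j_1\alpha_1+j_2\alpha_2)}$ on $\mathbb T^2$, $H[\tilde u]=\sum_{j_1,j_2}(-i)\operatorname{sgn}(j_1+j_2k)\,\hat u_{j_1,j_2}e^{i(j_1\alpha_1+j_2\alpha_2)}$ with $\operatorname{sgn}(0)=0$; $P_0[\tilde u]=\hat u_{0,0}$ (the mean over $\mathbb T^2$); $P=\mathrm{id}-P_0$; and $D=\partial_{\alpha_1}+k\,\partial_{\alpha_2}$. Quasi-periodic functions. If $u(\alpha)=\tilde u(\alpha,\theta+k\alpha)$ for some fixed $\theta\in\mathbb R$, then $H[u](\alpha)=H[\tilde u](\alpha,\theta+k\alpha)$, $P_0[u]=P_0[\tilde u]$, $P[u](\alpha)=P[\tilde u](\alpha,\theta+k\alpha)$, and $u_\alpha(\alpha)=(D\tilde u)(\alpha,\theta+k\alpha)$. Torus version of the traveling wave equations for $\tilde\eta$ (with constants $c,g,\tau$): setting $X=1+H[D\tilde\eta]$, $\tilde J=X^2+(D\tilde\eta)^2$ and $\tilde\kappa=\tilde J^{-3/2}\left(X\,D^2\tilde\eta-(D\tilde\eta)(DX)\right)$, $$P\left[\frac{c^2}{2\tilde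 J}+g\tilde\eta-\tau\tilde\kappa\right]=0\quad\text{on }\mathbb T^2 .$$ One-dimensional conformal water wave evolution equations (with constants $g,\tau$ and a prescribed real function $C_1$ of $t$, constant in $\alpha$): the unknowns are $\zeta=\xi+i\eta$ and $\varphi$, functions of $(\alpha,t)$ such that, at each fixed $t$, each of $\eta$, $\xi-\alpha$, $\varphi$ is quasi-periodic in $\alpha$, i.e. of the form $u(\alpha)=\tilde u(\alpha,\theta+k\alpha)$ with $\tilde u$ a function on $\mathbb T^2$ and $\theta\in\mathbb R$ fixed (the same $\theta$ for all three functions and all $t$), and $\xi=\alpha+x_0(t)+H[\eta]$ for a real function $x_0(t)$. With $$\xi_\alpha=1+H[\eta_\alpha],\quad \psi=-H[\varphi],\quad J=\xi_\alpha^2+\eta_\alpha^2,\quad \chi=\frac{\psi_\alpha}{J},\quad \kappa=\frac{\xi_\alpha\eta_{\alpha\alpha}-\eta_\alpha\xi_{\alpha\alpha}}{J^{3/2}},$$ the equations are $$\frac{dx_0}{dt}=P_0\left[\xi_\alpha\left(-H[\chi]+C_1\right)+\eta_\alpha\chi\right],\qquad \eta_t=-\eta_\alpha H[\chi]-\xi_\alpha\chi+C_1\eta_\alpha,$$ $$\varphi_t=P\left[\frac{\psi_\alpha^2-\varphi_\alpha^2}{2J}-\varphi_\alpha H[\chi]+C_1\varphi_\alpha-g\eta+\tau\kappa\right].$$ *)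

(* Defs.v *)
From Stdlib Require Export Reals ZArith.
From Coquelicot Require Export Coquelicot.
Open Scope R_scope.

Definition irrational (k : R) : Prop :=
  forall p q : Z, q <> 0%Z -> k <> IZR p / IZR q.

(** Functions on the torus [R^2 / 2 pi Z^2] are functions [R -> R -> R]; see
    [torus_fun] for the periodicity and regularity required of them. *)

(** e^{i (j1 x + j2 y)} *)
Definition mode (j1 j2 : Z) (x y : R) : C :=
  (cos (IZR j1 * x + IZR j2 * y), sin (IZR j1 * x + IZR j2 * y)).

(** Sum of [f j1 j2] over the square |j1|, |j2| <= N; recall that [sum_n _ n]
    has [n + 1] terms.  Series over Z^2 are limits of these sums. *)
Definition square_sum {G : AbelianMonoid} (f : Z -> Z -> G) (N : nat) : G :=
  sum_n (fun p => sum_n (fun q =>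
    f (Z.of_nat p - Z.of_nat N)%Z (Z.of_nat q - Z.of_nat N)%Z)
    (2 * N)) (2 * N).

Definition fourier_sum (a : Z -> Z -> C) (x y : R) (s : C) : Prop :=
  filterlim (square_sum (fun j1 j2 => Cmult (a j1 j2) (mode j1 j2 x y)))
    eventually (locally s).

Definition P0 (u : R -> R -> R) : R :=
  RInt (fun x => RInt (fun y => u x y) 0 (2 * PI)) 0 (2 * PI) / (2 * PI) ^ 2.

(** The coefficient P0 [u e^{-i (j1 x + j2 y)}], by real and imaginary parts. *)
Definition fourier_coef (u : R -> R -> R) (j1 j2 : Z) : C :=
  (P0 (fun x y => u x y * cos (IZR j1 * x + IZR j2 * y)),
   - P0 (fun x y => u x y * sin (IZR j1 * x + IZR j2 * y))).

(** [u] is the sum of its absolutely convergent Fourier series.  This implies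
    that [u] is continuous and 2 pi-periodic in both variables, and that the
    series defining [H k u] below converges. *)
Definition torus_fun (u : R -> R -> R) : Prop :=
  (exists M : R, forall N : nat,
     square_sum (fun j1 j2 => Cmod (fourier_coef u j1 j2)) N <= M) /\
  (forall x y : R, fourier_sum (fourier_coef u) x y (RtoC (u x y))).

(** For real [u] the series has a real sum, its terms at (j1, j2) and
    (-j1, -j2) being conjugate; hence taking [Re] loses nothing.
    Coquelicot's [sign] satisfies [sign 0 = 0]. *)
Definition H (k : R) (u : R -> R -> R) (x y : R) : R :=
  real (Lim_seq (fun N : nat => Re (square_sum (G := C_AbelianMonoid)
    (fun j1 j2 =>
       Cmult (Cmult (Cmult (Copp Ci) (RtoC (sign (IZR j1 + IZR j2 * k))))
                    (fourier_coef u j1 j2))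
             (mode j1 j2 x y)) N))).

Definition Pr (u : R -> R -> R) (x y : R) : R := u x y - P0 u.

Definition D (k : R) (u : R -> R -> R) (x y : R) : R :=
  Derive (fun s => u s y) x + k * Derive (fun s => u x s) y.

(** Frechet differentiability: [D k u] is then a genuine derivative, and
    restricts to the ordinary derivative along the lines y = theta + k x. *)
Definition torus_diff (u : R -> R -> R) : Prop :=
  forall x y : R, differentiable_pt u x y.

Definition Xi (k : R) (eta : R -> R -> R) (x y : R) : R :=
  1 + H k (D k eta) x y.

Definition Jac (k : R) (eta : R -> R -> R) (x y : R) : R :=
  Xi k eta x y ^ 2 + D k eta x y ^ 2.

Definition kappa (k : R) (eta : R -> R -> R) (x y : R) : R :=
  Rpower (Jac k eta x y) (- (3 / 2)) *
  (Xi k eta x y * D k (D k eta) x y - D k eta x y * D k (Xi k eta) x y).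

Definition torus_traveling_wave (k c g tau : R) (eta : R -> R -> R) : Prop :=
  forall x y : R,
    Pr (fun x y => c ^ 2 / (2 * Jac k eta x y) + g * eta x y
                   - tau * kappa k eta x y) x y = 0.

Definition qp_lift (k theta : R) (u : R -> R) (ut : R -> R -> R) : Prop :=
  torus_fun ut /\ forall alpha : R, u alpha = ut alpha (theta + k * alpha).

Definition Psi (k : R) (phi : R -> R -> R) (x y : R) : R := - H k phi x y.

Definition Chi (k : R) (eta phi : R -> R -> R) (x y : R) : R :=
  D k (Psi k phi) x y / Jac k eta x y.

Definition x0_rhs (k C1 : R) (eta phi : R -> R -> R) (x y : R) : R :=
  Xi k eta x y * (- H k (Chi k eta phi) x y + C1)
  + D k eta x y * Chi k eta phi x y.

Definition eta_rhs (k C1 : R) (eta phi : R -> R -> R) (x y : R) : R :=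
  - D k eta x y * H k (Chi k eta phi) x y
  - Xi k eta x y * Chi k eta phi x y + C1 * D k eta x y.

Definition phi_rhs (k g tau C1 : R) (eta phi : R -> R -> R) (x y : R) : R :=
  (D k (Psi k phi) x y ^ 2 - D k phi x y ^ 2) / (2 * Jac k eta x y)
  - D k phi x y * H k (Chi k eta phi) x y + C1 * D k phi x y
  - g * eta x y + tau * kappa k eta x y.

(** [P0], [H], [D] and division are total; this says that each is applied
    within its natural domain in the evolution equations. *)
Definition ww_domain (k g tau C1 : R) (eta phi : R -> R -> R) : Prop :=
  (torus_fun eta /\ torus_diff eta) /\
  (torus_fun (D k eta) /\ torus_diff (D k eta)) /\
  torus_diff (Xi k eta) /\
  (torus_fun phi /\ torus_diff phi) /\
  torus_diff (Psi k phi) /\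
  (forall x y : R, 0 < Jac k eta x y) /\
  torus_fun (Chi k eta phi) /\
  torus_fun (x0_rhs k C1 eta phi) /\
  torus_fun (phi_rhs k g tau C1 eta phi).

(** The one-dimensional conformal water wave evolution equations for
    [zeta alpha t] and [phi alpha t].  The torus functions [xit t], [etat t],
    [phit t] are the lifts of xi - alpha, eta, phi at time t; they are unique
    when k is irrational.  The operators H, P0, P and d/dalpha on
    quasi-periodic functions of alpha are those on the lifts, evaluated at
    (alpha, theta + k alpha). *)
Definition conformal_water_wave (k theta g tau : R) (C1 : R -> R)
    (zeta : R -> R -> C) (phi : R -> R -> R) : Prop :=
  exists (x0 : R -> R) (xit etat phit : R -> R -> R -> R),
    (forall t : R,
       qp_lift k theta (fun alpha => Re (zeta alpha t) - alpha) (xit t) /\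
       qp_lift k theta (fun alpha => Im (zeta alpha t)) (etat t) /\
       qp_lift k theta (fun alpha => phi alpha t) (phit t) /\
       ww_domain k g tau (C1 t) (etat t) (phit t)) /\
    (forall alpha t : R,
       Re (zeta alpha t)
       = alpha + x0 t + H k (etat t) alpha (theta + k * alpha)) /\
    (forall t : R, is_derive x0 t (P0 (x0_rhs k (C1 t) (etat t) (phit t)))) /\
    (forall alpha t : R,
       is_derive (fun s => Im (zeta alpha s)) t
         (eta_rhs k (C1 t) (etat t) (phit t) alpha (theta + k * alpha))) /\
    (forall alpha t : R,
       is_derive (fun s => phi alpha s) t
         (Pr (phi_rhs k g tau (C1 t) (etat t) (phit t))
            alpha (theta + k * alpha))).

Definition zeta0 (k : R) (eta : R -> R -> R) (theta alpha : R) : C :=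
  (alpha + H k eta alpha (theta + k * alpha), eta alpha (theta + k * alpha)).

Definition phi0 (k c : R) (eta : R -> R -> R) (theta alpha : R) : R :=
  c * H k eta alpha (theta + k * alpha).

Definition Derive_RC (f : R -> C) (x : R) : C :=
  (Derive (fun s => Re (f s)) x, Derive (fun s => Im (f s)) x).

(* Main.v *)
Require Import Defs.
From Stdlib Require Import Lra Lia Psatz FunctionalExtensionality Classical ClassicalEpsilon.

(** With [zt] the lift of [zeta0 - alpha], the function [zt] has no frequency
    [j1 + j2 k > 0], so neither has the tangent [zeta_alpha].  The point is that
    [1 / zeta_alpha = (Xi - i D eta) / J] has none either: then [Xi / J] and
    [- D eta / J] are conjugate functions, so that
    [H (D eta / J) = P0 (Xi / J) - Xi / J] and every right-hand side of the
    evolution equations collapses by algebra (the one for [phi] by the traveling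
    wave equation).

    No analytic continuation to the lower half-plane is used.  The chords
    [s + zt(x + s, y + k s) - zt(x, y)], [s > 0], lie in the uniformly closed
    algebra generated by the modes of nonpositive frequency; by injectivity they
    vanish nowhere, and they connect [s zeta_alpha] (small [s]) to the constant [s]
    (large [s]).  Having an inverse in that algebra is locally constant in [s], and
    holds for large [s] by a Neumann series.

    Absolute convergence of the Fourier series of [1 / J] comes from an
    exponentially weighted form of Wiener's lemma. *)

(** Injectivity cannot be dropped: a mode of negative frequency vanishes nowhere, yet its inverse
    has positive frequency, so nonvanishing of [zeta_alpha] alone says nothing about the spectrum of
    its inverse. The chords transport invertibility from a constant. They are taken over the whole
    torus because the lower bounds behind the Neumann series come from compactness; every torus
    point lies, up to periods, on a line with [theta] in [0, 2 pi), so the hypotheses of all these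
    lines are combined.

    Two classes of functions share the work. [AP Q] is closed under uniform limits, so smallness in
    its Neumann series is measured in the sup norm alone, but its members need not have summable
    coefficients. Members of [analytic] have exponentially decaying coefficients, which justify [H],
    [D] and termwise sums. The first class gives the spectrum of [1 / zeta_alpha], the second the
    convergence of its series. Irrationality makes the constant the only mode of frequency zero;
    hence [H (H u)] is [P0 u - u], and the positive frequencies determine a real function up to its
    mean. *)

(** * Square sums over the integer lattice *)

(* [ring] does not see through the coercion from Coquelicot's structures to [C]. *)
Ltac cring := match goal with |- @eq _ ?a ?b => change (@eq C a b) end; ring.

Notation csum := (square_sum (G := C_AbelianMonoid)).
Notation rsum := (square_sum (G := R_AbelianMonoid)).

(** A square sum is an iterated symmetric sum by conversion, and the symmetric form permits
    induction on the radius, which adds one term at each end. *)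
Definition zsum {G : AbelianMonoid} (f : Z -> G) (N : nat) : G :=
  sum_n (fun p => f (Z.of_nat p - Z.of_nat N)%Z) (2 * N).

Lemma sum_n_first {G : AbelianMonoid} (a : nat -> G) (n : nat) :
  sum_n a (S n) = plus (a O) (sum_n (fun i => a (S i)) n).
Proof.
  unfold sum_n. rewrite sum_Sn_m by lia. f_equal. symmetry. apply sum_n_m_S.
Qed.

Lemma zsum_S {G : AbelianMonoid} (f : Z -> G) (N : nat) :
  zsum f (S N) = plus (plus (f (- Z.of_nat (S N))%Z) (zsum f N)) (f (Z.of_nat (S N))).
Proof.
  unfold zsum. replace (2 * S N)%nat with (S (S (2 * N))) by lia.
  rewrite sum_Sn, sum_n_first.
  apply f_equal2; [apply f_equal2|].
  - apply f_equal. lia.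
  - apply sum_n_ext; intros p. apply f_equal. lia.
  - apply f_equal. lia.
Qed.

Lemma zsum_0 {G : AbelianMonoid} (f : Z -> G) : zsum f 0 = f 0%Z.
Proof. unfold zsum. simpl. now rewrite sum_O. Qed.

Lemma zsum_ext {G : AbelianMonoid} (f g : Z -> G) N :
  (forall p, (Z.abs p <= Z.of_nat N)%Z -> f p = g p) -> zsum f N = zsum g N.
Proof.
  intros E. unfold zsum. apply sum_n_ext_loc; intros p Hp. apply E. lia.
Qed.

Lemma zsum_plus {G : AbelianMonoid} (f g : Z -> G) N :
  zsum (fun p => plus (f p) (g p)) N = plus (zsum f N) (zsum g N).
Proof. apply sum_n_plus. Qed.

Lemma zsum_scal_l {K : Ring} (a : K) (f : Z -> K) N :
  zsum (fun p => mult a (f p)) N = mult a (zsum f N).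
Proof. apply sum_n_mult_l. Qed.

Lemma zsum_scal_r {K : Ring} (a : K) (f : Z -> K) N :
  zsum (fun p => mult (f p) a) N = mult (zsum f N) a.
Proof. apply sum_n_mult_r. Qed.

Lemma square_sum_zsum {G : AbelianMonoid} (f : Z -> Z -> G) N :
  square_sum f N = zsum (fun p => zsum (f p) N) N.
Proof. reflexivity. Qed.

Lemma square_sum_plus {G : AbelianMonoid} (f g : Z -> Z -> G) N :
  square_sum (fun p q => plus (f p q) (g p q)) N
  = plus (square_sum f N) (square_sum g N).
Proof.
  rewrite !square_sum_zsum, <- zsum_plus. apply zsum_ext; intros. apply zsum_plus.
Qed.

Lemma square_sum_scal {K : Ring} (a : K) (f : Z -> Z -> K) N :
  square_sum (fun p q => mult a (f p q)) N = mult a (square_sum f N).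
Proof.
  rewrite !square_sum_zsum. rewrite <- zsum_scal_l.
  apply zsum_ext; intros. apply zsum_scal_l.
Qed.

Lemma csum_plus (f g : Z -> Z -> C) N :
  csum (fun p q => Cplus (f p q) (g p q)) N = Cplus (csum f N) (csum g N).
Proof. apply (square_sum_plus (G := C_AbelianMonoid)). Qed.

Lemma csum_scal (c : C) (f : Z -> Z -> C) N :
  csum (fun p q => Cmult c (f p q)) N = Cmult c (csum f N).
Proof. apply (square_sum_scal (K := C_Ring)). Qed.

(** Two monoids are allowed so that one induction serves both to compare complex sums with real
    majorants and to show that sums of zeros vanish. *)
Lemma zsum_induction {G1 G2 : AbelianMonoid} (Rl : G1 -> G2 -> Prop)
    (f : Z -> G1) (g : Z -> G2) N :
  (forall a b c d, Rl a b -> Rl c d -> Rl (plus a c) (plus b d)) ->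
  (forall p, (Z.abs p <= Z.of_nat N)%Z -> Rl (f p) (g p)) -> Rl (zsum f N) (zsum g N).
Proof.
  intros P. induction N as [|N IH]; intros Hfg.
  - rewrite !zsum_0. apply Hfg. lia.
  - rewrite !zsum_S. apply P; [apply P|]; try (apply Hfg; lia).
    apply IH. intros; apply Hfg; lia.
Qed.

Lemma square_sum_induction {G1 G2 : AbelianMonoid} (Rl : G1 -> G2 -> Prop)
    (f : Z -> Z -> G1) (g : Z -> Z -> G2) N :
  (forall a b c d, Rl a b -> Rl c d -> Rl (plus a c) (plus b d)) ->
  (forall p q, (Z.abs p <= Z.of_nat N)%Z -> (Z.abs q <= Z.of_nat N)%Z ->
     Rl (f p q) (g p q)) -> Rl (square_sum f N) (square_sum g N).
Proof.
  intros P Hfg. rewrite !square_sum_zsum. apply zsum_induction; auto.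
  intros p Hp. apply zsum_induction; auto.
Qed.

(** Two opposite sides are taken with their corners and the other two without, so that no lattice
    point is counted twice. *)
Definition square_shell {G : AbelianMonoid} (f : Z -> Z -> G) (N : nat) : G :=
  let m := Z.of_nat (S N) in
  plus (plus (zsum (f (- m)%Z) (S N)) (zsum (f m) (S N)))
       (zsum (fun p => plus (f p (- m)%Z) (f p m)) N).

Lemma square_sum_S {G : AbelianMonoid} (f : Z -> Z -> G) N :
  square_sum f (S N) = plus (square_sum f N) (square_shell f N).
Proof.
  unfold square_shell. set (m := Z.of_nat (S N)).
  rewrite !square_sum_zsum, zsum_S. fold m.
  rewrite (zsum_ext (fun p => zsum (f p) (S N))
            (fun p => plus (zsum (f p) N) (plus (f p (- m)%Z) (f p m)))).
  2:{ intros p _. rewrite zsum_S. fold m.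
      rewrite (plus_comm _ (zsum (f p) N)), <- plus_assoc. reflexivity. }
  rewrite zsum_plus.
  set (A := zsum _ N). set (B := zsum _ N). set (a := zsum _ (S N)). set (b := zsum _ (S N)).
  rewrite (plus_comm a), <- !plus_assoc. f_equal.
  rewrite (plus_comm B), <- plus_assoc. reflexivity.
Qed.

Lemma Cmod_le_plus (a c : C) (b d : R) :
  Cmod a <= b -> Cmod c <= d -> Cmod (Cplus a c) <= b + d.
Proof. intros; eapply Rle_trans; [apply Cmod_triangle | lra]. Qed.

Lemma square_shell_le (f : Z -> Z -> C) (g : Z -> Z -> R) N :
  (forall p q, Cmod (f p q) <= g p q) ->
  Cmod (square_shell (G := C_AbelianMonoid) f N)
  <= square_shell (G := R_AbelianMonoid) g N.
Proof.
  intros Hfg. unfold square_shell.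
  assert (P := Cmod_le_plus).
  apply P; [apply P|];
    apply (zsum_induction (G1 := C_AbelianMonoid) (G2 := R_AbelianMonoid)
             (fun a b => Cmod a <= b)); intros; try (apply P; auto); auto.
Qed.

(** Telescoping over the shells bounds increments by those of the majorant, so no rearrangement of a
    double series is ever needed. *)
Lemma csum_tail (f : Z -> Z -> C) (g : Z -> Z -> R) N d :
  (forall p q, Cmod (f p q) <= g p q) ->
  Cmod (Cminus (csum f (N + d)) (csum f N)) <= rsum g (N + d) - rsum g N.
Proof.
  intros Hfg. induction d as [|d IH].
  - rewrite Nat.add_0_r. replace (Cminus _ _) with (RtoC 0) by ring.
    rewrite Cmod_0. lra.
  - rewrite Nat.add_succ_r, !square_sum_S.
    set (n := (N + d)%nat) in *.
    assert (B := square_shell_le f g n Hfg).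
    change (@plus C_AbelianMonoid) with Cplus. change (@plus R_AbelianMonoid) with Rplus.
    set (sf := square_shell f n) in *. set (sg := square_shell g n) in *.
    replace (Cminus (Cplus (csum f n) sf) (csum f N))
      with (Cplus (Cminus (csum f n) (csum f N)) sf) by ring.
    eapply Rle_trans; [apply Cmod_triangle|].
    change (rsum g n + sg - rsum g N) with (Rminus (Rplus (rsum g n) sg) (rsum g N)).
    unfold Rminus in *. lra.
Qed.

Lemma csum_le (f : Z -> Z -> C) (g : Z -> Z -> R) N :
  (forall p q, Cmod (f p q) <= g p q) -> Cmod (csum f N) <= rsum g N.
Proof.
  intros Hfg. apply (square_sum_induction (G1 := C_AbelianMonoid) (G2 := R_AbelianMonoid)
             (fun a b => Cmod a <= b)); auto. intros; apply Cmod_le_plus; auto.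
Qed.

(** * Exponential weights on the lattice *)

Definition wt (r : R) (p q : Z) : R := r ^ (Z.abs_nat p + Z.abs_nat q).

Lemma wt_pos r p q : 0 < r -> 0 < wt r p q.
Proof. intros; now apply pow_lt. Qed.

Lemma zsum_geom r N : 0 < r < 1 ->
  zsum (G := R_AbelianMonoid) (fun p => r ^ Z.abs_nat p) N
  = (1 + r - 2 * r ^ (S N)) / (1 - r).
Proof.
  intros Hr. induction N as [|N IH].
  - rewrite zsum_0. simpl. field. lra.
  - rewrite zsum_S, IH.
    replace (Z.abs_nat (- Z.of_nat (S N))) with (S N) by lia.
    replace (Z.abs_nat (Z.of_nat (S N))) with (S N) by lia.
    change (@plus R_AbelianMonoid) with Rplus.
    simpl. field. lra.
Qed.

(** The weight is a product of a function of [p] and one of [q], so its square sum is the square of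
    a one-dimensional geometric sum. *)
Lemma rsum_wt r N : 0 < r < 1 ->
  rsum (wt r) N = ((1 + r - 2 * r ^ (S N)) / (1 - r)) ^ 2.
Proof.
  intros Hr. rewrite square_sum_zsum.
  rewrite <- (zsum_geom r N Hr).
  set (z := zsum _ N) at 2. simpl. rewrite Rmult_1_r.
  unfold z at 1. rewrite <- (zsum_scal_r (K := R_Ring)). apply zsum_ext; intros p _.
  unfold z. change (@mult R_Ring (r ^ Z.abs_nat p)) with (@mult R_Ring (r ^ Z.abs_nat p)).
  rewrite <- (zsum_scal_l (K := R_Ring)).
  apply zsum_ext; intros q _. apply pow_add.
Qed.

(** Total mass of the weight [wt r], and a bound for its mass outside the square
    of radius [N]. *)
Definition wt_mass (r : R) : R := ((1 + r) / (1 - r)) ^ 2.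
Definition wt_tail (r : R) (N : nat) : R := 4 * ((1 + r) / (1 - r) ^ 2) * r ^ S N.

(** With [t = r ^ S N], expand [(1 + r - 2 * t) ^ 2]: dropping [4 * t ^ 2] leaves the tail constant
    of the lower bound, and [t <= r] gives the upper one. *)
Lemma rsum_wt_bounds r N : 0 < r < 1 ->
  wt_mass r - wt_tail r N <= rsum (wt r) N <= wt_mass r.
Proof.
  intros Hr. rewrite rsum_wt by auto. unfold wt_mass, wt_tail.
  assert (Hp : 0 < r ^ S N) by (apply pow_lt; lra).
  assert (Hp1 : r ^ S N <= r).
  { simpl. assert (r ^ N <= 1) by (rewrite <- (pow1 N); apply pow_incr; lra). nra. }
  set (t := r ^ S N) in *.
  assert (Hi : 0 < / (1 - r)) by (apply Rinv_0_lt_compat; lra).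
  set (i := / (1 - r)) in *. unfold Rdiv.
  assert (Ei : / (1 - r) ^ 2 = i ^ 2) by (unfold i; field; lra).
  rewrite Ei. fold i.
  assert (0 < i ^ 2) by nra.
  split; nra.
Qed.

Lemma wt_tail_small r : 0 < r < 1 -> forall eps, 0 < eps ->
  exists N, forall n, (N <= n)%nat -> 0 <= wt_tail r n < eps.
Proof.
  intros Hr eps He. set (A := 4 * ((1 + r) / (1 - r) ^ 2)).
  assert (HA : 0 < A).
  { unfold A. apply Rmult_lt_0_compat; [lra|]. apply Rdiv_lt_0_compat; nra. }
  destruct (pow_lt_1_zero r) with (y := eps / A) as [N HN].
  { rewrite Rabs_pos_eq; lra. } { apply Rdiv_lt_0_compat; lra. }
  exists N. intros n Hn. specialize (HN (S n) ltac:(lia)).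
  assert (0 < r ^ S n) by (apply pow_lt; lra).
  rewrite Rabs_pos_eq in HN by lra. unfold wt_tail. fold A.
  split; [nra|]. replace eps with (A * (eps / A)) by (field; lra).
  apply Rmult_lt_compat_l; auto.
Qed.

(** * Convergent sums over the lattice *)

Definition gsum (f : Z -> Z -> C) (s : C) : Prop :=
  forall eps, 0 < eps -> exists N, forall n, (N <= n)%nat ->
    Cmod (Cminus (csum f n) s) < eps.

Lemma Cmod_le_abs (z : C) : Cmod z <= Rabs (Re z) + Rabs (Im z).
Proof.
  replace z with (Cplus (RtoC (Re z)) (Cmult Ci (RtoC (Im z)))) at 1.
  - eapply Rle_trans; [apply Cmod_triangle|].
    rewrite Cmod_mult, Cmod_Ci, !Cmod_R. lra.
  - destruct z as [a b]. unfold Cplus, Cmult, Ci, RtoC; simpl. f_equal; ring.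
Qed.

Lemma im_le_Cmod (z : C) : Rabs (Im z) <= Cmod z.
Proof. eapply Rle_trans; [|apply Rmax_Cmod]. apply Rmax_r. Qed.

Lemma eps_le (a b : R) : (forall eps, 0 < eps -> a <= b + eps) -> a <= b.
Proof. intros Hh. apply Rle_plus_epsilon. intros eps He. apply Hh, He. Qed.

(** The bounds on the tail and on the sum depend only on [K] and [r]. Applied at each point of the
    torus, they therefore give uniform convergence. *)
Lemma gsum_exists (f : Z -> Z -> C) (K r : R) : 0 < r < 1 ->
  (forall p q, Cmod (f p q) <= K * wt r p q) ->
  exists s, gsum f s /\ (forall N, Cmod (Cminus (csum f N) s) <= K * wt_tail r N) /\
    Cmod s <= K * wt_mass r.
Proof.
  intros Hr Hf.
  assert (K0 : 0 <= K).
  { specialize (Hf 0%Z 0%Z). unfold wt in Hf; simpl in Hf.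
    assert (Q := Cmod_ge_0 (f 0%Z 0%Z)). lra. }
  assert (Esc : forall n, rsum (fun p q => K * wt r p q) n = K * rsum (wt r) n)
    by (intros n; apply (square_sum_scal (K := R_Ring))).
  assert (T : forall N d, Cmod (Cminus (csum f (N + d)) (csum f N)) <= K * wt_tail r N).
  { intros N d. eapply Rle_trans; [apply csum_tail, Hf|].
    rewrite !Esc.
    assert (B1 := rsum_wt_bounds r N Hr). assert (B2 := rsum_wt_bounds r (N + d) Hr).
    change (K * rsum (wt r) (N+d) - K * rsum (wt r) N <= K * wt_tail r N).
    rewrite <- Rmult_minus_distr_l. apply Rmult_le_compat_l; auto. lra. }
  assert (Cau : forall (g : C -> R), (forall a b, Rabs (g a - g b) <= Cmod (Cminus a b)) ->
      ex_lim_seq_cauchy (fun n => g (csum f n))).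
  { intros g Hg eps.
    (* The [+ 1] keeps the quotient meaningful when [K = 0]; the same device recurs in later epsilon
       arguments. *)
    destruct (wt_tail_small r Hr (eps / (2 * (K + 1)))) as [N HN].
    { apply Rdiv_lt_0_compat; [apply cond_pos | lra]. }
    exists N. intros n m Hn Hm.
    assert (Hx : forall n, (N <= n)%nat -> Rabs (g (csum f n) - g (csum f N)) < eps / 2).
    { intros n0 Hn0. eapply Rle_lt_trans; [apply Hg|].
      replace n0 with (N + (n0 - N))%nat by lia.
      eapply Rle_lt_trans; [apply T|].
      specialize (HN N (le_n _)). assert (He := cond_pos eps).
      apply Rle_lt_trans with (K * (eps / (2 * (K + 1)))); [nra|].
      apply Rlt_le_trans with ((K + 1) * (eps / (2 * (K + 1)))).
      - apply Rmult_lt_compat_r; [apply Rdiv_lt_0_compat; lra | lra].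
      - right; field; lra. }
    assert (A1 := Hx n Hn). assert (A2 := Hx m Hm).
    apply Rabs_def2 in A1. apply Rabs_def2 in A2. apply Rabs_def1; lra. }
  assert (C1 := Cau Re). assert (C2 := Cau Im).
  apply ex_lim_seq_cauchy_corr in C1; [|intros a b; apply (re_le_Cmod (Cminus a b))].
  apply ex_lim_seq_cauchy_corr in C2; [|intros a b; apply (im_le_Cmod (Cminus a b))].
  destruct C1 as [l1 L1], C2 as [l2 L2].
  assert (G : gsum f (l1, l2)).
  { intros eps He.
    apply is_lim_seq_spec in L1. apply is_lim_seq_spec in L2.
    destruct (L1 (pos_div_2 (mkposreal _ He))) as [N1 H1].
    destruct (L2 (pos_div_2 (mkposreal _ He))) as [N2 H2].
    exists (N1 + N2)%nat. intros n Hn.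
    eapply Rle_lt_trans; [apply Cmod_le_abs|].
    specialize (H1 n ltac:(lia)). specialize (H2 n ltac:(lia)).
    change (Rabs (Re (Cminus (csum f n) (l1, l2))) < eps / 2) in H1.
    change (Rabs (Im (Cminus (csum f n) (l1, l2))) < eps / 2) in H2. lra. }
  exists (l1, l2). split; [auto|]. split.
  - intros N. apply eps_le. intros eps He.
    destruct (G eps He) as [M HM]. specialize (HM (N + M)%nat ltac:(lia)).
    specialize (T N M).
    replace (Cminus (csum f N) (l1, l2)) with
      (Cminus (Cminus (csum f (N + M)) (l1, l2)) (Cminus (csum f (N + M)) (csum f N))) by ring.
    unfold Cminus at 1. eapply Rle_trans; [apply Cmod_triangle|]. rewrite Cmod_opp. lra.
  - apply eps_le. intros eps He.
    destruct (G eps He) as [M HM]. specialize (HM M (le_n _)).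
    assert (B := csum_le f _ M Hf). rewrite Esc in B.
    assert (B1 := rsum_wt_bounds r M Hr).
    replace (l1, l2) with (Cminus (csum f M) (Cminus (csum f M) (l1, l2))) by ring.
    unfold Cminus at 1. eapply Rle_trans; [apply Cmod_triangle|]. rewrite Cmod_opp.
    assert (K * rsum (wt r) M <= K * wt_mass r) by (apply Rmult_le_compat_l; lra).
    unfold C, R_AbelianMonoid in *. simpl in *. lra.
Qed.

Lemma gsum_unique f s t : gsum f s -> gsum f t -> s = t.
Proof.
  intros Hs Ht. apply Ceq_minus, Cmod_eq_0. apply Rle_antisym; [|apply Cmod_ge_0].
  apply eps_le. intros eps He.
  destruct (Hs (eps / 2)) as [N1 H1]; [lra|]. destruct (Ht (eps / 2)) as [N2 H2]; [lra|].
  specialize (H1 (N1 + N2)%nat ltac:(lia)). specialize (H2 (N1 + N2)%nat ltac:(lia)).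
  set (n := (N1 + N2)%nat) in *.
  replace (Cminus s t) with (Cminus (Cminus (csum f n) t) (Cminus (csum f n) s)) by ring.
  unfold Cminus at 1. eapply Rle_trans; [apply Cmod_triangle|]. rewrite Cmod_opp. lra.
Qed.

Lemma gsum_ext f g s : (forall p q, f p q = g p q) -> gsum f s -> gsum g s.
Proof.
  intros E. replace g with f; auto.
  apply functional_extensionality; intros p; apply functional_extensionality; auto.
Qed.

Lemma gsum_plus f g s t : gsum f s -> gsum g t ->
  gsum (fun p q => Cplus (f p q) (g p q)) (Cplus s t).
Proof.
  intros Hs Ht eps He.
  destruct (Hs (eps / 2)) as [N1 H1]; [lra|]. destruct (Ht (eps / 2)) as [N2 H2]; [lra|].
  exists (N1 + N2)%nat. intros n Hn.
  specialize (H1 n ltac:(lia)). specialize (H2 n ltac:(lia)).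
  rewrite csum_plus.
  replace (Cminus _ _) with (Cplus (Cminus (csum f n) s) (Cminus (csum g n) t)) by ring.
  eapply Rle_lt_trans; [apply Cmod_triangle|]. lra.
Qed.

Lemma gsum_scal c f s : gsum f s -> gsum (fun p q => Cmult c (f p q)) (Cmult c s).
Proof.
  intros Hs eps He. assert (Hc := Cmod_ge_0 c).
  destruct (Hs (eps / (Cmod c + 1))) as [N1 H1]; [apply Rdiv_lt_0_compat; lra|].
  exists N1. intros n Hn. specialize (H1 n Hn).
  rewrite csum_scal.
  replace (Cminus _ _) with (Cmult c (Cminus (csum f n) s)) by ring.
  rewrite Cmod_mult.
  apply Rle_lt_trans with (Cmod c * (eps / (Cmod c + 1))).
  - apply Rmult_le_compat_l; lra.
  - apply Rlt_le_trans with ((Cmod c + 1) * (eps / (Cmod c + 1))).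
    + apply Rmult_lt_compat_r; [apply Rdiv_lt_0_compat; lra | lra].
    + right; field; lra.
Qed.

Lemma gsum_single (j1 j2 : Z) (f : Z -> Z -> C) :
  (forall p q, (p, q) <> (j1, j2) -> f p q = RtoC 0) -> gsum f (f j1 j2).
Proof.
  intros Hf.
  assert (Z1 : forall (g : Z -> C) N, (forall p, (Z.abs p <= Z.of_nat N)%Z -> g p = RtoC 0) ->
     zsum (G := C_AbelianMonoid) g N = RtoC 0).
  { intros g N Hg.
    apply (zsum_induction (G1 := C_AbelianMonoid) (G2 := C_AbelianMonoid)
      (fun a _ => a = RtoC 0) g g N); auto.
    intros a _ b _ -> ->. apply Cplus_0_l. }
  assert (Z2 : forall (g : Z -> C) j N, (forall p, p <> j -> g p = RtoC 0) ->
     (Z.abs j <= Z.of_nat N)%Z -> zsum (G := C_AbelianMonoid) g N = g j).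
  { intros g j N Hg. induction N as [|N IH]; intros Hj.
    - rewrite zsum_0. f_equal. lia.
    - rewrite zsum_S. change (@plus C_AbelianMonoid) with Cplus.
      destruct (Z_le_gt_dec (Z.abs j) (Z.of_nat N)) as [Hl|Hg'].
      + rewrite IH by auto. rewrite (Hg (- Z.of_nat (S N))%Z), (Hg (Z.of_nat (S N))) by lia. cring.
      + rewrite Z1 by (intros; apply Hg; lia).
        destruct (Z_le_gt_dec j 0) as [Hn|Hp].
        * rewrite (Hg (Z.of_nat (S N))) by lia.
          replace (- Z.of_nat (S N))%Z with j by lia. cring.
        * rewrite (Hg (- Z.of_nat (S N))%Z) by lia.
          replace (Z.of_nat (S N)) with j by lia. cring. }
  intros eps He. exists (Z.abs_nat j1 + Z.abs_nat j2)%nat. intros n Hn.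
  replace (csum f n) with (f j1 j2).
  { replace (Cminus _ _) with (RtoC 0) by ring. rewrite Cmod_0; auto. }
  symmetry. rewrite square_sum_zsum.
  rewrite (Z2 (fun p => zsum (f p) n) j1).
  - apply Z2; [|lia]. intros q Hq. apply Hf. congruence.
  - intros p Hp. apply Z1. intros q _. apply Hf. congruence.
  - lia.
Qed.

(** * The mean over the torus *)

(** [P0] is an iterated integral: uniformity makes the inner integral continuous in the outer
    variable, hence integrable. *)
Definition unif_cont (u : R -> R -> R) : Prop :=
  forall eps, 0 < eps -> exists d, 0 < d /\
    forall x y x' y', Rabs (x' - x) < d -> Rabs (y' - y) < d ->
      Rabs (u x' y' - u x y) < eps.

Lemma unif_cont_section u x y : unif_cont u -> continuous (u x) y.
Proof.
  intros Hu. apply filterlim_locally. intros eps.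
  destruct (Hu eps (cond_pos eps)) as [d [Hd B]].
  exists (mkposreal d Hd). intros y' Hy. apply B; [|apply Hy].
  rewrite Rminus_diag, Rabs_R0; auto.
Qed.

Lemma unif_cont_ex_RInt u x a b : unif_cont u -> ex_RInt (u x) a b.
Proof. intros Hu. apply (ex_RInt_continuous (V := R_CompleteNormedModule)). intros; now apply unif_cont_section. Qed.

Lemma unif_cont_scal c u : unif_cont u -> unif_cont (fun x y => c * u x y).
Proof.
  intros Hu eps He. assert (Hc := Rabs_pos c).
  destruct (Hu (eps / (Rabs c + 1))) as [d [D1 B1]]; [apply Rdiv_lt_0_compat; lra|].
  exists d. split; auto. intros x y x' y' Hx Hy.
  specialize (B1 x y x' y' Hx Hy).
  rewrite <- Rmult_minus_distr_l, Rabs_mult.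
  apply Rle_lt_trans with (Rabs c * (eps / (Rabs c + 1))).
  - apply Rmult_le_compat_l; lra.
  - apply Rlt_le_trans with ((Rabs c + 1) * (eps / (Rabs c + 1))).
    + apply Rmult_lt_compat_r; [apply Rdiv_lt_0_compat; lra | lra].
    + right; field; lra.
Qed.

Lemma two_PI_pos : 0 < 2 * PI.
Proof. assert (Q := PI_RGT_0). lra. Qed.

Lemma unif_cont_RInt u x : unif_cont u ->
  continuous (fun x => RInt (u x) 0 (2 * PI)) x.
Proof.
  intros Hu. assert (Q := two_PI_pos). apply filterlim_locally. intros eps.
  destruct (Hu (eps / (2 * (2 * PI)))) as [d [Hd B]].
  { apply Rdiv_lt_0_compat; [apply cond_pos | lra]. }
  exists (mkposreal d Hd). intros x' Hx.
  change (Rabs (RInt (u x') 0 (2 * PI) - RInt (u x) 0 (2 * PI)) < eps).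
  assert (E : RInt (fun y => u x' y - u x y) 0 (2 * PI)
              = RInt (u x') 0 (2 * PI) - RInt (u x) 0 (2 * PI)).
  { apply (RInt_minus (V := R_CompleteNormedModule));
      now apply unif_cont_ex_RInt. }
  rewrite <- E.
  eapply Rle_lt_trans; [apply abs_RInt_le_const with (M := eps / (2 * (2 * PI)))|].
  - lra.
  - apply (ex_RInt_minus (V := R_CompleteNormedModule)); now apply unif_cont_ex_RInt.
  - intros t _. apply Rlt_le, B; [apply Hx|]. rewrite Rminus_diag, Rabs_R0; auto.
  - assert (He := cond_pos eps).
    replace (_ * _) with (eps / 2) by (field; lra). lra.
Qed.

Lemma unif_cont_ex_RInt2 u a b : unif_cont u ->
  ex_RInt (fun x => RInt (u x) 0 (2 * PI)) a b.
Proof. intros Hu. apply (ex_RInt_continuous (V := R_CompleteNormedModule)). intros; now apply unif_cont_RInt. Qed.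

Lemma P0_plus u v : unif_cont u -> unif_cont v ->
  P0 (fun x y => u x y + v x y) = P0 u + P0 v.
Proof.
  intros Hu Hv. unfold P0.
  rewrite (RInt_ext (fun x => RInt (fun y => u x y + v x y) 0 (2 * PI))
     (fun x => RInt (u x) 0 (2 * PI) + RInt (v x) 0 (2 * PI))).
  2:{ intros x _. apply (RInt_plus (V := R_CompleteNormedModule));
      now apply unif_cont_ex_RInt. }
  rewrite (RInt_plus (V := R_CompleteNormedModule)
     (fun x => RInt (u x) 0 (2 * PI)) (fun x => RInt (v x) 0 (2 * PI)));
    try now apply unif_cont_ex_RInt2.
  apply Rmult_plus_distr_r.
Qed.

Lemma P0_scal c u : unif_cont u -> P0 (fun x y => c * u x y) = c * P0 u.
Proof.
  intros Hu. unfold P0.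
  rewrite (RInt_ext (fun x => RInt (fun y => c * u x y) 0 (2 * PI))
     (fun x => c * RInt (u x) 0 (2 * PI))).
  2:{ intros x _. apply (RInt_scal (V := R_CompleteNormedModule));
      now apply unif_cont_ex_RInt. }
  rewrite (RInt_scal (V := R_CompleteNormedModule)
     (fun x => RInt (u x) 0 (2 * PI)));
    try now apply unif_cont_ex_RInt2.
  apply Rmult_assoc.
Qed.

Lemma P0_const c : P0 (fun _ _ => c) = c.
Proof.
  assert (Q := two_PI_pos). unfold P0.
  rewrite (RInt_ext _ (fun x => 2 * PI * c)).
  2:{ intros x _. rewrite RInt_const. unfold scal; simpl. unfold mult; simpl. ring. }
  rewrite RInt_const. unfold scal; simpl. unfold mult; simpl. field. lra.
Qed.

Lemma P0_bound u M : unif_cont u -> (forall x y, Rabs (u x y) <= M) -> Rabs (P0 u) <= M.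
Proof.
  intros Hu HM. assert (Q := two_PI_pos). unfold P0.
  assert (B : Rabs (RInt (fun x => RInt (u x) 0 (2 * PI)) 0 (2 * PI))
     <= (2 * PI - 0) * ((2 * PI - 0) * M)).
  { apply abs_RInt_le_const; [lra | now apply unif_cont_ex_RInt2 |].
    intros x _. apply abs_RInt_le_const; [lra | now apply unif_cont_ex_RInt | auto]. }
  unfold Rdiv. rewrite Rabs_mult, (Rabs_pos_eq (/ _)).
  2:{ apply Rlt_le, Rinv_0_lt_compat, pow_lt; lra. }
  apply Rle_trans with ((2 * PI - 0) * ((2 * PI - 0) * M) * / (2 * PI) ^ 2).
  - apply Rmult_le_compat_r; auto. apply Rlt_le, Rinv_0_lt_compat, pow_lt; lra.
  - right. field. lra.
Qed.

Lemma RInt_pos_at (g : R -> R) (a b x0 : R) : a < x0 < b ->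
  (forall x, continuous g x) -> (forall x, 0 <= g x) -> 0 < g x0 -> 0 < RInt g a b.
Proof.
  intros Hx0 Hc Hg Hp.
  assert (Ex : forall a b, ex_RInt g a b) by (intros; apply (ex_RInt_continuous (V := R_CompleteNormedModule)); auto).
  destruct (proj1 (filterlim_locally g (g x0)) (Hc x0) (mkposreal _ Hp)) as [d Hd].
  set (e := Rmin (d / 2) (Rmin ((x0 - a) / 2) ((b - x0) / 2))).
  assert (E1 : e <= d / 2) by apply Rmin_l.
  assert (E2 : e <= (x0 - a) / 2) by (eapply Rle_trans; [apply Rmin_r | apply Rmin_l]).
  assert (E3 : e <= (b - x0) / 2) by (eapply Rle_trans; [apply Rmin_r | apply Rmin_r]).
  assert (E0 : 0 < e).
  { assert (Q := cond_pos d). repeat apply Rmin_pos; lra. }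
  rewrite <- (RInt_Chasles g a (x0 - e) b), <- (RInt_Chasles g (x0 - e) (x0 + e) b); auto.
  change (@plus _) with Rplus.
  assert (A1 : 0 <= RInt g a (x0 - e)) by (apply RInt_ge_0; auto; lra).
  assert (A2 : 0 <= RInt g (x0 + e) b) by (apply RInt_ge_0; auto; lra).
  assert (A3 : 0 < RInt g (x0 - e) (x0 + e)).
  { apply RInt_gt_0; auto; [lra|]. intros x Hx.
    assert (B : Rabs (g x - g x0) < g x0).
    { apply (Hd x). change (Rabs (x - x0) < d). assert (Q := cond_pos d).
      apply Rabs_def1; lra. }
    apply Rabs_def2 in B. lra. }
  change (0 < RInt g a (x0 - e) + (RInt g (x0 - e) (x0 + e) + RInt g (x0 + e) b)). lra.
Qed.

(** The point ([PI], [PI]) is the centre of the square of integration, so a neighbourhood lies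
    inside it; other points are brought there by translation. *)
Lemma P0_pos u : unif_cont u -> (forall x y, 0 <= u x y) -> 0 < u PI PI -> 0 < P0 u.
Proof.
  intros Hu Hp Hpi. assert (Q := PI_RGT_0). unfold P0.
  apply Rdiv_lt_0_compat; [|apply pow_lt; lra].
  apply RInt_pos_at with (x0 := PI); [lra | intros; now apply unif_cont_RInt | |].
  - intros x. apply RInt_ge_0; [lra | now apply unif_cont_ex_RInt | auto].
  - apply RInt_pos_at with (x0 := PI); [lra | intros; now apply unif_cont_section | auto | auto].
Qed.

Lemma cos_sin_period_Z (x : R) (n : Z) :
  cos (x + IZR n * (2 * PI)) = cos x /\ sin (x + IZR n * (2 * PI)) = sin x.
Proof.
  assert (P : forall (m : nat) x, cos (x + INR m * (2 * PI)) = cos x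
                               /\ sin (x + INR m * (2 * PI)) = sin x).
  { intros m y. replace (y + INR m * (2 * PI)) with (y + 2 * INR m * PI) by ring.
    split; [apply cos_period | apply sin_period]. }
  destruct (Z_le_gt_dec 0 n) as [Hn|Hn].
  - rewrite <- (Z2Nat.id n Hn), <- INR_IZR_INZ. apply P.
  - destruct (P (Z.to_nat (- n)) (x + IZR n * (2 * PI))) as [P1 P2].
    rewrite INR_IZR_INZ, Z2Nat.id, opp_IZR in P1, P2 by lia.
    replace (x + IZR n * (2 * PI) + - IZR n * (2 * PI)) with x in P1, P2 by ring.
    auto.
Qed.

Lemma RInt_cos_sin_period (a : R) (n : Z) : n <> 0%Z ->
  RInt (fun t => cos (a + IZR n * t)) 0 (2 * PI) = 0 /\
  RInt (fun t => sin (a + IZR n * t)) 0 (2 * PI) = 0.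
Proof.
  intros Hn. apply not_0_IZR in Hn.
  destruct (cos_sin_period_Z a n) as [Ec Es].
  split; apply is_RInt_unique.
  - replace 0 with (minus (sin (a + IZR n * (2 * PI)) / IZR n) (sin (a + IZR n * 0) / IZR n)) at 2.
    + apply (is_RInt_derive (fun t => sin (a + IZR n * t) / IZR n)).
      * intros x _. auto_derive; auto. field; auto.
      * intros x _. apply (ex_derive_continuous (fun t => cos (a + IZR n * t))). auto_derive; auto.
    + rewrite Es, Rmult_0_r, Rplus_0_r. apply Rminus_diag_eq; auto.
  - replace 0 with (minus (- cos (a + IZR n * (2 * PI)) / IZR n) (- cos (a + IZR n * 0) / IZR n)) at 2.
    + apply (is_RInt_derive (fun t => - cos (a + IZR n * t) / IZR n)).
      * intros x _. auto_derive; auto. field; auto.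
      * intros x _. apply (ex_derive_continuous (fun t => sin (a + IZR n * t))). auto_derive; auto.
    + rewrite Ec, Rmult_0_r, Rplus_0_r. apply Rminus_diag_eq; auto.
Qed.

Lemma P0_cos_sin (p q : Z) : (p, q) <> (0%Z, 0%Z) ->
  P0 (fun x y => cos (IZR p * x + IZR q * y)) = 0 /\
  P0 (fun x y => sin (IZR p * x + IZR q * y)) = 0.
Proof.
  intros Hpq. unfold P0.
  assert (Z0 : forall g : R -> R, (forall x, g x = 0) -> RInt g 0 (2 * PI) / (2 * PI) ^ 2 = 0).
  { intros g Hg. rewrite (RInt_ext _ (fun _ => 0)); auto.
    rewrite RInt_const. unfold scal; simpl. unfold mult; simpl. unfold Rdiv. ring. }
  (* If [q = 0] the inner integrand is constant and the outer integral vanishes; otherwise the inner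
     integral already does. *)
  destruct (Z.eq_dec q 0) as [->|Hq].
  - assert (Hp : p <> 0%Z) by (intros ->; auto).
    assert (Q := two_PI_pos).
    destruct (RInt_cos_sin_period 0 p Hp) as [E1 E2].
    assert (G : forall g : R -> R, (forall x, continuous g x) ->
      RInt (fun x => g (0 + IZR p * x)) 0 (2 * PI) = 0 ->
      RInt (fun x => RInt (fun y => g (IZR p * x + 0 * y)) 0 (2 * PI)) 0 (2 * PI) = 0).
    { intros g Hc Hg. rewrite (RInt_ext _ (fun x => scal (2 * PI) (g (0 + IZR p * x)))).
      - rewrite (RInt_scal (V := R_CompleteNormedModule) (fun x => g (0 + IZR p * x))).
        + rewrite Hg. apply Rmult_0_r.
        + apply (ex_RInt_continuous (V := R_CompleteNormedModule)). intros z _.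
          apply (continuous_comp (fun t => 0 + IZR p * t) g); [|apply Hc].
          apply (ex_derive_continuous (fun t => 0 + IZR p * t)). auto_derive; auto.
      - intros x _. rewrite (RInt_ext _ (fun _ => g (0 + IZR p * x))).
        + rewrite RInt_const, Rminus_0_r. reflexivity.
        + intros y _. apply f_equal. ring. }
    split.
    + rewrite (G cos continuous_cos E1). apply Rmult_0_l.
    + rewrite (G sin continuous_sin E2). apply Rmult_0_l.
  - split; apply Z0; intros x;
      destruct (RInt_cos_sin_period (IZR p * x) q Hq) as [E1 E2]; assumption.
Qed.

(** * Uniform limits of trigonometric polynomials *)

Ltac fext := let x := fresh "x" in let y := fresh "y" in
  apply functional_extensionality; intros x; apply functional_extensionality; intros y.

Lemma mode_mult p q p' q' x y :
  Cmult (mode p q x y) (mode p' q' x y) = mode (p + p') (q + q') x y.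
Proof.
  unfold mode, Cmult; simpl. rewrite !plus_IZR.
  replace ((IZR p + IZR p') * x + (IZR q + IZR q') * y)
    with ((IZR p * x + IZR q * y) + (IZR p' * x + IZR q' * y)) by ring.
  generalize (IZR p * x + IZR q * y) (IZR p' * x + IZR q' * y); intros s t.
  rewrite cos_plus, sin_plus. f_equal; ring.
Qed.

Lemma mode_conj p q x y : Cconj (mode p q x y) = mode (- p) (- q) x y.
Proof.
  unfold mode, Cconj; simpl. rewrite !opp_IZR.
  replace (- IZR p * x + - IZR q * y) with (- (IZR p * x + IZR q * y)) by ring.
  now rewrite cos_neg, sin_neg.
Qed.

Lemma mode_0 x y : mode 0 0 x y = RtoC 1.
Proof.
  unfold mode, RtoC. replace (0 * x + 0 * y) with 0 by ring.
  now rewrite cos_0, sin_0.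
Qed.

Lemma Cmod_mode p q x y : Cmod (mode p q x y) = 1.
Proof.
  unfold Cmod, mode; simpl. rewrite !Rmult_1_r, Rplus_comm.
  fold (Rsqr (cos (IZR p * x + IZR q * y))) (Rsqr (sin (IZR p * x + IZR q * y))).
  rewrite sin2_cos2. apply sqrt_1.
Qed.

Lemma mode_shift p q x y a b :
  mode p q (x + a) (y + b) = Cmult (mode p q a b) (mode p q x y).
Proof.
  unfold mode, Cmult; simpl.
  replace (IZR p * (x + a) + IZR q * (y + b))
    with ((IZR p * a + IZR q * b) + (IZR p * x + IZR q * y)) by ring.
  generalize (IZR p * a + IZR q * b) (IZR p * x + IZR q * y); intros s t.
  rewrite cos_plus, sin_plus. f_equal; ring.
Qed.

Lemma mode_period p q (m n : Z) x y :
  mode p q (x + IZR m * (2 * PI)) (y + IZR n * (2 * PI)) = mode p q x y.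
Proof.
  unfold mode.
  replace (IZR p * (x + IZR m * (2 * PI)) + IZR q * (y + IZR n * (2 * PI)))
    with ((IZR p * x + IZR q * y) + IZR (p * m + q * n) * (2 * PI))
    by (rewrite plus_IZR, !mult_IZR; ring).
  destruct (cos_sin_period_Z (IZR p * x + IZR q * y) (p * m + q * n)) as [-> ->]; auto.
Qed.

Lemma Cmod_minus_triangle a b c :
  Cmod (Cminus a c) <= Cmod (Cminus a b) + Cmod (Cminus b c).
Proof.
  replace (Cminus a c) with (Cplus (Cminus a b) (Cminus b c)) by ring.
  apply Cmod_triangle.
Qed.

Lemma Cmod_minus_sym a b : Cmod (Cminus a b) = Cmod (Cminus b a).
Proof. rewrite <- Cmod_opp. f_equal. ring. Qed.

(** Uniform limits of trigonometric polynomials on the torus with frequencies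
    in [Q]. *)
Inductive AP (Q : Z -> Z -> Prop) : (R -> R -> C) -> Prop :=
| AP_zero : AP Q (fun _ _ => RtoC 0)
| AP_mode c p q : Q p q -> AP Q (fun x y => Cmult c (mode p q x y))
| AP_plus F G : AP Q F -> AP Q G -> AP Q (fun x y => Cplus (F x y) (G x y))
| AP_lim F (G : nat -> R -> R -> C) :
    (forall n, AP Q (G n)) ->
    (forall n x y, Cmod (Cminus (F x y) (G n x y)) <= / INR (S n)) -> AP Q F.

(** No restriction on the spectrum: [AP Any] is the algebra of all continuous functions on the
    torus. *)
Definition Any (p q : Z) : Prop := True.

Lemma inv_INR_pos n : 0 < / INR (S n).
Proof. apply Rinv_0_lt_compat, lt_0_INR. lia. Qed.

Lemma inv_INR_small eps : 0 < eps -> exists n, / INR (S n) < eps.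
Proof.
  intros He. destruct (archimed_cor1 eps He) as [n [Hn Hp]].
  exists (pred n). now replace (S (pred n)) with n by lia.
Qed.

Lemma AP_ext Q F G : (forall x y, F x y = G x y) -> AP Q F -> AP Q G.
Proof. intros E. replace G with F; auto. fext; auto. Qed.

(** The constructor wants a sequence with the fixed rate [/ INR (S n)]; choice extracts one from
    approximations at every precision. *)
Lemma AP_lim_eps Q F :
  (forall eps, 0 < eps -> exists G, AP Q G /\
     forall x y, Cmod (Cminus (F x y) (G x y)) <= eps) -> AP Q F.
Proof.
  intros Hl.
  set (g := fun n => constructive_indefinite_description _ (Hl _ (inv_INR_pos n))).
  apply AP_lim with (fun n => proj1_sig (g n)); intros n; apply (proj2_sig (g n)).
Qed.

Lemma AP_mono (Q Q' : Z -> Z -> Prop) F :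
  (forall p q, Q p q -> Q' p q) -> AP Q F -> AP Q' F.
Proof.
  intros HQ HF. induction HF.
  - apply AP_zero.
  - apply AP_mode; auto.
  - apply AP_plus; auto.
  - eapply AP_lim; eauto.
Qed.

Lemma AP_Any Q F : AP Q F -> AP Any F.
Proof. apply AP_mono. intros; exact I. Qed.

Lemma AP_scal Q c F : AP Q F -> AP Q (fun x y => Cmult c (F x y)).
Proof.
  intros HF. induction HF.
  - apply AP_ext with (fun _ _ => RtoC 0); [intros; ring | apply AP_zero].
  - apply AP_ext with (fun x y => Cmult (Cmult c c0) (mode p q x y));
      [intros; ring | now apply AP_mode].
  - apply AP_ext with (fun x y => Cplus (Cmult c (F x y)) (Cmult c (G x y)));
      [intros; ring | now apply AP_plus].
  - apply AP_lim_eps. intros eps He. assert (Hc := Cmod_ge_0 c).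
    destruct (inv_INR_small (eps / (Cmod c + 1))) as [n Hn];
      [apply Rdiv_lt_0_compat; lra|].
    exists (fun x y => Cmult c (G n x y)). split; auto. intros x y.
    replace (Cminus _ _) with (Cmult c (Cminus (F x y) (G n x y))) by ring.
    rewrite Cmod_mult.
    apply Rle_trans with ((Cmod c + 1) * (eps / (Cmod c + 1))); [|right; field; lra].
    specialize (H1 n x y).
    apply Rmult_le_compat; try apply Cmod_ge_0; lra.
Qed.

Lemma AP_opp Q F : AP Q F -> AP Q (fun x y => Copp (F x y)).
Proof.
  intros HF. apply AP_ext with (fun x y => Cmult (RtoC (-1)) (F x y)); [|now apply AP_scal].
  intros. change (RtoC (-1)) with (RtoC (- (1))). rewrite RtoC_opp. ring.
Qed.

Lemma AP_minus Q F G : AP Q F -> AP Q G -> AP Q (fun x y => Cminus (F x y) (G x y)).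
Proof. intros HF HG. apply AP_plus; auto. now apply AP_opp. Qed.

Lemma AP_bounded Q F : AP Q F -> exists M, 0 < M /\ forall x y, Cmod (F x y) <= M.
Proof.
  intros HF. induction HF.
  - exists 1. split; [lra|]. intros. rewrite Cmod_0. lra.
  - exists (Cmod c + 1). assert (Hc := Cmod_ge_0 c). split; [lra|].
    intros. rewrite Cmod_mult, Cmod_mode. lra.
  - destruct IHHF1 as [M [M0 HM]], IHHF2 as [M' [M0' HM']].
    exists (M + M'). split; [lra|]. intros. apply Cmod_le_plus; auto.
  - destruct (H0 0%nat) as [M [M0 HM]]. exists (M + 1). split; [lra|]. intros x y.
    specialize (H1 0%nat x y). simpl in H1. rewrite Rinv_1 in H1.
    replace (F x y) with (Cplus (G 0%nat x y) (Cminus (F x y) (G 0%nat x y))) by ring.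
    apply Cmod_le_plus; auto.
Qed.

Lemma AP_const (Q : Z -> Z -> Prop) c : Q 0%Z 0%Z -> AP Q (fun _ _ => c).
Proof.
  intros HQ. apply AP_ext with (fun x y => Cmult c (mode 0 0 x y)).
  - intros. rewrite mode_0. ring.
  - now apply AP_mode.
Qed.

Definition additive (Q : Z -> Z -> Prop) : Prop :=
  forall p q p' q', Q p q -> Q p' q' -> Q (p + p')%Z (q + q')%Z.

Lemma additive_Any : additive Any.
Proof. repeat intro. exact I. Qed.

(** Multiplying by a bounded function preserves uniform approximation. This is the limit case of
    both inductions in [AP_mult]. *)
Lemma AP_uniform_mult Q F (G : nat -> R -> R -> C) K :
  AP Any K ->
  (forall n x y, Cmod (Cminus (F x y) (G n x y)) <= / INR (S n)) ->
  (forall n, AP Q (fun x y => Cmult (G n x y) (K x y))) ->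
  AP Q (fun x y => Cmult (F x y) (K x y)).
Proof.
  intros HK HG HP. destruct (AP_bounded _ _ HK) as [M [M0 HM]].
  apply AP_lim_eps. intros eps He.
  destruct (inv_INR_small (eps / M)) as [n Hn]; [apply Rdiv_lt_0_compat; lra|].
  exists (fun x y => Cmult (G n x y) (K x y)). split; auto. intros x y.
  replace (Cminus _ _) with (Cmult (Cminus (F x y) (G n x y)) (K x y)) by ring.
  rewrite Cmod_mult.
  replace eps with (eps / M * M) by (field; lra).
  specialize (HG n x y).
  apply Rmult_le_compat; try apply Cmod_ge_0; auto. lra.
Qed.

(** The outer induction reduces [F] to one mode, the inner one reduces [G] to another; frequencies
    of modes add under multiplication, which is what [additive] is for. *)
Lemma AP_mult Q F G : additive Q -> AP Q F -> AP Q G ->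
  AP Q (fun x y => Cmult (F x y) (G x y)).
Proof.
  intros HQ HF HG. induction HF.
  - apply AP_ext with (fun _ _ => RtoC 0); [intros; ring | apply AP_zero].
  - apply AP_ext with (fun x y => Cmult c (Cmult (G x y) (mode p q x y))); [intros; ring|].
    apply AP_scal. assert (HM : AP Any (mode p q)).
    { apply AP_ext with (fun x y => Cmult (RtoC 1) (mode p q x y)); [intros; ring|].
      apply AP_mode. exact I. }
    induction HG.
    + apply AP_ext with (fun _ _ => RtoC 0); [intros; ring | apply AP_zero].
    + apply AP_ext with (fun x y => Cmult c0 (mode (p0 + p) (q0 + q) x y)).
      * intros. rewrite <- mode_mult. ring.
      * apply AP_mode. auto.
    + apply AP_ext with (fun x y => Cplus (Cmult (F x y) (mode p q x y))
          (Cmult (G x y) (mode p q x y))); [intros; ring | now apply AP_plus].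
    + eapply AP_uniform_mult; eauto.
  - apply AP_ext with (fun x y => Cplus (Cmult (F x y) (G x y)) (Cmult (G0 x y) (G x y)));
      [intros; ring | now apply AP_plus].
  - eapply AP_uniform_mult; eauto. eapply AP_Any; eauto.
Qed.

Lemma AP_shift Q F a b : AP Q F -> AP Q (fun x y => F (x + a) (y + b)).
Proof.
  intros HF. induction HF.
  - apply AP_zero.
  - apply AP_ext with (fun x y => Cmult (Cmult c (mode p q a b)) (mode p q x y)).
    + intros. rewrite mode_shift. ring.
    + now apply AP_mode.
  - now apply (AP_plus Q (fun x y => F (x + a) (y + b)) (fun x y => G (x + a) (y + b))).
  - apply AP_lim with (fun n x y => G n (x + a) (y + b)); auto.
Qed.

Lemma AP_conj Q F : AP Q F -> AP Any (fun x y => Cconj (F x y)).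
Proof.
  intros HF. induction HF.
  - apply AP_ext with (fun _ _ => RtoC 0); [|apply AP_zero].
    intros. unfold Cconj, RtoC; simpl. f_equal. ring.
  - apply AP_ext with (fun x y => Cmult (Cconj c) (mode (- p) (- q) x y)).
    + intros. now rewrite Cmult_conj, mode_conj.
    + apply AP_mode. exact I.
  - apply AP_ext with (fun x y => Cplus (Cconj (F x y)) (Cconj (G x y))).
    + intros. now rewrite Cplus_conj.
    + now apply AP_plus.
  - apply AP_lim with (fun n x y => Cconj (G n x y)); auto.
    intros. rewrite <- Cminus_conj, Cmod_conj. auto.
Qed.

Lemma AP_period Q F : AP Q F -> forall (m n : Z) x y,
  F (x + IZR m * (2 * PI)) (y + IZR n * (2 * PI)) = F x y.
Proof.
  intros HF m n x y. induction HF.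
  - auto.
  - now rewrite mode_period.
  - congruence.
  - apply Ceq_minus, Cmod_eq_0, Rle_antisym; [|apply Cmod_ge_0].
    apply eps_le. intros eps He. destruct (inv_INR_small (eps / 2)) as [k Hk]; [lra|].
    assert (A1 := H1 k (x + IZR m * (2 * PI)) (y + IZR n * (2 * PI))).
    assert (A2 := H1 k x y). rewrite H0 in A1.
    eapply Rle_trans; [apply (Cmod_minus_triangle _ (G k x y))|].
    rewrite (Cmod_minus_sym (G k x y)). lra.
Qed.

Definition unif_contC (F : R -> R -> C) : Prop :=
  forall eps, 0 < eps -> exists d, 0 < d /\
    forall x y x' y', Rabs (x' - x) < d -> Rabs (y' - y) < d ->
      Cmod (Cminus (F x' y') (F x y)) < eps.

(** Follows from [1 - cos x = 2 * sin (x / 2) ^ 2] and the bound of |sin t| by |t|. *)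
Lemma one_minus_cos_le x : 1 - cos x <= x ^ 2 / 2.
Proof.
  replace x with (2 * (x / 2)) at 1 by field. rewrite cos_2a_sin.
  assert (A : Rabs (sin (x / 2)) <= Rabs (x / 2)).
  { assert (Hn : forall t, 0 <= t -> sin t <= t).
    { intros t [Ht|<-]; [apply Rlt_le, sin_lt_x; auto | rewrite sin_0; lra]. }
    assert (Hm : forall t, 0 <= t -> - t <= sin t).
    { intros t Ht. destruct (Rle_dec t PI).
      - assert (0 <= sin t) by (apply sin_ge_0; auto). lra.
      - assert (A1 := SIN_bound t). assert (A2 := PI_RGT_0).
        assert (A3 := PI2_1). lra. }
    destruct (Rle_dec 0 (x / 2)) as [Hx|Hx].
    - rewrite (Rabs_pos_eq (x / 2)) by auto. apply Rabs_le.
      specialize (Hn _ Hx). specialize (Hm _ Hx). lra.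
    - rewrite (Rabs_left (x / 2)) by lra.
      specialize (Hn (- (x / 2)) ltac:(lra)). specialize (Hm (- (x / 2)) ltac:(lra)).
      rewrite sin_neg in Hn, Hm. apply Rabs_le. lra. }
  assert (B := Rsqr_le_abs_1 _ _ A). unfold Rsqr in B. nra.
Qed.

Lemma cos_sin_Lipschitz a : Rabs (cos a - 1) <= Rabs a /\ Rabs (sin a) <= Rabs a.
Proof.
  assert (B := one_minus_cos_le a). assert (Bc := COS_bound a).
  assert (Bs := sin2_cos2 a). unfold Rsqr in Bs.
  assert (As : (sin a)² <= a²) by (unfold Rsqr; nra).
  assert (Ac : (cos a - 1)² <= a²) by (unfold Rsqr; nra).
  split; apply Rsqr_le_abs_0; auto.
Qed.

Lemma mode_Lipschitz p q a b :
  Cmod (Cminus (mode p q a b) (RtoC 1)) <= 2 * (Rabs (IZR p) * Rabs a + Rabs (IZR q) * Rabs b).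
Proof.
  eapply Rle_trans; [apply Cmod_le_abs|].
  unfold mode; simpl. set (s := IZR p * a + IZR q * b).
  destruct (cos_sin_Lipschitz s) as [A B].
  change (Rabs (cos s - 1) + Rabs (sin s + - 0)
    <= 2 * (Rabs (IZR p) * Rabs a + Rabs (IZR q) * Rabs b)).
  rewrite Ropp_0, Rplus_0_r.
  assert (D : Rabs s <= Rabs (IZR p) * Rabs a + Rabs (IZR q) * Rabs b).
  { unfold s. rewrite <- !Rabs_mult. apply Rabs_triang. }
  lra.
Qed.

Lemma AP_unif_cont Q F : AP Q F -> unif_contC F.
Proof.
  intros HF. induction HF; intros eps He.
  - exists 1. split; [lra|]. intros. replace (Cminus _ _) with (RtoC 0) by ring.
    rewrite Cmod_0; auto.
  (* A Lipschitz constant of the mode times [c], enlarged to stay positive when [c] or both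
     frequencies vanish. *)
  - set (L := 2 * (Cmod c + 1) * (Rabs (IZR p) + Rabs (IZR q) + 1)).
    assert (Hc := Cmod_ge_0 c). assert (Hp := Rabs_pos (IZR p)). assert (Hq := Rabs_pos (IZR q)).
    assert (L0 : 0 < L) by (unfold L; nra).
    assert (D0 : 0 < eps / L) by (apply Rdiv_lt_0_compat; auto).
    exists (eps / L). split; auto. intros x y x' y' Hx Hy.
    replace x' with (x + (x' - x)) by ring. replace y' with (y + (y' - y)) by ring.
    rewrite mode_shift.
    replace (Cminus _ _) with
      (Cmult (Cmult c (mode p q x y)) (Cminus (mode p q (x' - x) (y' - y)) (RtoC 1))) by ring.
    rewrite !Cmod_mult, Cmod_mode, Rmult_1_r.
    assert (A := mode_Lipschitz p q (x' - x) (y' - y)).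
    assert (B : Rabs (IZR p) * Rabs (x' - x) + Rabs (IZR q) * Rabs (y' - y)
       <= (Rabs (IZR p) + Rabs (IZR q)) * (eps / L)) by nra.
    apply Rle_lt_trans with (Cmod c * (2 * ((Rabs (IZR p) + Rabs (IZR q)) * (eps / L)))).
    + apply Rmult_le_compat_l; lra.
    + replace eps with (L * (eps / L)) at 2 by (field; lra). unfold L at 2.
      set (e := eps / L) in *. set (P := Rabs (IZR p) + Rabs (IZR q)) in *.
      assert (0 <= P) by (unfold P; lra).
      assert (Cmod c * P < (Cmod c + 1) * (P + 1)) by nra. nra.
  - destruct (IHHF1 (eps / 2)) as [d1 [D1 B1]]; [lra|].
    destruct (IHHF2 (eps / 2)) as [d2 [D2 B2]]; [lra|].
    exists (Rmin d1 d2). split; [now apply Rmin_pos|].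
    intros x y x' y' Hx Hy.
    assert (A := Rmin_l d1 d2). assert (A' := Rmin_r d1 d2).
    specialize (B1 x y x' y' ltac:(lra) ltac:(lra)).
    specialize (B2 x y x' y' ltac:(lra) ltac:(lra)).
    replace (Cminus _ _) with
      (Cplus (Cminus (F x' y') (F x y)) (Cminus (G x' y') (G x y))) by ring.
    eapply Rle_lt_trans; [apply Cmod_triangle|]. lra.
  - destruct (inv_INR_small (eps / 3)) as [k Hk]; [lra|].
    destruct (H0 k (eps / 3)) as [d [D1 B1]]; [lra|].
    exists d. split; auto. intros x y x' y' Hx Hy. specialize (B1 x y x' y' Hx Hy).
    assert (A1 := H1 k x y). assert (A2 := H1 k x' y').
    eapply Rle_lt_trans; [apply (Cmod_minus_triangle _ (G k x' y'))|].
    eapply Rle_lt_trans; [apply Rplus_le_compat_l, (Cmod_minus_triangle _ (G k x y))|].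
    rewrite (Cmod_minus_sym (G k x y)). lra.
Qed.

Lemma AP_unif_cont_Re Q F : AP Q F -> unif_cont (fun x y => Re (F x y)).
Proof.
  intros HF eps He. destruct (AP_unif_cont _ _ HF eps He) as [d [D B]].
  exists d. split; auto. intros x y x' y' Hx Hy.
  eapply Rle_lt_trans; [apply (re_le_Cmod (Cminus (F x' y') (F x y)))|auto].
Qed.

Lemma AP_unif_cont_Im Q F : AP Q F -> unif_cont (fun x y => Im (F x y)).
Proof.
  intros HF eps He. destruct (AP_unif_cont _ _ HF eps He) as [d [D B]].
  exists d. split; auto. intros x y x' y' Hx Hy.
  eapply Rle_lt_trans; [apply (im_le_Cmod (Cminus (F x' y') (F x y)))|auto].
Qed.

(** * Fourier coefficients *)

Definition cmean (F : R -> R -> C) : C :=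
  (P0 (fun x y => Re (F x y)), P0 (fun x y => Im (F x y))).

Lemma cmean_ext F G : (forall x y, F x y = G x y) -> cmean F = cmean G.
Proof. intros E. f_equal. fext; auto. Qed.

Lemma cmean_plus F G : AP Any F -> AP Any G ->
  cmean (fun x y => Cplus (F x y) (G x y)) = Cplus (cmean F) (cmean G).
Proof.
  intros HF HG. unfold cmean, Cplus; simpl. f_equal; apply P0_plus;
    (eapply AP_unif_cont_Re; eassumption) || (eapply AP_unif_cont_Im; eassumption).
Qed.

Lemma cmean_scal c F : AP Any F ->
  cmean (fun x y => Cmult c (F x y)) = Cmult c (cmean F).
Proof.
  intros HF. assert (H1 := AP_unif_cont_Re _ _ HF). assert (H2 := AP_unif_cont_Im _ _ HF).
  destruct c as [a b]. unfold cmean, Cmult; simpl. f_equal.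
  - replace (fun x y => a * fst (F x y) - b * snd (F x y))
      with (fun x y => a * Re (F x y) + (- b) * Im (F x y)) by (fext; unfold Re, Im; ring).
    rewrite P0_plus, !P0_scal by (try apply unif_cont_scal; assumption). ring.
  - replace (fun x y => a * snd (F x y) + b * fst (F x y))
      with (fun x y => a * Im (F x y) + b * Re (F x y)) by (fext; unfold Re, Im; ring).
    rewrite P0_plus, !P0_scal by (try apply unif_cont_scal; assumption). ring.
Qed.

Lemma cmean_minus F G : AP Any F -> AP Any G ->
  cmean (fun x y => Cminus (F x y) (G x y)) = Cminus (cmean F) (cmean G).
Proof.
  intros HF HG.
  rewrite (cmean_ext _ (fun x y => Cplus (F x y) (Cmult (RtoC (-1)) (G x y)))).
  - rewrite cmean_plus, cmean_scal by (try apply AP_scal; assumption).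
    change (RtoC (-1)) with (RtoC (- (1))). rewrite RtoC_opp. ring.
  - intros. change (RtoC (-1)) with (RtoC (- (1))). rewrite RtoC_opp. ring.
Qed.

(** The factor 2 comes from bounding real and imaginary parts separately; it affects only constants
    later on. *)
Lemma cmean_bound F M : AP Any F -> (forall x y, Cmod (F x y) <= M) ->
  Cmod (cmean F) <= 2 * M.
Proof.
  intros HF HM. eapply Rle_trans; [apply Cmod_le_abs|].
  assert (Rabs (Re (cmean F)) <= M).
  { apply P0_bound; [eapply AP_unif_cont_Re; eassumption|].
    intros. eapply Rle_trans; [apply re_le_Cmod | auto]. }
  assert (Rabs (Im (cmean F)) <= M).
  { apply P0_bound; [eapply AP_unif_cont_Im; eassumption|].
    intros. eapply Rle_trans; [apply im_le_Cmod | auto]. }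
  lra.
Qed.

Lemma cmean_mode p q : (p, q) <> (0%Z, 0%Z) -> cmean (mode p q) = RtoC 0.
Proof. intros Hpq. destruct (P0_cos_sin p q Hpq) as [E1 E2]. unfold cmean. simpl.
  rewrite E1, E2. reflexivity.
Qed.

Lemma cmean_const c : cmean (fun _ _ => c) = c.
Proof. unfold cmean. rewrite !P0_const. now destruct c. Qed.

Lemma cmean_mode_0 : cmean (mode 0 0) = RtoC 1.
Proof. rewrite (cmean_ext _ (fun _ _ => RtoC 1)); [apply cmean_const | apply mode_0]. Qed.

Lemma AP_mode1 (Q : Z -> Z -> Prop) p q : Q p q -> AP Q (mode p q).
Proof.
  intros HQ. apply AP_ext with (fun x y => Cmult (RtoC 1) (mode p q x y)); [intros; ring|].
  now apply AP_mode.
Qed.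

Lemma cmean_lim F (G : nat -> R -> R -> C) c :
  AP Any F -> (forall n, AP Any (G n)) ->
  (forall n x y, Cmod (Cminus (F x y) (G n x y)) <= / INR (S n)) ->
  (forall n, cmean (G n) = c) -> cmean F = c.
Proof.
  intros HF HG Hl Hc. apply Ceq_minus, Cmod_eq_0, Rle_antisym; [|apply Cmod_ge_0].
  apply eps_le. intros eps He. destruct (inv_INR_small (eps / 2)) as [k Hk]; [lra|].
  rewrite <- (Hc k), <- cmean_minus by auto.
  eapply Rle_trans; [apply cmean_bound with (M := / INR (S k))|]; auto.
  - now apply AP_minus.
  - lra.
Qed.

(** No change of variables in the integrals: a translation multiplies a mode by a constant, which is
    1 for the constant mode and irrelevant for the others, whose mean is zero. *)
Lemma cmean_shift Q F a b : AP Q F -> cmean (fun x y => F (x + a) (y + b)) = cmean F.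
Proof.
  intros HF. induction HF.
  - reflexivity.
  - rewrite (cmean_ext _ (fun x y => Cmult (Cmult c (mode p q a b)) (mode p q x y)))
      by (intros; rewrite mode_shift; ring).
    rewrite !cmean_scal by (apply AP_mode1; exact I).
    destruct (classic ((p, q) = (0%Z, 0%Z))) as [E|E].
    + injection E; intros -> ->. rewrite mode_0. ring.
    + rewrite cmean_mode by auto. ring.
  - apply AP_Any in HF1. apply AP_Any in HF2.
    rewrite (cmean_plus (fun x y => F (x + a) (y + b)) (fun x y => G (x + a) (y + b)))
      by now apply AP_shift.
    rewrite cmean_plus by assumption. congruence.
  - assert (HA : forall n, AP Any (G n)) by (intros; eapply AP_Any; eauto).
    assert (HF : AP Any F) by (apply AP_lim with G; auto).
    apply Ceq_minus, Cmod_eq_0, Rle_antisym; [|apply Cmod_ge_0].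
    apply eps_le. intros eps He. destruct (inv_INR_small (eps / 4)) as [k Hk]; [lra|].
    eapply Rle_trans; [apply (Cmod_minus_triangle _ (cmean (G k)))|].
    rewrite <- (H0 k) at 1.
    rewrite <- (cmean_minus (fun x y => F (x + a) (y + b)) (fun x y => G k (x + a) (y + b)))
      by now apply AP_shift.
    rewrite <- cmean_minus by auto.
    assert (A1 : Cmod (cmean (fun x y => Cminus (F (x + a) (y + b)) (G k (x + a) (y + b))))
      <= 2 * / INR (S k)).
    { apply cmean_bound; auto.
      apply (AP_minus Any (fun x y => F (x + a) (y + b)) (fun x y => G k (x + a) (y + b)));
        now apply AP_shift. }
    assert (A2 : Cmod (cmean (fun x y => Cminus (G k x y) (F x y))) <= 2 * / INR (S k)).
    { apply cmean_bound; [now apply AP_minus|]. intros. rewrite Cmod_minus_sym. auto. }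
    lra.
Qed.

Definition coef (F : R -> R -> C) (p q : Z) : C :=
  cmean (fun x y => Cmult (F x y) (mode (- p) (- q) x y)).

Lemma AP_mult_mode F p q : AP Any F -> AP Any (fun x y => Cmult (F x y) (mode p q x y)).
Proof.
  intros HF. apply AP_mult; [apply additive_Any | auto | apply AP_mode1; exact I].
Qed.

Lemma coef_ext F G p q : (forall x y, F x y = G x y) -> coef F p q = coef G p q.
Proof. intros E. apply cmean_ext. intros. now rewrite E. Qed.

Lemma coef_plus F G p q : AP Any F -> AP Any G ->
  coef (fun x y => Cplus (F x y) (G x y)) p q = Cplus (coef F p q) (coef G p q).
Proof.
  intros HF HG. unfold coef. rewrite <- cmean_plus by now apply AP_mult_mode.
  apply cmean_ext. intros. ring.
Qed.

Lemma coef_scal c F p q : AP Any F ->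
  coef (fun x y => Cmult c (F x y)) p q = Cmult c (coef F p q).
Proof.
  intros HF. unfold coef. rewrite <- cmean_scal by now apply AP_mult_mode.
  apply cmean_ext. intros. ring.
Qed.

Lemma coef_minus F G p q : AP Any F -> AP Any G ->
  coef (fun x y => Cminus (F x y) (G x y)) p q = Cminus (coef F p q) (coef G p q).
Proof.
  intros HF HG. unfold coef. rewrite <- cmean_minus by now apply AP_mult_mode.
  apply cmean_ext. intros. ring.
Qed.

Lemma coef_bound F M p q : AP Any F -> (forall x y, Cmod (F x y) <= M) ->
  Cmod (coef F p q) <= 2 * M.
Proof.
  intros HF HM. apply cmean_bound; [now apply AP_mult_mode|].
  intros. now rewrite Cmod_mult, Cmod_mode, Rmult_1_r.
Qed.

Lemma coef_mode_ne p q p' q' : (p, q) <> (p', q') -> coef (mode p q) p' q' = RtoC 0.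
Proof.
  intros Hne. unfold coef.
  rewrite (cmean_ext _ (mode (p - p') (q - q'))) by (intros; apply mode_mult).
  apply cmean_mode. intros E. injection E; intros. apply Hne. f_equal; lia.
Qed.

Lemma coef_mode_eq p q : coef (mode p q) p q = RtoC 1.
Proof.
  unfold coef. rewrite (cmean_ext _ (mode 0 0)); [apply cmean_mode_0|].
  intros. rewrite mode_mult. f_equal; lia.
Qed.

Lemma coef_lim F (G : nat -> R -> R -> C) c p q :
  AP Any F -> (forall n, AP Any (G n)) ->
  (forall n x y, Cmod (Cminus (F x y) (G n x y)) <= / INR (S n)) ->
  (forall n, coef (G n) p q = c) -> coef F p q = c.
Proof.
  intros HF HG Hl Hc.
  apply cmean_lim with (fun n x y => Cmult (G n x y) (mode (- p) (- q) x y)).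
  - now apply AP_mult_mode.
  - intros n. now apply AP_mult_mode.
  - intros n x y.
    replace (Cminus (Cmult (F x y) (mode (- p) (- q) x y)) (Cmult (G n x y) (mode (- p) (- q) x y)))
      with (Cmult (Cminus (F x y) (G n x y)) (mode (- p) (- q) x y)) by ring.
    rewrite Cmod_mult, Cmod_mode, Rmult_1_r. apply Hl.
  - exact Hc.
Qed.

Lemma coef_0 p q : coef (fun _ _ => RtoC 0) p q = RtoC 0.
Proof. unfold coef. rewrite (cmean_ext _ (fun _ _ => RtoC 0)) by (intros; ring). apply cmean_const. Qed.

(** Orthogonality of modes, kept by uniform limits. This turns membership in [AP Q] into a statement
    about coefficients. *)
Lemma coef_off Q F p q : AP Q F -> ~ Q p q -> coef F p q = RtoC 0.
Proof.
  intros HF HQ. induction HF.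
  - apply coef_0.
  - rewrite coef_scal by (apply AP_mode1; exact I). rewrite coef_mode_ne; [ring | congruence].
  - rewrite coef_plus by (eapply AP_Any; eauto). rewrite IHHF1, IHHF2. ring.
  - apply coef_lim with G; auto.
    + apply AP_lim with G; auto. intros; eapply AP_Any; eauto.
    + intros; eapply AP_Any; eauto.
Qed.

Lemma AP_orthogonal D G : AP Any D -> (forall p q, coef D p q = RtoC 0) -> AP Any G ->
  cmean (fun x y => Cmult (D x y) (Cconj (G x y))) = RtoC 0.
Proof.
  intros HD H0 HG. destruct (AP_bounded _ _ HD) as [M [M0 HM]].
  assert (HA : forall G, AP Any G -> AP Any (fun x y => Cmult (D x y) (Cconj (G x y)))).
  { intros K HK. apply AP_mult; [apply additive_Any | auto | eapply AP_conj; eauto]. }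
  induction HG.
  - rewrite (cmean_ext _ (fun _ _ => RtoC 0)); [apply cmean_const|].
    intros. unfold Cconj, RtoC, Cmult; simpl. f_equal; ring.
  - rewrite (cmean_ext _ (fun x y => Cmult (Cconj c) (Cmult (D x y) (mode (- p) (- q) x y)))).
    + rewrite cmean_scal by now apply AP_mult_mode.
      change (Cmult (Cconj c) (coef D p q) = RtoC 0). rewrite H0. ring.
    + intros. rewrite Cmult_conj, mode_conj. ring.
  - rewrite (cmean_ext _ (fun x y => Cplus (Cmult (D x y) (Cconj (F x y)))
        (Cmult (D x y) (Cconj (G x y))))) by (intros; rewrite Cplus_conj; ring).
    rewrite cmean_plus by auto. rewrite IHHG1, IHHG2. ring.
  - assert (HF : AP Any F) by (apply AP_lim with G; auto).
    apply Cmod_eq_0, Rle_antisym; [|apply Cmod_ge_0].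
    apply eps_le. intros eps He.
    destruct (inv_INR_small (eps / (2 * M))) as [k Hk]; [apply Rdiv_lt_0_compat; lra|].
    replace (cmean _) with (cmean (fun x y => Cminus (Cmult (D x y) (Cconj (F x y)))
       (Cmult (D x y) (Cconj (G k x y))))).
    2:{ rewrite cmean_minus, H1 by auto. ring. }
    eapply Rle_trans; [apply cmean_bound with (M := M * (eps / (2 * M)))|].
    + apply AP_minus; auto.
    + intros x y.
      replace (Cminus _ _) with (Cmult (D x y) (Cconj (Cminus (F x y) (G k x y))))
        by (rewrite Cminus_conj; ring).
      rewrite Cmod_mult, Cmod_conj. specialize (H2 k x y).
      apply Rmult_le_compat; try apply Cmod_ge_0; auto. lra.
    + right. field. lra.
Qed.

(** Taking [G = D] in [AP_orthogonal], the mean of |D|^2 vanishes. A nonzero value, translated to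
    the centre of the square, would make that mean positive. *)
Lemma AP_coef_0 D : AP Any D -> (forall p q, coef D p q = RtoC 0) ->
  forall x y, D x y = RtoC 0.
Proof.
  intros HD H0 x0 y0. apply NNPP. intros Hne.
  set (N := fun x y => Cmult (D x y) (Cconj (D x y))).
  assert (HN : AP Any N).
  { apply AP_mult; [apply additive_Any | auto | eapply AP_conj; eauto]. }
  assert (E : cmean (fun x y => N (x + (x0 - PI)) (y + (y0 - PI))) = RtoC 0).
  { rewrite (cmean_shift Any) by auto. now apply AP_orthogonal. }
  assert (EN : forall x y, Re (N x y) = Cmod (D x y) ^ 2).
  { intros. unfold N. rewrite <- Cmod2_conj. reflexivity. }
  apply (f_equal Re) in E. unfold cmean in E. simpl in E.
  apply Rlt_irrefl with 0. rewrite <- E at 2.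
  apply P0_pos.
  - apply (AP_unif_cont_Re Any (fun x y => N (x + (x0 - PI)) (y + (y0 - PI)))).
    now apply AP_shift.
  - intros x y. change (0 <= Re (N (x + (x0 - PI)) (y + (y0 - PI)))).
    rewrite EN. apply pow2_ge_0.
  - change (0 < Re (N (PI + (x0 - PI)) (PI + (y0 - PI)))).
    rewrite EN. replace (PI + (x0 - PI)) with x0 by ring. replace (PI + (y0 - PI)) with y0 by ring.
    apply pow_lt, Cmod_gt_0; auto.
Qed.

Lemma AP_eq F G : AP Any F -> AP Any G -> (forall p q, coef F p q = coef G p q) -> F = G.
Proof.
  intros HF HG E. fext. apply Ceq_minus.
  apply (AP_coef_0 (fun x y => Cminus (F x y) (G x y))).
  - now apply AP_minus.
  - intros. rewrite coef_minus, E by auto. ring.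
Qed.

Lemma AP_zsum Q (f : Z -> R -> R -> C) N : (forall p, AP Q (f p)) ->
  AP Q (fun x y => zsum (G := C_AbelianMonoid) (fun p => f p x y) N).
Proof.
  intros Hf. induction N as [|N IH].
  - apply AP_ext with (f 0%Z); auto. intros. now rewrite zsum_0.
  - eapply AP_ext; [intros x y; symmetry; apply zsum_S|].
    apply (AP_plus Q (fun x y => Cplus _ _)); [apply AP_plus|]; auto.
Qed.

Lemma AP_csum Q (f : Z -> Z -> R -> R -> C) N : (forall p q, AP Q (f p q)) ->
  AP Q (fun x y => csum (fun p q => f p q x y) N).
Proof.
  intros Hf.
  apply (AP_zsum Q (fun p x y => zsum (G := C_AbelianMonoid) (fun q => f p q x y) N)).
  intros p. apply AP_zsum; auto.
Qed.

Lemma cmean_zsum (f : Z -> R -> R -> C) N : (forall p, AP Any (f p)) ->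
  cmean (fun x y => zsum (G := C_AbelianMonoid) (fun p => f p x y) N)
  = zsum (G := C_AbelianMonoid) (fun p => cmean (f p)) N.
Proof.
  intros Hf. induction N as [|N IH].
  - rewrite zsum_0. apply cmean_ext. intros. now rewrite zsum_0.
  - rewrite zsum_S. rewrite <- IH.
    erewrite cmean_ext; [|intros x y; apply zsum_S].
    change (@plus C_AbelianMonoid) with Cplus.
    rewrite (cmean_plus (fun x y => Cplus _ _)), cmean_plus; auto.
    + apply AP_zsum; auto.
    + apply AP_plus; auto. apply AP_zsum; auto.
Qed.

Lemma cmean_csum (f : Z -> Z -> R -> R -> C) N : (forall p q, AP Any (f p q)) ->
  cmean (fun x y => csum (fun p q => f p q x y) N) = csum (fun p q => cmean (f p q)) N.
Proof.
  intros Hf.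
  transitivity (zsum (G := C_AbelianMonoid)
    (fun p => cmean (fun x y => zsum (G := C_AbelianMonoid) (fun q => f p q x y) N)) N).
  - apply (cmean_zsum (fun p x y => zsum (G := C_AbelianMonoid) (fun q => f p q x y) N)).
    intros p. apply AP_zsum; auto.
  - rewrite square_sum_zsum. apply zsum_ext; intros p _. now apply cmean_zsum.
Qed.

(** Termwise integration: a majorant independent of the point makes the tails uniformly small. *)
Lemma gsum_cmean (f : Z -> Z -> R -> R -> C) F K r : 0 < r < 1 ->
  (forall p q, AP Any (f p q)) -> AP Any F ->
  (forall p q x y, Cmod (f p q x y) <= K * wt r p q) ->
  (forall x y, gsum (fun p q => f p q x y) (F x y)) ->
  gsum (fun p q => cmean (f p q)) (cmean F).
Proof.
  intros Hr Hf HF HK Hg.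
  assert (K0 : 0 <= K).
  { specialize (HK 0%Z 0%Z 0 0). unfold wt in HK; simpl in HK.
    assert (Q := Cmod_ge_0 (f 0%Z 0%Z 0 0)). lra. }
  assert (T : forall N x y, Cmod (Cminus (csum (fun p q => f p q x y) N) (F x y)) <= K * wt_tail r N).
  { intros N x y.
    destruct (gsum_exists (fun p q => f p q x y) K r Hr (fun p q => HK p q x y)) as [s [Hs [Ht _]]].
    rewrite (gsum_unique _ _ _ (Hg x y) Hs). apply Ht. }
  intros eps He. destruct (wt_tail_small r Hr (eps / (2 * (K + 1)))) as [N HN].
  { apply Rdiv_lt_0_compat; lra. }
  exists N. intros n Hn. specialize (HN n Hn).
  rewrite <- cmean_csum by auto.
  rewrite <- cmean_minus by (auto; apply AP_csum; auto).
  eapply Rle_lt_trans; [apply cmean_bound with (M := K * wt_tail r n)|].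
  - apply AP_minus; auto. apply AP_csum; auto.
  - apply T.
  - apply Rle_lt_trans with (2 * (K * (eps / (2 * (K + 1))))).
    + apply Rmult_le_compat_l; [lra|]. apply Rmult_le_compat_l; lra.
    + apply Rlt_le_trans with (2 * ((K + 1) * (eps / (2 * (K + 1))))).
      * apply Rmult_lt_compat_l; [lra|]. apply Rmult_lt_compat_r; [apply Rdiv_lt_0_compat; lra | lra].
      * right; field; lra.
Qed.

(** Uniform tails place the sum in [AP Q]; integrating the series against a mode leaves a single
    term by orthogonality. *)
Lemma gsum_AP (Q : Z -> Z -> Prop) (a : Z -> Z -> C) (F : R -> R -> C) K r : 0 < r < 1 ->
  (forall p q, Cmod (a p q) <= K * wt r p q) ->
  (forall p q, ~ Q p q -> a p q = RtoC 0) ->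
  (forall x y, gsum (fun p q => Cmult (a p q) (mode p q x y)) (F x y)) ->
  AP Q F /\ forall p q, coef F p q = a p q.
Proof.
  intros Hr Ha HQ HF.
  assert (K0 : 0 <= K).
  { specialize (Ha 0%Z 0%Z). unfold wt in Ha; simpl in Ha.
    assert (B := Cmod_ge_0 (a 0%Z 0%Z)). lra. }
  assert (Hm : forall p q x y, Cmod (Cmult (a p q) (mode p q x y)) <= K * wt r p q).
  { intros. now rewrite Cmod_mult, Cmod_mode, Rmult_1_r. }
  assert (HA : AP Q F).
  { apply AP_lim_eps. intros eps He.
    destruct (wt_tail_small r Hr (eps / (K + 1))) as [N HN].
    { apply Rdiv_lt_0_compat; lra. }
    exists (fun x y => csum (fun p q => Cmult (a p q) (mode p q x y)) N). split.
    - apply (AP_csum Q (fun p q x y => Cmult (a p q) (mode p q x y))). intros p q.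
      destruct (classic (Q p q)) as [Hq|Hq].
      + now apply AP_mode.
      + apply AP_ext with (fun _ _ => RtoC 0); [|apply AP_zero].
        intros. rewrite HQ by auto. ring.
    - intros x y.
      destruct (gsum_exists _ K r Hr (fun p q => Hm p q x y)) as [s [Hs [Ht _]]].
      rewrite (gsum_unique _ _ _ (HF x y) Hs), Cmod_minus_sym.
      eapply Rle_trans; [apply Ht|]. specialize (HN N (le_n _)).
      apply Rle_trans with ((K + 1) * (eps / (K + 1))); [nra | right; field; lra]. }
  split; auto. intros p q.
  assert (G : gsum (fun p' q' => cmean (fun x y =>
      Cmult (Cmult (a p' q') (mode p' q' x y)) (mode (- p) (- q) x y))) (coef F p q)).
  { apply (gsum_cmean (fun p' q' x y =>
      Cmult (Cmult (a p' q') (mode p' q' x y)) (mode (- p) (- q) x y))) with K r; auto.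
    - intros. apply AP_mult_mode, AP_mode. exact I.
    - apply AP_mult_mode. eapply AP_Any; eauto.
    - intros. now rewrite Cmod_mult, (Cmod_mode (- p)), Rmult_1_r.
    - intros. apply gsum_ext with (fun p' q' =>
        Cmult (mode (- p) (- q) x y) (Cmult (a p' q') (mode p' q' x y))).
      + intros. ring.
      + rewrite Cmult_comm. now apply gsum_scal. }
  assert (E : forall p' q', cmean (fun x y =>
      Cmult (Cmult (a p' q') (mode p' q' x y)) (mode (- p) (- q) x y))
      = Cmult (a p' q') (coef (mode p' q') p q)).
  { intros. unfold coef. rewrite <- cmean_scal by (apply AP_mult_mode, AP_mode1; exact I).
    apply cmean_ext. intros. ring. }
  eapply gsum_unique; [apply G|].
  replace (a p q) with (Cmult (a p q) (coef (mode p q) p q)) by (rewrite coef_mode_eq; ring).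
  apply gsum_ext with (fun p' q' => Cmult (a p' q') (coef (mode p' q') p q)); [now intros; rewrite E|].
  apply (gsum_single p q (fun p' q' => Cmult (a p' q') (coef (mode p' q') p q))).
  intros. rewrite coef_mode_ne by auto. ring.
Qed.

(** * Exponentially decaying coefficients *)

Lemma pow_le_1 r n : 0 <= r <= 1 -> r ^ n <= 1.
Proof. intros Hr. rewrite <- (pow1 n). now apply pow_incr. Qed.

Lemma wt_le r r' p q : 0 < r <= r' -> wt r p q <= wt r' p q.
Proof. intros Hr. apply pow_incr; lra. Qed.

(** The triangle inequality for |p| + |q|, read through a power of [r < 1]. *)
Lemma wt_shift r p q p' q' : 0 < r < 1 ->
  wt r p' q' * wt r (p - p') (q - q') <= wt r p q.
Proof.
  intros Hr. unfold wt. rewrite <- pow_add.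
  assert (E : (Z.abs_nat p + Z.abs_nat q <=
    Z.abs_nat p' + Z.abs_nat q' + (Z.abs_nat (p - p') + Z.abs_nat (q - q')))%nat) by lia.
  replace (Z.abs_nat p' + Z.abs_nat q' + (Z.abs_nat (p - p') + Z.abs_nat (q - q')))%nat with
    (Z.abs_nat p + Z.abs_nat q + (Z.abs_nat p' + Z.abs_nat q' +
      (Z.abs_nat (p - p') + Z.abs_nat (q - q')) - (Z.abs_nat p + Z.abs_nat q)))%nat by lia.
  rewrite pow_add.
  set (n := (_ - _)%nat). set (m := (Z.abs_nat p + Z.abs_nat q)%nat).
  assert (0 < r ^ m) by (apply pow_lt; lra).
  assert (r ^ n <= 1) by (apply pow_le_1; lra). nra.
Qed.

Definition exp_decay (a : Z -> Z -> C) : Prop :=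
  exists K r, 0 <= K /\ 0 < r < 1 /\ forall p q, Cmod (a p q) <= K * wt r p q.

(** These are the real-analytic functions on the torus. *)
Definition analytic (F : R -> R -> C) : Prop := AP Any F /\ exp_decay (coef F).

Lemma analytic_of_coef (Q : Z -> Z -> Prop) a : exp_decay a ->
  (forall p q, ~ Q p q -> a p q = RtoC 0) ->
  exists F, AP Q F /\ analytic F /\ forall p q, coef F p q = a p q.
Proof.
  intros [K [r [K0 [Hr Ha]]]] HQ.
  assert (Hm : forall p q x y, Cmod (Cmult (a p q) (mode p q x y)) <= K * wt r p q).
  { intros. now rewrite Cmod_mult, Cmod_mode, Rmult_1_r. }
  set (g := fun x y => constructive_indefinite_description _
    (gsum_exists _ K r Hr (fun p q => Hm p q x y))).
  set (F := fun x y => proj1_sig (g x y)).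
  destruct (gsum_AP Q a F K r Hr Ha HQ) as [H1 H2].
  { intros x y. apply (proj2_sig (g x y)). }
  exists F. repeat split; auto.
  - eapply AP_Any; eauto.
  - exists K, r. repeat split; try lra. intros. rewrite H2. auto.
Qed.

(** The series converges to some function with the same coefficients as [F], and uniqueness of
    coefficients identifies the two; no summation kernel is involved. *)
Lemma analytic_gsum F : analytic F ->
  forall x y, gsum (fun p q => Cmult (coef F p q) (mode p q x y)) (F x y).
Proof.
  intros [HF [K [r [K0 [Hr Ha]]]]].
  assert (Hm : forall p q x y, Cmod (Cmult (coef F p q) (mode p q x y)) <= K * wt r p q).
  { intros. now rewrite Cmod_mult, Cmod_mode, Rmult_1_r. }
  set (g := fun x y => constructive_indefinite_description _
    (gsum_exists _ K r Hr (fun p q => Hm p q x y))).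
  set (F' := fun x y => proj1_sig (g x y)).
  assert (G : forall x y, gsum (fun p q => Cmult (coef F p q) (mode p q x y)) (F' x y)).
  { intros x y. apply (proj2_sig (g x y)). }
  destruct (gsum_AP Any (coef F) F' K r Hr Ha) as [H1 H2]; auto.
  { intros p q N. destruct N. exact I. }
  intros x y. clearbody F'.
  assert (E : F = F') by (apply AP_eq; auto; intros; symmetry; apply H2).
  specialize (G x y). now rewrite <- E in G.
Qed.

(** The converse of [coef_off] for analytic functions: resynthesize [F] from the modes in [Q] and
    use uniqueness. *)
Lemma analytic_AP Q F : analytic F ->
  (forall p q, ~ Q p q -> coef F p q = RtoC 0) -> AP Q F.
Proof.
  intros [HF HE] HQ. destruct (analytic_of_coef Q (coef F) HE HQ) as [G [H1 [H2 H3]]].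
  rewrite (AP_eq F G); auto. apply H2.
Qed.

Lemma exp_decay_plus a b : exp_decay a -> exp_decay b ->
  exp_decay (fun p q => Cplus (a p q) (b p q)).
Proof.
  intros [K [r [K0 [Hr Ha]]]] [K' [r' [K0' [Hr' Hb]]]].
  assert (M1 := Rmax_l r r'). assert (M2 := Rmax_r r r').
  assert (M3 : Rmax r r' < 1) by (apply Rmax_lub_lt; lra).
  exists (K + K'), (Rmax r r'). repeat split; try lra. intros p q.
  rewrite Rmult_plus_distr_r. apply Cmod_le_plus.
  - eapply Rle_trans; [apply Ha|]. apply Rmult_le_compat_l, wt_le; lra.
  - eapply Rle_trans; [apply Hb|]. apply Rmult_le_compat_l, wt_le; lra.
Qed.

Lemma exp_decay_le A a b : 0 <= A -> (forall p q, Cmod (b p q) <= A * Cmod (a p q)) ->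
  exp_decay a -> exp_decay b.
Proof.
  intros HA Hab [K [r [K0 [Hr Ha]]]]. exists (A * K), r. repeat split; try lra.
  { now apply Rmult_le_pos. }
  intros. rewrite Rmult_assoc. eapply Rle_trans; [apply Hab|]. apply Rmult_le_compat_l; auto.
Qed.

(** [poly] is Bernoulli's inequality, applied to the powers of [/ r = 1 + x]. *)
Lemma linear_geometric_bound r : 0 < r < 1 ->
  exists A, 0 <= A /\ forall n, INR n * r ^ n <= A.
Proof.
  intros Hr. set (x := / r - 1).
  assert (Hx : 0 < x).
  { unfold x. assert (1 < / r) by (rewrite <- Rinv_1; apply Rinv_lt_contravar; lra). lra. }
  exists (/ x). split; [apply Rlt_le, Rinv_0_lt_compat; auto|]. intros n.
  assert (B := poly n x Hx). replace (1 + x) with (/ r) in B by (unfold x; ring).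
  rewrite pow_inv in B. assert (Hp : 0 < r ^ n) by (apply pow_lt; lra).
  apply Rmult_le_reg_l with x; auto. rewrite Rinv_r by lra.
  apply Rmult_le_compat_l with (r := r ^ n) in B; [|lra].
  rewrite Rinv_r in B by lra. nra.
Qed.

(** Weakening the rate from [r] to [sqrt r] frees a factor [sqrt r ^ n], which absorbs a linear
    growth in the frequency. Derivatives thus stay in the class. *)
Lemma exp_decay_mult_linear A (m a : Z -> Z -> C) : 0 <= A ->
  (forall p q, Cmod (m p q) <= A * (1 + INR (Z.abs_nat p + Z.abs_nat q))) ->
  exp_decay a -> exp_decay (fun p q => Cmult (m p q) (a p q)).
Proof.
  intros HA Hm [K [r [K0 [Hr Ha]]]].
  assert (S0 : 0 < sqrt r) by (apply sqrt_lt_R0; lra).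
  assert (S1 : sqrt r < 1) by (rewrite <- sqrt_1; apply sqrt_lt_1; lra).
  assert (SS : sqrt r * sqrt r = r) by (apply sqrt_sqrt; lra).
  destruct (linear_geometric_bound (sqrt r)) as [B [B0 HB]]; [lra|].
  exists (A * (1 + B) * K), (sqrt r). repeat split; try lra.
  { apply Rmult_le_pos; auto. apply Rmult_le_pos; lra. }
  intros p q. rewrite Cmod_mult. specialize (Ha p q). specialize (Hm p q).
  unfold wt in *. set (n := (Z.abs_nat p + Z.abs_nat q)%nat) in *.
  specialize (HB n). assert (Hn := pos_INR n).
  rewrite <- SS, Rpow_mult_distr in Ha.
  assert (P0 : 0 < sqrt r ^ n) by (apply pow_lt; auto).
  assert (P1 : sqrt r ^ n <= 1) by (apply pow_le_1; lra).
  set (s := sqrt r ^ n) in *.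
  apply Rle_trans with (A * (1 + INR n) * (K * (s * s))).
  - apply Rmult_le_compat; auto using Cmod_ge_0.
  - replace (A * (1 + INR n) * (K * (s * s))) with (A * K * s * (s + INR n * s)) by ring.
    replace (A * (1 + B) * K * s) with (A * K * s * (1 + B)) by ring.
    apply Rmult_le_compat_l; [|lra]. repeat apply Rmult_le_pos; lra.
Qed.

Lemma analytic_multiplier F A (m : Z -> Z -> C) : 0 <= A ->
  (forall p q, Cmod (m p q) <= A * (1 + INR (Z.abs_nat p + Z.abs_nat q))) ->
  analytic F ->
  exists G, analytic G /\ forall p q, coef G p q = Cmult (m p q) (coef F p q).
Proof.
  intros HA Hm [HF HE].
  destruct (analytic_of_coef Any (fun p q => Cmult (m p q) (coef F p q))) as [G [_ HG]].
  - now apply exp_decay_mult_linear with A.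
  - intros p q N. destruct N. exact I.
  - now exists G.
Qed.

Lemma analytic_plus F G : analytic F -> analytic G ->
  analytic (fun x y => Cplus (F x y) (G x y)).
Proof.
  intros [HF EF] [HG EG]. split; [now apply AP_plus|].
  apply exp_decay_le with 1 (fun p q => Cplus (coef F p q) (coef G p q)); [lra| |now apply exp_decay_plus].
  intros. rewrite coef_plus by auto. lra.
Qed.

Lemma analytic_scal c F : analytic F -> analytic (fun x y => Cmult c (F x y)).
Proof.
  intros [HF EF]. split; [now apply AP_scal|].
  apply exp_decay_le with (Cmod c) (coef F); auto using Cmod_ge_0.
  intros. rewrite coef_scal, Cmod_mult by auto. lra.
Qed.

Lemma RtoC_m1 : RtoC (-1) = Copp (RtoC 1).
Proof. unfold RtoC, Copp; simpl. f_equal; ring. Qed.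

Lemma analytic_minus F G : analytic F -> analytic G ->
  analytic (fun x y => Cminus (F x y) (G x y)).
Proof.
  intros HF HG.
  replace (fun x y => Cminus (F x y) (G x y))
    with (fun x y => Cplus (F x y) (Cmult (RtoC (-1)) (G x y)))
    by (fext; rewrite RtoC_m1; ring).
  apply analytic_plus; auto. now apply analytic_scal.
Qed.

Lemma coef_const_0 c : coef (fun _ _ => c) 0 0 = c.
Proof.
  unfold coef. rewrite (cmean_ext _ (fun _ _ => c)); [apply cmean_const|].
  intros. change (- 0)%Z with 0%Z. rewrite mode_0. ring.
Qed.

Lemma coef_const_ne c p q : (p, q) <> (0%Z, 0%Z) -> coef (fun _ _ => c) p q = RtoC 0.
Proof.
  intros Hne. rewrite (coef_ext _ (fun x y => Cmult c (mode 0 0 x y))) by (intros; rewrite mode_0; ring).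
  rewrite coef_scal by (apply AP_mode1; exact I). rewrite coef_mode_ne by congruence. ring.
Qed.

Lemma coef_const_le c r p q : 0 < r < 1 -> Cmod (coef (fun _ _ => c) p q) <= Cmod c * wt r p q.
Proof.
  intros Hr. destruct (classic ((p, q) = (0%Z, 0%Z))) as [E|E].
  - injection E; intros -> ->. rewrite coef_const_0. unfold wt; simpl. lra.
  - rewrite coef_const_ne, Cmod_0 by auto. apply Rmult_le_pos; [apply Cmod_ge_0|].
    apply Rlt_le, wt_pos; lra.
Qed.

Lemma analytic_const c : analytic (fun _ _ => c).
Proof.
  split; [apply AP_const; exact I|].
  exists (Cmod c), (1 / 2). repeat split; try lra; [apply Cmod_ge_0|].
  intros; apply coef_const_le; lra.
Qed.

Lemma cmean_conj F : AP Any F -> cmean (fun x y => Cconj (F x y)) = Cconj (cmean F).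
Proof.
  intros HF. unfold cmean, Cconj; simpl. f_equal.
  replace (fun x y => - snd (F x y)) with (fun x y => -1 * Im (F x y)) by (fext; unfold Im; ring).
  rewrite P0_scal by (eapply AP_unif_cont_Im; eauto). ring.
Qed.

Lemma coef_conj F p q : AP Any F ->
  coef (fun x y => Cconj (F x y)) p q = Cconj (coef F (- p) (- q)).
Proof.
  intros HF. unfold coef. rewrite <- cmean_conj by now apply AP_mult_mode.
  apply cmean_ext. intros. now rewrite Cmult_conj, mode_conj, !Z.opp_involutive.
Qed.

Lemma analytic_conj F : analytic F -> analytic (fun x y => Cconj (F x y)).
Proof.
  intros [HF [K [r [K0 [Hr Ha]]]]]. split; [eapply AP_conj; eauto|].
  exists K, r. repeat split; try lra. intros p q. rewrite coef_conj, Cmod_conj by auto.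
  eapply Rle_trans; [apply Ha|]. unfold wt. right. f_equal. f_equal. lia.
Qed.

(* The first factor decays at the rate [s ^ 2] so that half of it pays for the
   convergence of the convolution. *)
Lemma coef_mult_bound F V K L s p q : 0 < s < 1 -> 0 <= K -> 0 <= L ->
  analytic F -> AP Any V ->
  (forall p q, Cmod (coef F p q) <= K * wt (s * s) p q) ->
  (forall p q, Cmod (coef V p q) <= L * wt s p q) ->
  Cmod (coef (fun x y => Cmult (F x y) (V x y)) p q) <= K * wt_mass s * L * wt s p q.
Proof.
  intros Hs K0 L0 HF HV BF BV.
  assert (Hss : 0 < s * s < 1) by nra.
  destruct (AP_bounded _ _ HV) as [M [M0 HM]].
  (* Only [F] is expanded into a series; [V] enters through its coefficients, so the convolution
     formula requires no convergence of the series of [V]. *)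
  set (f := fun p' q' x y => Cmult (Cmult (Cmult (coef F p' q') (mode p' q' x y)) (V x y)) (mode (- p) (- q) x y)).
  assert (G : gsum (fun p' q' => cmean (f p' q')) (coef (fun x y => Cmult (F x y) (V x y)) p q)).
  { apply (gsum_cmean f) with (K * M) (s * s); auto.
    - intros. apply AP_mult_mode, AP_mult; auto using additive_Any. apply AP_mode; exact I.
    - apply AP_mult_mode, AP_mult; auto using additive_Any. apply HF.
    - intros p' q' x y. unfold f. rewrite !Cmod_mult, !Cmod_mode, !Rmult_1_r.
      specialize (BF p' q'). specialize (HM x y).
      replace (K * M * wt (s * s) p' q') with (K * wt (s * s) p' q' * M) by ring.
      apply Rmult_le_compat; auto using Cmod_ge_0.
    - intros x y. apply gsum_ext with (fun p' q' => Cmult (Cmult (V x y) (mode (- p) (- q) x y))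
          (Cmult (coef F p' q') (mode p' q' x y))).
      + intros; unfold f; ring.
      + replace (Cmult (Cmult (F x y) (V x y)) (mode (- p) (- q) x y)) with
          (Cmult (Cmult (V x y) (mode (- p) (- q) x y)) (F x y)) by ring.
        apply gsum_scal. now apply analytic_gsum. }
  assert (E : forall p' q', cmean (f p' q') = Cmult (coef F p' q') (coef V (p - p') (q - q'))).
  { intros. unfold coef at 2. rewrite <- cmean_scal by now apply AP_mult_mode.
    apply cmean_ext. intros. unfold f.
    replace (- (p - p'))%Z with (p' + - p)%Z by lia.
    replace (- (q - q'))%Z with (q' + - q)%Z by lia.
    rewrite <- mode_mult. ring. }
  assert (B : forall p' q', Cmod (cmean (f p' q')) <= (K * L * wt s p q) * wt s p' q').
  { intros. rewrite E, Cmod_mult.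
    eapply Rle_trans; [apply Rmult_le_compat; [apply Cmod_ge_0 | apply Cmod_ge_0 | apply BF | apply BV]|].
    assert (A := wt_shift s p q p' q' Hs).
    assert (W := wt_pos s p' q' ltac:(lra)).
    replace (wt (s * s) p' q') with (wt s p' q' * wt s p' q') by (unfold wt; now rewrite Rpow_mult_distr).
    replace (K * (wt s p' q' * wt s p' q') * (L * wt s (p - p') (q - q'))) with
      (K * L * wt s p' q' * (wt s p' q' * wt s (p - p') (q - q'))) by ring.
    replace (K * L * wt s p q * wt s p' q') with (K * L * wt s p' q' * wt s p q) by ring.
    apply Rmult_le_compat_l; auto. apply Rmult_le_pos; [|lra]. now apply Rmult_le_pos. }
  destruct (gsum_exists _ _ s Hs B) as [t [Ht [_ Bt]]].
  rewrite (gsum_unique _ _ _ G Ht).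
  eapply Rle_trans; [apply Bt|]. right. ring.
Qed.

Lemma exp_decay_square a : exp_decay a ->
  exists K s, 0 <= K /\ 0 < s < 1 /\ forall p q, Cmod (a p q) <= K * wt (s * s) p q.
Proof.
  intros [K [r [K0 [Hr Ha]]]]. exists K, (sqrt r). rewrite sqrt_sqrt by lra.
  repeat split; auto.
  - apply sqrt_lt_R0; lra.
  - rewrite <- sqrt_1; apply sqrt_lt_1; lra.
Qed.

Lemma wt_mass_pos s : 0 < s < 1 -> 0 <= wt_mass s.
Proof. intros. apply pow2_ge_0. Qed.

Lemma analytic_mult F G : analytic F -> analytic G ->
  analytic (fun x y => Cmult (F x y) (G x y)).
Proof.
  intros HF HG. split.
  { apply AP_mult; [apply additive_Any | apply HF | apply HG]. }
  destruct (exp_decay_square _ (proj2 HF)) as [K [s [K0 [Hs Ha]]]].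
  destruct (proj2 HG) as [L [r [L0 [Hr Hb]]]].
  assert (M1 := Rmax_l r s). assert (M2 := Rmax_r r s).
  assert (M3 : Rmax r s < 1) by (apply Rmax_lub_lt; lra).
  (* [coef_mult_bound] wants the rates [t * t] and [t] with one common [t]; enlarging a rate only
     weakens a bound. *)
  set (t := Rmax r s) in *.
  exists (K * wt_mass t * L), t. repeat split; try lra.
  { apply Rmult_le_pos; auto. apply Rmult_le_pos; auto. apply wt_mass_pos; lra. }
  intros p q. apply coef_mult_bound; auto; try lra.
  - apply HG.
  - intros. eapply Rle_trans; [apply Ha|]. apply Rmult_le_compat_l, wt_le; auto. nra.
  - intros. eapply Rle_trans; [apply Hb|]. apply Rmult_le_compat_l, wt_le; auto. lra.
Qed.

(** * Neumann series and the weighted Wiener lemma *)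

Fixpoint geom_sum (F : R -> R -> C) (n : nat) (x y : R) : C :=
  match n with
  | O => RtoC 0
  | S m => Cplus (RtoC 1) (Cmult (F x y) (geom_sum F m x y))
  end.

Lemma geom_sum_spec F n x y :
  Cmult (Cminus (RtoC 1) (F x y)) (geom_sum F n x y) = Cminus (RtoC 1) (Cpow (F x y) n).
Proof.
  induction n as [|n IH]; simpl; [ring|].
  replace (Cmult _ _) with (Cplus (Cminus (RtoC 1) (F x y))
    (Cmult (F x y) (Cmult (Cminus (RtoC 1) (F x y)) (geom_sum F n x y)))) by ring.
  rewrite IH. ring.
Qed.

Lemma geom_sum_error F n q x y : q < 1 -> Cmod (F x y) <= q ->
  Cmod (Cminus (Cinv (Cminus (RtoC 1) (F x y))) (geom_sum F n x y)) <= q ^ n / (1 - q).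
Proof.
  intros Hq HF. assert (H0 := Cmod_ge_0 (F x y)).
  assert (Hd : 1 - q <= Cmod (Cminus (RtoC 1) (F x y))).
  { assert (A := Cmod_triangle (Cminus (RtoC 1) (F x y)) (F x y)).
    replace (Cplus (Cminus (RtoC 1) (F x y)) (F x y)) with (RtoC 1) in A by ring.
    rewrite Cmod_1 in A. lra. }
  assert (Hne : Cminus (RtoC 1) (F x y) <> RtoC 0).
  { intros E. rewrite E, Cmod_0 in Hd. lra. }
  replace (Cminus _ _) with (Cmult (Cpow (F x y) n) (Cinv (Cminus (RtoC 1) (F x y)))).
  - rewrite Cmod_mult, Cmod_inv by auto.
    replace (Cmod (Cpow (F x y) n)) with (Cmod (F x y) ^ n).
    + apply Rmult_le_compat.
      * apply pow_le; auto.
      * apply Rlt_le, Rinv_0_lt_compat; lra.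
      * apply pow_incr; lra.
      * apply Rinv_le_contravar; lra.
    + clear. induction n as [|n IH]; simpl; [now rewrite Cmod_1|].
      now rewrite Cmod_mult, IH.
  - replace (Cpow (F x y) n) with
      (Cminus (RtoC 1) (Cmult (Cminus (RtoC 1) (F x y)) (geom_sum F n x y)))
      by (rewrite geom_sum_spec; ring).
    field. exact Hne.
Qed.

Lemma AP_geom_sum Q F n : additive Q -> Q 0%Z 0%Z -> AP Q F -> AP Q (geom_sum F n).
Proof.
  intros HQ H0 HF. induction n as [|n IH].
  - apply AP_zero.
  - apply (AP_plus Q (fun _ _ => RtoC 1)); [now apply AP_const | now apply AP_mult].
Qed.

(** The partial sums are polynomials in [F] and converge uniformly, so inversion does not leave the
    closed algebra and creates no frequency outside [Q]. *)
Lemma AP_neumann Q F q : additive Q -> Q 0%Z 0%Z -> AP Q F -> 0 <= q < 1 ->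
  (forall x y, Cmod (F x y) <= q) -> AP Q (fun x y => Cinv (Cminus (RtoC 1) (F x y))).
Proof.
  intros HQ H0 HF Hq HB. apply AP_lim_eps. intros eps He.
  destruct (pow_lt_1_zero q) with (y := eps * (1 - q)) as [N HN].
  { rewrite Rabs_pos_eq; lra. } { apply Rmult_lt_0_compat; lra. }
  exists (geom_sum F N). split; [now apply AP_geom_sum|]. intros x y.
  eapply Rle_trans; [apply geom_sum_error with (q := q); auto; lra|].
  specialize (HN N (le_n _)). rewrite Rabs_pos_eq in HN by (apply pow_le; lra).
  apply Rmult_le_reg_r with (1 - q); [lra|]. unfold Rdiv.
  rewrite Rmult_assoc, Rinv_l by lra. lra.
Qed.

Lemma bernoulli_minus x n : 0 <= x <= 1 -> 1 - INR n * x <= (1 - x) ^ n.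
Proof.
  intros Hx. induction n as [|n IH]; [simpl; lra|].
  rewrite S_INR. simpl. assert (0 <= (1 - x) ^ n) by (apply pow_le; lra).
  assert (Q := pos_INR n). nra.
Qed.

(** The rate [s] does not depend on [n]. In Horner form each step is one product with [F], whose
    better rate [s * s] pays for the convolution, so only the constant grows. *)
Lemma coef_geom_sum_bound F s K n p q : 0 < s < 1 -> 0 <= K -> analytic F ->
  (forall p q, Cmod (coef F p q) <= K * wt (s * s) p q) ->
  Cmod (coef (geom_sum F n) p q) <= (1 + K * wt_mass s) ^ n * wt s p q.
Proof.
  intros Hs K0 HF HK.
  assert (B0 : 0 <= K * wt_mass s) by (apply Rmult_le_pos; auto; now apply wt_mass_pos).
  revert p q. induction n as [|n IH]; intros p q.
  - change (geom_sum F 0) with (fun _ _ : R => RtoC 0). rewrite coef_0, Cmod_0.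
    assert (W := wt_pos s p q ltac:(lra)). simpl. lra.
  - assert (P1 : 1 <= (1 + K * wt_mass s) ^ n) by (apply pow_R1_Rle; lra).
    change (geom_sum F (S n)) with
      (fun x y => Cplus (RtoC 1) (Cmult (F x y) (geom_sum F n x y))).
    assert (HA : AP Any (geom_sum F n)).
    { apply AP_geom_sum; [apply additive_Any | exact I | apply HF]. }
    rewrite (coef_plus (fun _ _ => RtoC 1)).
    2:{ apply AP_const; exact I. } 2:{ apply AP_mult; auto using additive_Any. apply HF. }
    eapply Rle_trans; [apply Cmod_le_plus|].
    + apply (coef_const_le _ s); auto.
    + apply (coef_mult_bound F (geom_sum F n) K ((1 + K * wt_mass s) ^ n) s); auto. lra.
    + rewrite Cmod_1. simpl. assert (W := wt_pos s p q ltac:(lra)). nra.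
Qed.

(* The coefficients of [1 / (1 - F)] are bounded by [B ^ n * s ^ |j|], from the
   partial geometric sum, plus [O(q ^ n)], from the remainder, for every [n];
   taking [n] proportional to [|j|] gives exponential decay. *)
Lemma analytic_neumann F q : analytic F -> 0 < q < 1 ->
  (forall x y, Cmod (F x y) <= q) -> analytic (fun x y => Cinv (Cminus (RtoC 1) (F x y))).
Proof.
  intros HF Hq HB.
  assert (HA : AP Any (fun x y => Cinv (Cminus (RtoC 1) (F x y)))).
  { apply AP_neumann with q; auto using additive_Any; [exact I | apply HF | lra]. }
  split; auto.
  destruct (exp_decay_square _ (proj2 HF)) as [K [s [K0 [Hs Ha]]]].
  set (B := 1 + K * wt_mass s).
  assert (B1 : 1 <= B).
  { unfold B. assert (0 <= K * wt_mass s); [|lra]. apply Rmult_le_pos; auto; now apply wt_mass_pos. }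
  (* [L] is the number of lattice steps whose decay [s ^ L] outweighs one factor [B], leaving at
     most [q]. *)
  destruct (pow_lt_1_zero s) with (y := q / B) as [L0 HL].
  { rewrite Rabs_pos_eq; lra. } { apply Rdiv_lt_0_compat; lra. }
  set (L := S L0). specialize (HL L ltac:(unfold L; lia)).
  assert (HsL : B * s ^ L <= q).
  { rewrite Rabs_pos_eq in HL by (apply pow_le; lra).
    apply Rle_trans with (B * (q / B)); [apply Rmult_le_compat_l; lra | right; field; lra]. }
  assert (NL : 1 <= INR L) by (unfold L; rewrite S_INR; assert (Q := pos_INR L0); lra).
  (* The final rate [1 - x] replaces an [L]-th root of [q]: Bernoulli's inequality gives
     [q <= (1 - x) ^ L]. *)
  set (x := (1 - q) / INR L).
  assert (Hx : 0 < x <= 1 - q).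
  { unfold x. split; [apply Rdiv_lt_0_compat; lra|].
    apply Rmult_le_reg_r with (INR L); [lra|]. unfold Rdiv.
    rewrite Rmult_assoc, Rinv_l by lra. nra. }
  assert (SL : q <= (1 - x) ^ L).
  { eapply Rle_trans; [|apply bernoulli_minus; lra]. unfold x. right. field. lra. }
  exists ((1 + 2 / (1 - q)) / q), (1 - x).
  assert (Hc : 0 < 1 + 2 / (1 - q)).
  { assert (0 < 2 / (1 - q)) by (apply Rdiv_lt_0_compat; lra). lra. }
  repeat split; try lra.
  { apply Rlt_le, Rdiv_lt_0_compat; lra. }
  intros i j. set (m := (Z.abs_nat i + Z.abs_nat j)%nat).
  assert (Dm := Nat.div_mod m L ltac:(unfold L; lia)).
  assert (Lm := Nat.mod_upper_bound m L ltac:(unfold L; lia)).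
  set (n := (m / L)%nat) in *.
  assert (HG : AP Any (geom_sum F n)).
  { apply AP_geom_sum; [apply additive_Any | exact I | apply HF]. }
  assert (E1 : Cmod (coef (geom_sum F n) i j) <= q ^ n).
  { eapply Rle_trans; [now apply coef_geom_sum_bound with (s := s) (K := K)|].
    fold B. unfold wt. fold m.
    apply Rle_trans with (B ^ n * s ^ (L * n)).
    - apply Rmult_le_compat_l; [apply pow_le; lra|].
      rewrite Dm, pow_add.
      assert (s ^ (m mod L) <= 1) by (apply pow_le_1; lra).
      assert (0 < s ^ (L * n)) by (apply pow_lt; lra). nra.
    - rewrite pow_mult, <- Rpow_mult_distr. apply pow_incr. split; auto.
      apply Rmult_le_pos; [lra | apply pow_le; lra]. }
  assert (E2 : Cmod (Cminus (coef (fun x y => Cinv (Cminus (RtoC 1) (F x y))) i j)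
     (coef (geom_sum F n) i j)) <= 2 * (q ^ n / (1 - q))).
  { rewrite <- coef_minus by auto. apply coef_bound; [now apply AP_minus|].
    intros. apply geom_sum_error; auto; lra. }
  (* The quotient [n = m / L] is rounded down, so the comparison holds for [S n]; the lost factor is
     the division by [q] in the constant. *)
  assert (E3 : q ^ S n <= (1 - x) ^ m).
  { apply Rle_trans with ((1 - x) ^ (L * S n)).
    - rewrite pow_mult. apply pow_incr. lra.
    - replace (L * S n)%nat with (m + (L * S n - m))%nat by lia.
      rewrite pow_add.
      assert ((1 - x) ^ (L * S n - m) <= 1) by (apply pow_le_1; lra).
      assert (0 < (1 - x) ^ m) by (apply pow_lt; lra). nra. }
  set (c1 := coef (fun x y => Cinv (Cminus (RtoC 1) (F x y))) i j) in *.
  set (c2 := coef (geom_sum F n) i j) in *.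
  replace c1 with (Cplus (Cminus c1 c2) c2) by ring.
  eapply Rle_trans; [apply Cmod_triangle|].
  apply Rle_trans with ((1 + 2 / (1 - q)) * q ^ n).
  - replace ((1 + 2 / (1 - q)) * q ^ n) with (2 * (q ^ n / (1 - q)) + q ^ n) by (field; lra).
    now apply Rplus_le_compat.
  - unfold wt. fold m. unfold Rdiv at 2. rewrite Rmult_assoc.
    apply Rmult_le_compat_l; [lra|].
    apply Rmult_le_reg_l with q; [lra|]. rewrite <- Rmult_assoc, Rinv_r, Rmult_1_l by lra.
    exact E3.
Qed.

(* [1 / F = conj F / |F|^2], and [|F|^2 / M = 1 - h] with [0 <= h < 1]. *)
Lemma analytic_inv F m : analytic F -> 0 < m -> (forall x y, m <= Cmod (F x y)) ->
  analytic (fun x y => Cinv (F x y)).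
Proof.
  intros HF Hm HB. destruct (AP_bounded _ _ (proj1 HF)) as [M [M0 HM]].
  assert (HmM : m <= M) by (apply Rle_trans with (Cmod (F 0 0)); auto).
  (* The factor 2 keeps [1 - m ^ 2 / A] strictly positive, as [analytic_neumann] demands, even when
     |F| is constant. *)
  set (A := 2 * M ^ 2). assert (HA : 0 < A) by (unfold A; nra).
  set (h := fun x y => Cminus (RtoC 1) (Cmult (RtoC (/ A)) (Cmult (F x y) (Cconj (F x y))))).
  assert (Hh : analytic h).
  { apply (analytic_minus (fun _ _ => RtoC 1)); [apply analytic_const|].
    apply analytic_scal, analytic_mult; auto. now apply analytic_conj. }
  assert (Ef : forall x y, Cmult (F x y) (Cconj (F x y)) = RtoC (Cmod (F x y) ^ 2)).
  { intros. now rewrite Cmod2_conj. }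
  replace (fun x y => Cinv (F x y)) with
    (fun x y => Cmult (RtoC (/ A)) (Cmult (Cconj (F x y)) (Cinv (Cminus (RtoC 1) (h x y))))).
  - apply analytic_scal, analytic_mult; [now apply analytic_conj|].
    apply analytic_neumann with (1 - m ^ 2 / A); auto.
    + assert (Q : m ^ 2 / A <= 1 / 2).
      { apply Rmult_le_reg_r with A; auto. unfold Rdiv. rewrite Rmult_assoc, Rinv_l by lra.
        unfold A. nra. }
      assert (0 < m ^ 2 / A) by (apply Rdiv_lt_0_compat; nra). lra.
    + intros x y. unfold h. rewrite Ef, <- RtoC_mult, <- RtoC_minus, Cmod_R.
      specialize (HB x y). specialize (HM x y).
      assert (I0 : 0 < / A) by now apply Rinv_0_lt_compat.
      assert (I1 : / A * Cmod (F x y) ^ 2 <= 1).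
      { apply Rmult_le_reg_l with A; auto. rewrite <- Rmult_assoc, Rinv_r by lra. unfold A. nra. }
      rewrite Rabs_pos_eq by lra. unfold Rdiv. rewrite (Rmult_comm (m ^ 2)).
      assert (/ A * m ^ 2 <= / A * Cmod (F x y) ^ 2); [|lra].
      apply Rmult_le_compat_l; [lra|]. nra.
  - fext. unfold h.
    assert (Hne : F x y <> RtoC 0).
    { intros E. specialize (HB x y). rewrite E, Cmod_0 in HB. lra. }
    assert (Hnc : Cconj (F x y) <> RtoC 0).
    { intros E. apply (f_equal Cmod) in E. rewrite Cmod_conj, Cmod_0 in E.
      specialize (HB x y). lra. }
    assert (HAc : RtoC A <> RtoC 0) by (intros E; apply RtoC_inj in E; lra).
    rewrite RtoC_inv by lra.
    replace (Cminus (RtoC 1) (Cminus (RtoC 1) (Cmult (Cinv (RtoC A)) (Cmult (F x y) (Cconj (F x y))))))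
      with (Cmult (Cinv (RtoC A)) (Cmult (F x y) (Cconj (F x y)))) by ring.
    field. auto.
Qed.

(** * Multipliers and differentiability *)

(** Links the epsilon form used throughout to the filter form in [fourier_sum]. *)
Lemma gsum_filterlim f s : gsum f s <-> filterlim (csum f) eventually (locally (T := C_UniformSpace) s).
Proof.
  split.
  - intros Hg. apply (filterlim_locally_ball_norm (K := C_AbsRing) (U := C_NormedModule)).
    intros eps. destruct (Hg eps (cond_pos eps)) as [N HN]. exists N. intros n Hn. apply (HN n Hn).
  - intros Hf eps He.
    apply (filterlim_locally_ball_norm (K := C_AbsRing) (U := C_NormedModule)) with (eps := mkposreal eps He) in Hf.
    destruct Hf as [N HN]. exists N. intros n Hn. apply (HN n Hn).
Qed.

Lemma gsum_Lim_Re f s : gsum f s -> real (Lim_seq (fun N => Re (csum f N))) = Re s.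
Proof.
  intros Hg. rewrite (is_lim_seq_unique _ (Re s)); auto.
  apply is_lim_seq_spec. intros eps. destruct (Hg eps (cond_pos eps)) as [N HN].
  exists N. intros n Hn. eapply Rle_lt_trans; [apply (re_le_Cmod (Cminus (csum f n) s))|]. auto.
Qed.

(** The mean value theorem with |cos c - 1| <= |c|. A quadratic bound, weaker than the true cubic
    one, is enough for first-order expansions. *)
Lemma sin_minus_id_bound s : Rabs (sin s - s) <= s ^ 2.
Proof.
  destruct (MVT_gen (fun t => sin t - t) 0 s (fun t => cos t - 1)) as [c [Hc E]].
  - intros x _. auto_derive; auto. ring.
  - intros x _. apply derivable_continuous_pt. reg.
  - rewrite sin_0 in E. replace (sin s - s) with ((cos c - 1) * s) by lra.
    rewrite Rabs_mult. destruct (cos_sin_Lipschitz c) as [B _].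
    assert (Rabs c <= Rabs s).
    { unfold Rmin, Rmax in Hc. destruct (Rle_dec 0 s).
      - rewrite !Rabs_pos_eq; lra.
      - rewrite !Rabs_left1; lra. }
    replace (s ^ 2) with (Rabs s * Rabs s) by (rewrite <- Rabs_mult, Rabs_pos_eq; nra).
    apply Rmult_le_compat_r; [apply Rabs_pos | lra].
Qed.

Lemma mode_Taylor p q h l :
  Cmod (Cminus (Cminus (mode p q h l) (RtoC 1)) (Cmult Ci (RtoC (IZR p * h + IZR q * l))))
  <= 2 * INR (Z.abs_nat p + Z.abs_nat q) ^ 2 * (Rabs h + Rabs l) ^ 2.
Proof.
  eapply Rle_trans; [apply Cmod_le_abs|].
  set (s := IZR p * h + IZR q * l).
  replace (Cminus (Cminus (mode p q h l) (RtoC 1)) (Cmult Ci (RtoC s)))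
    with ((cos s - 1, sin s - s) : C)
    by (unfold mode, Cminus, Cplus, Copp, Cmult, Ci, RtoC; simpl; fold s; f_equal; ring).
  simpl. assert (A := one_minus_cos_le s). assert (A' := COS_bound s).
  assert (B := sin_minus_id_bound s).
  assert (D : Rabs s <= INR (Z.abs_nat p + Z.abs_nat q) * (Rabs h + Rabs l)).
  { eapply Rle_trans; [apply Rabs_triang|]. rewrite !Rabs_mult, plus_INR.
    assert (E : forall z, Rabs (IZR z) = INR (Z.abs_nat z)).
    { intros z. rewrite <- abs_IZR, INR_IZR_INZ. f_equal. lia. }
    rewrite !E. assert (P := pos_INR (Z.abs_nat p)). assert (P' := pos_INR (Z.abs_nat q)).
    assert (Q := Rabs_pos h). assert (Q' := Rabs_pos l). nra. }
  assert (S2 : s ^ 2 <= (INR (Z.abs_nat p + Z.abs_nat q) * (Rabs h + Rabs l)) ^ 2).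
  { rewrite <- (pow2_abs s). apply pow_incr. split; [apply Rabs_pos | auto]. }
  rewrite Rpow_mult_distr in S2.
  rewrite (Rabs_left1 (cos s - 1)) by lra. nra.
Qed.

Lemma Cmod_RtoC_pos r : 0 <= r -> Cmod (RtoC r) = r.
Proof. intros. now rewrite Cmod_R, Rabs_pos_eq. Qed.

Lemma Cmod_freq p q : Cmod (Cmult Ci (RtoC (IZR p))) <= 1 * (1 + INR (Z.abs_nat p + Z.abs_nat q)) /\
  Cmod (Cmult Ci (RtoC (IZR q))) <= 1 * (1 + INR (Z.abs_nat p + Z.abs_nat q)).
Proof.
  rewrite !Cmod_mult, Cmod_Ci, !Cmod_R, plus_INR.
  assert (E : forall z, Rabs (IZR z) = INR (Z.abs_nat z)).
  { intros z. rewrite <- abs_IZR, INR_IZR_INZ. f_equal. lia. }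
  rewrite !E. assert (P := pos_INR (Z.abs_nat p)). assert (P' := pos_INR (Z.abs_nat q)). lra.
Qed.

(** Expanding each mode and summing gives a quadratic remainder uniform on the torus. This one
    estimate replaces a theorem on differentiating series and also controls short chords. *)
Lemma analytic_Taylor F : analytic F -> exists F1 F2,
  analytic F1 /\ analytic F2 /\
  (forall p q, coef F1 p q = Cmult (Cmult Ci (RtoC (IZR p))) (coef F p q)) /\
  (forall p q, coef F2 p q = Cmult (Cmult Ci (RtoC (IZR q))) (coef F p q)) /\
  exists K, 0 <= K /\ forall x y h l,
    Cmod (Cminus (Cminus (F (x + h) (y + l)) (F x y))
      (Cplus (Cmult (RtoC h) (F1 x y)) (Cmult (RtoC l) (F2 x y)))) <= K * (Rabs h + Rabs l) ^ 2.
Proof.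
  intros HF.
  destruct (analytic_multiplier F 1 (fun p q => Cmult Ci (RtoC (IZR p)))) as [F1 [A1 C1]];
    [lra | intros; apply Cmod_freq | auto |].
  destruct (analytic_multiplier F 1 (fun p q => Cmult Ci (RtoC (IZR q)))) as [F2 [A2 C2]];
    [lra | intros; apply Cmod_freq | auto |].
  exists F1, F2. repeat (split; [assumption|]).
  set (n := fun p q => RtoC (INR (Z.abs_nat p + Z.abs_nat q))).
  assert (Hn : forall p q, Cmod (n p q) <= 1 * (1 + INR (Z.abs_nat p + Z.abs_nat q))).
  { intros. unfold n. rewrite Cmod_RtoC_pos by apply pos_INR. lra. }
  (* The remainder of a mode grows like the square of its frequency; two linear multipliers absorb
     it. *)
  assert (E : exp_decay (fun p q => Cmult (n p q) (Cmult (n p q) (coef F p q)))).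
  { apply exp_decay_mult_linear with 1; [lra | auto |].
    apply exp_decay_mult_linear with 1; [lra | auto | apply HF]. }
  destruct E as [K [r [K0 [Hr HK]]]].
  exists (2 * K * wt_mass r). split.
  { apply Rmult_le_pos; [lra | now apply wt_mass_pos]. }
  intros x y h l.
  set (f := fun p q => Cmult (Cmult (coef F p q) (mode p q x y))
    (Cminus (Cminus (mode p q h l) (RtoC 1)) (Cmult Ci (RtoC (IZR p * h + IZR q * l))))).
  assert (G : gsum f (Cminus (Cminus (F (x + h) (y + l)) (F x y))
      (Cplus (Cmult (RtoC h) (F1 x y)) (Cmult (RtoC l) (F2 x y))))).
  { assert (G1 := analytic_gsum F HF (x + h) (y + l)).
    assert (G2 := gsum_scal (RtoC (-1)) _ _ (analytic_gsum F HF x y)).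
    assert (G3 := gsum_scal (Copp (RtoC h)) _ _ (analytic_gsum F1 A1 x y)).
    assert (G4 := gsum_scal (Copp (RtoC l)) _ _ (analytic_gsum F2 A2 x y)).
    assert (GG := gsum_plus _ _ _ _ (gsum_plus _ _ _ _ G1 G2) (gsum_plus _ _ _ _ G3 G4)).
    replace (Cminus (Cminus _ _) _) with (Cplus (Cplus (F (x + h) (y + l)) (Cmult (RtoC (-1)) (F x y)))
      (Cplus (Cmult (Copp (RtoC h)) (F1 x y)) (Cmult (Copp (RtoC l)) (F2 x y))))
      by (rewrite RtoC_m1; ring).
    eapply gsum_ext; [|apply GG].
    intros p q. simpl. unfold f. rewrite C1, C2, mode_shift, RtoC_m1, RtoC_plus, !RtoC_mult. ring. }
  assert (B : forall p q, Cmod (f p q) <= (2 * K * (Rabs h + Rabs l) ^ 2) * wt r p q).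
  { intros p q. unfold f. rewrite !Cmod_mult, Cmod_mode, Rmult_1_r.
    specialize (HK p q). rewrite !Cmod_mult in HK. unfold n in HK.
    rewrite Cmod_RtoC_pos in HK by apply pos_INR.
    assert (T := mode_Taylor p q h l).
    eapply Rle_trans; [apply Rmult_le_compat_l; [apply Cmod_ge_0 | apply T]|].
    set (N := INR (Z.abs_nat p + Z.abs_nat q)) in *. set (c := Cmod (coef F p q)) in *.
    replace (c * (2 * N ^ 2 * (Rabs h + Rabs l) ^ 2)) with
      (2 * (Rabs h + Rabs l) ^ 2 * (N * (N * c))) by ring.
    replace (2 * K * (Rabs h + Rabs l) ^ 2 * wt r p q) with
      (2 * (Rabs h + Rabs l) ^ 2 * (K * wt r p q)) by ring.
    apply Rmult_le_compat_l; auto.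
    apply Rmult_le_pos; [lra | apply pow2_ge_0]. }
  destruct (gsum_exists _ _ r Hr B) as [t [Ht [_ Bt]]].
  rewrite (gsum_unique _ _ _ G Ht). eapply Rle_trans; [apply Bt|]. right. ring.
Qed.

(** * Real analytic functions and the operators [H] and [D] *)

Definition cplx (u : R -> R -> R) (x y : R) : C := RtoC (u x y).

Definition ranalytic (u : R -> R -> R) : Prop := analytic (cplx u).

Lemma fourier_coef_eq u p q : AP Any (cplx u) -> fourier_coef u p q = coef (cplx u) p q.
Proof.
  intros Hu. unfold fourier_coef, coef, cmean. f_equal.
  - f_equal. fext. unfold cplx, mode, RtoC, Cmult; simpl. rewrite !opp_IZR.
    replace (- IZR p * x + - IZR q * y) with (- (IZR p * x + IZR q * y)) by ring.
    rewrite cos_neg. ring.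
  - replace (fun x y => Im (Cmult (cplx u x y) (mode (- p) (- q) x y)))
      with (fun x y => -1 * (u x y * sin (IZR p * x + IZR q * y))).
    + rewrite P0_scal; [ring|].
      replace (fun x y => u x y * sin (IZR p * x + IZR q * y))
        with (fun x y => Im (Cmult (cplx u x y) (mode p q x y)))
        by (fext; unfold cplx, mode, RtoC, Cmult; simpl; ring).
      apply (AP_unif_cont_Im Any (fun x y => Cmult (cplx u x y) (mode p q x y))).
      now apply AP_mult_mode.
    + fext. unfold cplx, mode, RtoC, Cmult; simpl. rewrite !opp_IZR.
      replace (- IZR p * x + - IZR q * y) with (- (IZR p * x + IZR q * y)) by ring.
      rewrite sin_neg. ring.
Qed.

Lemma Cconj_RtoC r : Cconj (RtoC r) = RtoC r.
Proof. unfold Cconj, RtoC; simpl. f_equal; ring. Qed.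

Lemma coef_real u p q : AP Any (cplx u) ->
  coef (cplx u) (- p) (- q) = Cconj (coef (cplx u) p q).
Proof.
  intros Hu. rewrite <- (Cconj_conj (coef (cplx u) (- p) (- q))), <- coef_conj by auto.
  f_equal. apply coef_ext. intros; apply Cconj_RtoC.
Qed.

(** [G] and its conjugate have the same coefficients, hence coincide. *)
Lemma AP_real G : AP Any G -> (forall p q, coef G (- p) (- q) = Cconj (coef G p q)) ->
  exists v, G = cplx v.
Proof.
  intros HG Hh.
  assert (E : G = (fun x y => Cconj (G x y))).
  { apply AP_eq; auto; [eapply AP_conj; eauto|].
    intros. rewrite coef_conj by auto. now rewrite Hh, Cconj_conj. }
  exists (fun x y => Re (G x y)). fext. apply (f_equal (fun F => F x y)) in E.
  unfold cplx, RtoC. destruct (G x y) as [a b] eqn:EG. unfold Cconj in E. simpl in *.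
  injection E. intros. f_equal. lra.
Qed.

Lemma ranalytic_multiplier u A (m : Z -> Z -> C) : 0 <= A ->
  (forall p q, Cmod (m p q) <= A * (1 + INR (Z.abs_nat p + Z.abs_nat q))) ->
  (forall p q, m (- p)%Z (- q)%Z = Cconj (m p q)) ->
  ranalytic u ->
  exists v, ranalytic v /\ forall p q, coef (cplx v) p q = Cmult (m p q) (coef (cplx u) p q).
Proof.
  intros HA Hm Hc Hu. destruct (analytic_multiplier _ A m HA Hm Hu) as [G [AG CG]].
  destruct (AP_real G) as [v ->].
  - apply AG.
  - intros. rewrite !CG, Hc, coef_real, Cmult_conj by apply Hu. auto.
  - now exists v.
Qed.

Lemma ranalytic_eq u v : AP Any (cplx u) -> AP Any (cplx v) ->
  (forall p q, coef (cplx u) p q = coef (cplx v) p q) -> u = v.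
Proof.
  intros Hu Hv E. assert (EQ := AP_eq _ _ Hu Hv E). fext.
  apply (f_equal (fun F => F x y)) in EQ. now apply RtoC_inj.
Qed.

Lemma ranalytic_torus_fun u : ranalytic u -> torus_fun u.
Proof.
  intros Hu. assert (HA := proj1 Hu). split.
  - destruct (proj2 Hu) as [K [r [K0 [Hr HK]]]]. exists (K * wt_mass r). intros N.
    apply Rle_trans with (rsum (fun p q => K * wt r p q) N).
    + apply (square_sum_induction (G1 := R_AbelianMonoid) (G2 := R_AbelianMonoid) Rle).
      * intros a b c d. apply Rplus_le_compat.
      * intros p q _ _. now rewrite fourier_coef_eq.
    + assert (Esc : rsum (fun p q => K * wt r p q) N = K * rsum (wt r) N)
        by apply (square_sum_scal (K := R_Ring)).
      rewrite Esc. apply Rmult_le_compat_l; auto. now apply rsum_wt_bounds.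
  - intros x y. apply gsum_filterlim.
    eapply gsum_ext; [|apply (analytic_gsum _ Hu x y)].
    intros. now rewrite fourier_coef_eq.
Qed.

Definition freq (k : R) (p q : Z) : R := IZR p + IZR q * k.

Lemma freq_opp k p q : freq k (- p) (- q) = - freq k p q.
Proof. unfold freq. rewrite !opp_IZR. ring. Qed.

Definition hilbert_symbol (k : R) (p q : Z) : C := Cmult (Copp Ci) (RtoC (sign (freq k p q))).

Lemma sign_abs_le x : Rabs (sign x) <= 1.
Proof.
  destruct (Rtotal_order x 0) as [Hx|[->|Hx]].
  - rewrite sign_eq_m1, Rabs_left by (auto; lra); lra.
  - rewrite sign_0, Rabs_R0; lra.
  - rewrite sign_eq_1, Rabs_R1 by auto; lra.
Qed.

(** The multiplier lemma supplies a function whose Fourier series is, term by term, the one in the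
    definition of [H]; so that limit exists and equals it at every point. *)
Lemma H_ranalytic k u : ranalytic u -> ranalytic (H k u) /\
  forall p q, coef (cplx (H k u)) p q = Cmult (hilbert_symbol k p q) (coef (cplx u) p q).
Proof.
  intros Hu.
  destruct (ranalytic_multiplier u 1 (hilbert_symbol k)) as [v [Av Cv]]; auto; [lra | | |].
  - intros. unfold hilbert_symbol. rewrite Cmod_mult, Cmod_opp, Cmod_Ci, Cmod_R.
    assert (P := pos_INR (Z.abs_nat p + Z.abs_nat q)). assert (Q := sign_abs_le (freq k p q)). lra.
  - intros. unfold hilbert_symbol. rewrite freq_opp, sign_opp.
    rewrite Cmult_conj, Copp_conj, Cconj_RtoC, RtoC_opp.
    replace (Cconj Ci) with (Copp Ci) by (unfold Cconj, Copp, Ci; simpl; f_equal; ring). ring.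
  - assert (E : H k u = v); [|now rewrite E].
    fext. unfold H. assert (G := analytic_gsum _ Av x y).
    rewrite (gsum_Lim_Re _ (cplx v x y)); [reflexivity|].
    eapply gsum_ext; [|apply G]. intros p q. simpl.
    rewrite Cv, fourier_coef_eq by apply Hu. reflexivity.
Qed.

Lemma Re_Cmult_RtoC h z : Re (Cmult (RtoC h) z) = h * Re z.
Proof. unfold Cmult, RtoC; simpl. unfold Re. ring. Qed.

Lemma is_derive_quadratic (f : R -> R) x l K :
  (forall h, Rabs (f (x + h) - f x - h * l) <= K * h ^ 2) -> is_derive f x l.
Proof.
  intros HK.
  assert (K0 : 0 <= K).
  { specialize (HK 1). assert (Q := Rabs_pos (f (x + 1) - f x - 1 * l)). lra. }
  apply is_derive_Reals. intros eps He.
  assert (Hd : 0 < eps / (K + 1)) by (apply Rdiv_lt_0_compat; lra).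
  exists (mkposreal _ Hd). intros h Hh Hs. simpl in Hs.
  replace ((f (x + h) - f x) / h - l) with ((f (x + h) - f x - h * l) / h) by (field; auto).
  unfold Rdiv. rewrite Rabs_mult, Rabs_inv.
  assert (Ha : 0 < Rabs h) by now apply Rabs_pos_lt.
  apply Rmult_lt_reg_r with (Rabs h); auto. rewrite Rmult_assoc, Rinv_l, Rmult_1_r by lra.
  eapply Rle_lt_trans; [apply HK|]. rewrite <- (pow2_abs h).
  apply Rle_lt_trans with (K * (eps / (K + 1)) * Rabs h).
  - simpl. rewrite Rmult_1_r, <- Rmult_assoc. apply Rmult_le_compat_r; [lra|].
    apply Rmult_le_compat_l; lra.
  - apply Rmult_lt_compat_r; auto.
    apply Rlt_le_trans with ((K + 1) * (eps / (K + 1))); [|right; field; lra].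
    apply Rmult_lt_compat_r; lra.
Qed.

(** One Taylor expansion yields everything needed about [D]: differentiability on the torus, the
    symbol, and the remainder along the direction (1, k). *)
Lemma D_ranalytic k u : ranalytic u ->
  torus_diff u /\ ranalytic (D k u) /\
  (forall p q, coef (cplx (D k u)) p q = Cmult (Cmult Ci (RtoC (freq k p q))) (coef (cplx u) p q)) /\
  exists K, 0 <= K /\ forall x y s,
    Rabs (u (x + s) (y + k * s) - u x y - s * D k u x y) <= K * s ^ 2.
Proof.
  intros Hu. destruct (analytic_Taylor _ Hu) as [F1 [F2 [A1 [A2 [C1 [C2 [K [K0 HK]]]]]]]].
  assert (HR : forall x y h l, Rabs (u (x + h) (y + l) - u x y - (h * Re (F1 x y) + l * Re (F2 x y)))
     <= K * (Rabs h + Rabs l) ^ 2).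
  { intros x y h l. eapply Rle_trans; [|apply (HK x y h l)]. eapply Rle_trans; [|apply re_le_Cmod].
    right. apply f_equal.
    change (u (x + h) (y + l) - u x y - (h * Re (F1 x y) + l * Re (F2 x y)) =
      u (x + h) (y + l) - u x y - (Re (Cmult (RtoC h) (F1 x y)) + Re (Cmult (RtoC l) (F2 x y)))).
    now rewrite !Re_Cmult_RtoC. }
  assert (D1 : forall x y, is_derive (fun s => u s y) x (Re (F1 x y))).
  { intros x y. apply is_derive_quadratic with K. intros h.
    specialize (HR x y h 0). rewrite Rabs_R0, !Rplus_0_r, Rmult_0_l, Rplus_0_r, pow2_abs in HR. exact HR. }
  assert (D2 : forall x y, is_derive (fun s => u x s) y (Re (F2 x y))).
  { intros x y. apply is_derive_quadratic with K. intros h.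
    specialize (HR x y 0 h). rewrite Rabs_R0, !Rplus_0_r, Rmult_0_l, !Rplus_0_l, pow2_abs in HR. exact HR. }
  set (G := fun x y => Cplus (F1 x y) (Cmult (RtoC k) (F2 x y))).
  assert (AG : analytic G) by (apply analytic_plus; auto; now apply analytic_scal).
  assert (CG : forall p q, coef G p q = Cmult (Cmult Ci (RtoC (freq k p q))) (coef (cplx u) p q)).
  { intros p q. unfold G. rewrite (coef_plus F1), coef_scal, C1, C2; try apply A1; try apply A2.
    - unfold freq. rewrite RtoC_plus, RtoC_mult. ring.
    - apply AP_scal, A2. }
  destruct (AP_real G) as [v EG]; [apply AG | |].
  { intros p q. rewrite !CG, freq_opp, coef_real, !Cmult_conj, Cconj_RtoC, RtoC_opp by apply Hu.
    replace (Cconj Ci) with (Copp Ci) by (unfold Cconj, Copp, Ci; simpl; f_equal; ring). ring. }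
  assert (ED : forall x y, D k u x y = Re (F1 x y) + k * Re (F2 x y)).
  { intros x y. unfold D. 
    apply f_equal2; [|apply f_equal]; now apply is_derive_unique. }
  assert (E : D k u = v).
  { fext. rewrite ED. rewrite <- Re_Cmult_RtoC.
    change (Re (G x y) = v x y). now rewrite EG. }
  rewrite E. unfold ranalytic. rewrite <- EG. repeat split; auto; try apply AG.
  - intros x y. exists (Re (F1 x y)), (Re (F2 x y)). intros eps.
    assert (Hd : 0 < eps / (4 * (K + 1))).
    { apply Rdiv_lt_0_compat; [apply cond_pos | lra]. }
    exists (mkposreal _ Hd). intros x' y' Hx Hy. simpl in Hx, Hy.
    specialize (HR x y (x' - x) (y' - y)).
    replace (x + (x' - x)) with x' in HR by ring. replace (y + (y' - y)) with y' in HR by ring.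
    rewrite (Rmult_comm (Re (F1 x y))), (Rmult_comm (Re (F2 x y))).
    eapply Rle_trans; [apply HR|].
    set (M := Rmax (Rabs (x' - x)) (Rabs (y' - y))).
    assert (M1 : Rabs (x' - x) <= M) by apply Rmax_l.
    assert (M2 : Rabs (y' - y) <= M) by apply Rmax_r.
    assert (M3 : M < eps / (4 * (K + 1))) by (now apply Rmax_lub_lt).
    assert (Q1 := Rabs_pos (x' - x)). assert (Q2 := Rabs_pos (y' - y)).
    assert (T : (Rabs (x' - x) + Rabs (y' - y)) ^ 2 <= 4 * M ^ 2) by nra.
    apply Rle_trans with (K * (4 * M ^ 2)); [now apply Rmult_le_compat_l|].
    replace (K * (4 * M ^ 2)) with (4 * K * M * M) by ring.
    apply Rmult_le_compat_r; [lra|].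
    apply Rle_trans with (4 * (K + 1) * (eps / (4 * (K + 1)))); [|right; field; lra].
    apply Rmult_le_compat; lra.
  - exists (K * (1 + Rabs k) ^ 2). split.
    { apply Rmult_le_pos; auto. apply pow2_ge_0. }
    intros x y s. rewrite <- E, ED. specialize (HR x y s (k * s)).
    replace (s * (Re (F1 x y) + k * Re (F2 x y))) with (s * Re (F1 x y) + k * s * Re (F2 x y)) by ring.
    eapply Rle_trans; [apply HR|]. right. rewrite Rabs_mult, <- (pow2_abs s). ring.
Qed.

(** * Inverses in closed algebras of trigonometric polynomials *)

Lemma reduce_mod_2PI x : exists n : Z, 0 <= x + IZR n * (2 * PI) < 2 * PI.
Proof.
  assert (Q := two_PI_pos). destruct (archimed (- x / (2 * PI))) as [A B].
  set (z := up (- x / (2 * PI))) in *.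
  assert (E : x = - (- x / (2 * PI)) * (2 * PI)) by (field; lra).
  set (w := - x / (2 * PI)) in *.
  (* [up] leaves [IZR z - w] in (0, 1]; the value 1 must be moved to 0 to land in the half-open
     period. *)
  destruct (Req_dec (IZR z - w) 1) as [E1|E1].
  - exists (z - 1)%Z. rewrite minus_IZR, E. split; nra.
  - exists z. rewrite E. split; nra.
Qed.

Lemma AP_lower_bound Q F : AP Q F -> (forall x y, F x y <> RtoC 0) ->
  exists m, 0 < m /\ forall x y, m <= Cmod (F x y).
Proof.
  intros HF Hne.
  assert (Hd : forall u v, exists d : posreal, d <= Cmod (F u v) / 2 /\
    forall x y, Rabs (x - u) < d -> Rabs (y - v) < d -> Cmod (F u v) / 2 <= Cmod (F x y)).
  { intros u v. assert (P := Cmod_gt_0 (F u v)). assert (P' : 0 < Cmod (F u v)) by (apply P; auto).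
    destruct (AP_unif_cont Q F HF (Cmod (F u v) / 2)) as [d [D B]]; [lra|].
    (* Capping the radius by half the modulus makes one compactness statement suffice: a lower bound
       for the radii of the covering is then also a lower bound for |F|. *)
    assert (M : 0 < Rmin d (Cmod (F u v) / 2)) by (apply Rmin_pos; lra).
    exists (mkposreal _ M). simpl. split; [apply Rmin_r|].
    intros x y Hx Hy. assert (R := Rmin_l d (Cmod (F u v) / 2)).
    specialize (B u v x y ltac:(lra) ltac:(lra)).
    assert (T := Cmod_triangle (F x y) (Cminus (F u v) (F x y))).
    replace (Cplus (F x y) (Cminus (F u v) (F x y))) with (F u v) in T by ring.
    rewrite Cmod_minus_sym in B. lra. }
  set (dl := fun u v => proj1_sig (constructive_indefinite_description _ (Hd u v))).
  destruct (compactness_value_2d 0 (2 * PI) 0 (2 * PI) dl) as [d Hc].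
  exists d. split; [apply cond_pos|]. intros x y.
  destruct (reduce_mod_2PI x) as [m Hm], (reduce_mod_2PI y) as [n Hn].
  rewrite <- (AP_period Q F HF m n). set (x' := x + _) in *. set (y' := y + _) in *.
  apply Rnot_lt_le. intros Hlt. apply (Hc x' y'); try lra.
  intros [u [v [_ [_ [Hx [Hy Hl]]]]]].
  assert (S : dl u v <= Cmod (F u v) / 2 /\ forall x y, Rabs (x - u) < dl u v ->
     Rabs (y - v) < dl u v -> Cmod (F u v) / 2 <= Cmod (F x y)).
  { unfold dl. apply (proj2_sig (constructive_indefinite_description _ (Hd u v))). }
  destruct S as [S1 S2]. specialize (S2 x' y' Hx Hy). lra.
Qed.

Lemma Cmod_lower (a b : C) q : Cmod (Cminus b a) <= q * Cmod b -> (1 - q) * Cmod b <= Cmod a.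
Proof.
  intros Hb. assert (T := Cmod_triangle a (Cminus b a)).
  replace (Cplus a (Cminus b a)) with b in T by ring. lra.
Qed.

(** [B = A * (1 - f)] with |f| <= q, and the second factor has a Neumann inverse. Relative smallness
    avoids any bound on the inverse of [A]. *)
Lemma AP_inv_perturb Q A B q : additive Q -> Q 0%Z 0%Z -> 0 <= q < 1 -> AP Q A -> AP Q B ->
  AP Q (fun x y => Cinv (A x y)) -> (forall x y, A x y <> RtoC 0) ->
  (forall x y, Cmod (Cminus (B x y) (A x y)) <= q * Cmod (A x y)) ->
  AP Q (fun x y => Cinv (B x y)).
Proof.
  intros HQ Q0 Hq HA HB HI Hne Hd.
  set (f := fun x y => Cmult (Cminus (A x y) (B x y)) (Cinv (A x y))).
  assert (Hf : forall x y, Cmod (f x y) <= q).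
  { intros x y. unfold f. rewrite Cmod_mult, Cmod_inv by auto.
    assert (P : 0 < Cmod (A x y)) by (apply Cmod_gt_0; auto).
    apply Rmult_le_reg_r with (Cmod (A x y)); auto.
    rewrite Rmult_assoc, Rinv_l, Rmult_1_r, Cmod_minus_sym by lra. auto. }
  apply AP_ext with (fun x y => Cmult (Cinv (A x y)) (Cinv (Cminus (RtoC 1) (f x y)))).
  - intros x y. specialize (Hf x y). unfold f in *.
    assert (NB : B x y <> RtoC 0).
    { intros E. specialize (Hd x y). rewrite E in Hd.
      replace (Cminus (RtoC 0) (A x y)) with (Copp (A x y)) in Hd by ring.
      rewrite Cmod_opp in Hd. assert (P : 0 < Cmod (A x y)) by (apply Cmod_gt_0; auto). nra. }
    replace (Cminus (RtoC 1) (Cmult (Cminus (A x y) (B x y)) (Cinv (A x y))))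
      with (Cmult (B x y) (Cinv (A x y))) by (field; auto).
    field. auto.
  - apply AP_mult; auto. apply AP_neumann with q; auto.
    apply AP_mult; auto. now apply AP_minus.
Qed.

(** Smallness relative to the function to be inverted: |B - A| <= |B| / 3 forces |A| >= 2 |B| / 3,
    hence |B - A| <= |A| / 2. It serves when the lower bound at hand is for [B]. *)
Lemma AP_inv_perturb_r Q A B : additive Q -> Q 0%Z 0%Z -> AP Q A -> AP Q B ->
  AP Q (fun x y => Cinv (A x y)) -> (forall x y, B x y <> RtoC 0) ->
  (forall x y, Cmod (Cminus (B x y) (A x y)) <= / 3 * Cmod (B x y)) ->
  AP Q (fun x y => Cinv (B x y)).
Proof.
  intros HQ Q0 HA HB HI Hne Hd.
  assert (L : forall x y, 2 / 3 * Cmod (B x y) <= Cmod (A x y)).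
  { intros x y. assert (T := Cmod_lower _ _ _ (Hd x y)). lra. }
  apply (AP_inv_perturb Q A B (1 / 2)); auto; [lra | | ].
  - intros x y E. specialize (L x y). rewrite E, Cmod_0 in L.
    assert (P : 0 < Cmod (B x y)) by (apply Cmod_gt_0; auto). lra.
  - intros x y. specialize (L x y). specialize (Hd x y). lra.
Qed.

(** Connectedness of the positive half-line, obtained from the intermediate value theorem for the
    function equal to 1 where [P] holds and to -1 elsewhere. *)
Lemma locally_constant_Prop (P : R -> Prop) a b :
  (forall s, 0 < s -> exists d, 0 < d /\ forall s', 0 < s' -> Rabs (s' - s) < d -> (P s <-> P s')) ->
  0 < a < b -> ~ P a -> P b -> False.
Proof.
  intros Hl Hab Na Pb.
  set (f := fun s => if excluded_middle_informative (P s) then 1 else -1).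
  destruct (Ranalysis5.IVT_interv f a b) as [z [_ Ez]].
  - intros s Hs eps He. destruct (Hl s ltac:(lra)) as [d [D B]].
    exists (Rmin d (s / 2)). split; [apply Rmin_pos; lra|].
    intros s' [_ Hs']. simpl in Hs'. unfold Rdist in Hs'.
    assert (R1 := Rmin_l d (s / 2)). assert (R2 := Rmin_r d (s / 2)).
    assert (R3 : 0 < s') by (assert (A := Rabs_def2 _ _ Hs'); lra).
    specialize (B s' R3 ltac:(lra)). unfold f; simpl; unfold Rdist.
    destruct (excluded_middle_informative (P s)), (excluded_middle_informative (P s'));
      try tauto; rewrite Rminus_diag, Rabs_R0; auto.
  - lra.
  - unfold f. destruct (excluded_middle_informative (P a)); [tauto | lra].
  - unfold f. destruct (excluded_middle_informative (P b)); [lra | tauto].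
  - unfold f in Ez. destruct (excluded_middle_informative (P z)); lra.
Qed.

Lemma AP_chord Q k Z s : Q 0%Z 0%Z -> AP Q Z ->
  AP Q (fun x y => Cplus (RtoC s) (Cminus (Z (x + s) (y + k * s)) (Z x y))).
Proof.
  intros Q0 HZ. apply (AP_plus Q (fun _ _ => RtoC s)); [now apply AP_const|].
  apply (AP_minus Q (fun x y => Z (x + s) (y + k * s)) Z); auto. now apply AP_shift.
Qed.

(* Along the curve [s |-> s + Z], the normalized chords of length [s] deform the
   tangent [f0] (as [s -> 0]) to the constant 1 (as [s -> oo]) through
   nonvanishing functions, and invertibility in the closed algebra [AP Q] is
   locally constant along the deformation. *)
Lemma AP_inv_tangent (Q : Z -> Z -> Prop) k (Z f0 : R -> R -> C) K :
  additive Q -> Q 0%Z 0%Z -> 0 < k -> AP Q Z -> AP Q f0 -> 0 <= K ->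
  (forall s x y, 0 < s -> Cplus (RtoC s) (Cminus (Z (x + s) (y + k * s)) (Z x y)) <> RtoC 0) ->
  (forall x y, f0 x y <> RtoC 0) ->
  (forall s x y, 0 < s -> Cmod (Cminus (Cmult (RtoC s) (f0 x y))
     (Cplus (RtoC s) (Cminus (Z (x + s) (y + k * s)) (Z x y)))) <= K * s ^ 2) ->
  AP Q (fun x y => Cinv (f0 x y)).
Proof.
  intros HQ Q0 Hk HZ Hf0 K0 Hne Hne0 Htan.
  set (W := fun s x y => Cplus (RtoC s) (Cminus (Z (x + s) (y + k * s)) (Z x y))).
  assert (HW : forall s, AP Q (W s)) by (intros; now apply AP_chord).
  set (E := fun s => AP Q (fun x y => Cinv (W s x y))).
  assert (Hloc : forall s, 0 < s -> exists d, 0 < d /\ forall s', 0 < s' -> Rabs (s' - s) < d ->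
     (E s <-> E s')).
  { intros s Hs.
    destruct (AP_lower_bound Q (W s) (HW s)) as [m [M0 Hm]]; [intros; now apply Hne|].
    (* A chord changes by the change of [s] plus that of [Z]; at most [m / 6] from each gives a
       third of the lower bound [m]. *)
    destruct (AP_unif_cont Q Z HZ (m / 6)) as [d [D0 HD]]; [lra|].
    (* Dividing by [k + 1] makes both coordinates of the endpoint, with speeds 1 and [k], move by
       less than [d]. *)
    set (e := Rmin (m / 6) (d / (k + 1))).
    assert (He : 0 < e) by (apply Rmin_pos; [lra | apply Rdiv_lt_0_compat; lra]).
    exists e. split; auto. intros s' Hs' Hss.
    assert (E1 : e <= m / 6) by apply Rmin_l. assert (E2 : e <= d / (k + 1)) by apply Rmin_r.
    assert (E3 : Rabs (s' - s) * (k + 1) < d).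
    { replace d with (d / (k + 1) * (k + 1)) by (field; lra).
      apply Rmult_lt_compat_r; lra. }
    assert (Q1 := Rabs_pos (s' - s)).
    assert (B : forall x y, Cmod (Cminus (W s' x y) (W s x y)) <= / 3 * Cmod (W s x y)).
    { intros x y. specialize (HD (x + s) (y + k * s) (x + s') (y + k * s')).
      replace (x + s' - (x + s)) with (s' - s) in HD by ring.
      replace (y + k * s' - (y + k * s)) with (k * (s' - s)) in HD by ring.
      rewrite (Rabs_mult k), (Rabs_pos_eq k) in HD by lra.
      specialize (HD ltac:(nra) ltac:(nra)).
      unfold W at 1 2.
      replace (Cminus _ _) with (Cplus (RtoC (s' - s))
        (Cminus (Z (x + s') (y + k * s')) (Z (x + s) (y + k * s)))) by (rewrite RtoC_minus; ring).
      eapply Rle_trans; [apply Cmod_triangle|]. rewrite Cmod_R.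
      specialize (Hm x y). lra. }
    split; intros HE.
    - apply (AP_inv_perturb Q (W s) (W s') (/ 3)); auto; [lra|]. intros; now apply Hne.
    - apply (AP_inv_perturb_r Q (W s') (W s)); auto; [intros; now apply Hne|].
      intros x y. rewrite Cmod_minus_sym. apply B. }
  destruct (AP_bounded Q Z HZ) as [M [M0 HM]].
  (* The chord of length [4 * M] differs from that constant by at most [2 * M], half of it. *)
  assert (Hbig : E (4 * M)).
  { apply (AP_inv_perturb Q (fun _ _ => RtoC (4 * M)) (W (4 * M)) (1 / 2)); auto.
    - lra.
    - now apply AP_const.
    - apply (AP_const Q (Cinv (RtoC (4 * M))) Q0).
    - intros x y N. apply RtoC_inj in N. lra.
    - intros x y. unfold W.
      replace (Cminus _ _) with (Cminus (Z (x + 4 * M) (y + k * (4 * M))) (Z x y)) by ring.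
      unfold Cminus. eapply Rle_trans; [apply Cmod_triangle|].
      rewrite Cmod_opp, Cmod_R, Rabs_pos_eq by lra.
      assert (A1 := HM (x + 4 * M) (y + k * (4 * M))). assert (A2 := HM x y). lra. }
  destruct (AP_lower_bound Q f0 Hf0 Hne0) as [m [m0 Hm]].
  (* The first bound makes the error [K * s ^ 2] at most a third of |s f0|; the second keeps [s]
     below [4 * M], for the connectedness argument. *)
  set (s := Rmin (m / (3 * (K + 1))) (2 * M)).
  assert (Hs : 0 < s) by (apply Rmin_pos; [apply Rdiv_lt_0_compat; lra | lra]).
  assert (S1 : s <= m / (3 * (K + 1))) by apply Rmin_l. assert (S2 : s <= 2 * M) by apply Rmin_r.
  assert (Hsmall : E s).
  { apply NNPP. intros NE. apply (locally_constant_Prop E s (4 * M)); auto. lra. }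
  assert (Hcs : RtoC s <> RtoC 0) by (intros N; apply RtoC_inj in N; lra).
  apply AP_ext with (fun x y => Cmult (RtoC s) (Cinv (Cmult (RtoC s) (f0 x y)))).
  { intros x y. field. auto. }
  apply AP_scal.
  apply (AP_inv_perturb_r Q (W s) (fun x y => Cmult (RtoC s) (f0 x y))); auto.
  - now apply AP_scal.
  - intros x y. now apply Cmult_neq_0.
  - intros x y. eapply Rle_trans; [now apply Htan|].
    rewrite Cmod_mult, Cmod_R, Rabs_pos_eq by lra.
    assert (T : K * s <= / 3 * m).
    { apply Rle_trans with ((K + 1) * (m / (3 * (K + 1)))); [|right; field; lra].
      apply Rmult_le_compat; lra. }
    specialize (Hm x y).
    replace (K * s ^ 2) with (K * s * s) by ring.
    replace (/ 3 * (s * Cmod (f0 x y))) with (/ 3 * Cmod (f0 x y) * s) by ring.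
    apply Rmult_le_compat_r; lra.
Qed.

(** * Traveling waves *)

Lemma AP_cplx_const c : AP Any (cplx (fun _ _ => c)).
Proof. apply (AP_const Any (RtoC c)). exact I. Qed.

Lemma ranalytic_const c : ranalytic (fun _ _ => c).
Proof. apply (analytic_const (RtoC c)). Qed.

Lemma cplx_plus u v : cplx (fun x y => u x y + v x y) = (fun x y => Cplus (cplx u x y) (cplx v x y)).
Proof. fext. apply RtoC_plus. Qed.

Lemma cplx_minus u v : cplx (fun x y => u x y - v x y) = (fun x y => Cminus (cplx u x y) (cplx v x y)).
Proof. fext. apply RtoC_minus. Qed.

Lemma cplx_scal c u : cplx (fun x y => c * u x y) = (fun x y => Cmult (RtoC c) (cplx u x y)).
Proof. fext. apply RtoC_mult. Qed.

Lemma cplx_mult u v : cplx (fun x y => u x y * v x y) = (fun x y => Cmult (cplx u x y) (cplx v x y)).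
Proof. fext. apply RtoC_mult. Qed.

Lemma ranalytic_plus u v : ranalytic u -> ranalytic v -> ranalytic (fun x y => u x y + v x y).
Proof. intros Hu Hv. unfold ranalytic. rewrite cplx_plus. exact (analytic_plus (cplx u) (cplx v) Hu Hv). Qed.

Lemma ranalytic_minus u v : ranalytic u -> ranalytic v -> ranalytic (fun x y => u x y - v x y).
Proof. intros Hu Hv. unfold ranalytic. rewrite cplx_minus. exact (analytic_minus (cplx u) (cplx v) Hu Hv). Qed.

Lemma ranalytic_minus_mean u : ranalytic u -> ranalytic (fun x y => u x y - P0 u).
Proof. intros Hu. exact (ranalytic_minus u (fun _ _ => P0 u) Hu (ranalytic_const _)). Qed.

Lemma ranalytic_scal c u : ranalytic u -> ranalytic (fun x y => c * u x y).
Proof. intros Hu. unfold ranalytic. rewrite cplx_scal. exact (analytic_scal (RtoC c) (cplx u) Hu). Qed.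

Lemma ranalytic_mult u v : ranalytic u -> ranalytic v -> ranalytic (fun x y => u x y * v x y).
Proof. intros Hu Hv. unfold ranalytic. rewrite cplx_mult. exact (analytic_mult (cplx u) (cplx v) Hu Hv). Qed.

Lemma ranalytic_div u v m : ranalytic u -> ranalytic v -> 0 < m -> (forall x y, m <= v x y) ->
  ranalytic (fun x y => u x y / v x y).
Proof.
  intros Hu Hv Hm Hb. unfold ranalytic.
  replace (cplx (fun x y => u x y / v x y))
    with (fun x y => Cmult (cplx u x y) (Cinv (cplx v x y))).
  - apply (analytic_mult (cplx u) (fun x y => Cinv (cplx v x y)) Hu).
    apply (analytic_inv (cplx v) m Hv Hm).
    intros x y. unfold cplx. specialize (Hb x y). rewrite Cmod_R, Rabs_pos_eq; lra.
  - fext. unfold cplx, Rdiv. specialize (Hb x y). rewrite RtoC_mult, RtoC_inv; auto; lra.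
Qed.

Lemma coef_cplx_0 u : coef (cplx u) 0 0 = RtoC (P0 u).
Proof.
  unfold coef. rewrite (cmean_ext _ (cplx u)).
  - unfold cmean, cplx. simpl. now rewrite P0_const.
  - intros. change (- 0)%Z with 0%Z. rewrite mode_0. ring.
Qed.

Lemma coef_minus_mean u p q : ranalytic u ->
  coef (cplx (fun x y => u x y - P0 u)) p q
  = (if excluded_middle_informative ((p, q) = (0%Z, 0%Z)) then RtoC 0 else coef (cplx u) p q).
Proof.
  intros Hu. rewrite (cplx_minus u (fun _ _ => P0 u)).
  rewrite (coef_minus (cplx u) (cplx (fun _ _ => P0 u))) by (try apply AP_cplx_const; apply Hu).
  destruct (excluded_middle_informative _) as [E|E].
  - injection E; intros -> ->.
    rewrite (coef_cplx_0 u), (coef_cplx_0 (fun _ _ => P0 u)), P0_const. ring.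
  - assert (E0 : coef (cplx (fun _ _ => P0 u)) p q = RtoC 0) by exact (coef_const_ne (RtoC (P0 u)) p q E).
    rewrite E0. ring.
Qed.

(** As in the other operator identities on real analytic functions below, it suffices to compare
    coefficients. *)
Lemma H_scal k c u : ranalytic u -> H k (fun x y => c * u x y) = (fun x y => c * H k u x y).
Proof.
  intros Hu. destruct (H_ranalytic k u Hu) as [A1 C1].
  destruct (H_ranalytic k _ (ranalytic_scal c u Hu)) as [A2 C2].
  apply ranalytic_eq; [apply A2 | now apply ranalytic_scal |].
  intros. rewrite C2, !cplx_scal, !coef_scal, C1 by (apply Hu || apply A1). ring.
Qed.

Lemma D_scal k c u : D k (fun x y => c * u x y) = (fun x y => c * D k u x y).
Proof. fext. unfold D.
  rewrite (Derive_scal (fun s => u s y) c x), (Derive_scal (fun s => u x s) c y). ring. Qed.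

Lemma D_minus_mean k u : ranalytic u -> D k (fun x y => u x y - P0 u) = D k u.
Proof.
  intros Hu. destruct (D_ranalytic k u Hu) as [_ [A1 [C1 _]]].
  assert (Hm : ranalytic (fun x y => u x y - P0 u)).
  { now apply ranalytic_minus_mean. }
  destruct (D_ranalytic k _ Hm) as [_ [A2 [C2 _]]].
  apply ranalytic_eq; [apply A2 | apply A1 |].
  intros. rewrite C2, C1, coef_minus_mean by auto.
  destruct (excluded_middle_informative _) as [E|E]; auto.
  injection E; intros -> ->. unfold freq. replace (0 + 0 * k) with 0 by ring. ring.
Qed.

(** Here irrationality itself is used; other lemmas rely on it through this fact. *)
Lemma freq_neq_0 k p q : irrational k -> (p, q) <> (0%Z, 0%Z) -> freq k p q <> 0.
Proof.
  intros Hk Hne E. unfold freq in E. destruct (Z.eq_dec q 0) as [->|Hq].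
  - apply Hne. rewrite Rmult_0_l, Rplus_0_r in E. apply eq_IZR in E. now rewrite E.
  - apply (Hk (- p)%Z q Hq). apply not_0_IZR in Hq. rewrite opp_IZR.
    apply Rmult_eq_reg_r with (IZR q); auto. field_simplify; auto. lra.
Qed.

Lemma sign_sqr x : x <> 0 -> sign x * sign x = 1.
Proof.
  intros Hx. destruct (Rtotal_order x 0) as [Hn|[Hz|Hp]]; [|contradiction|].
  - rewrite sign_eq_m1 by auto. ring.
  - rewrite sign_eq_1 by auto. ring.
Qed.

Lemma Ci_sqr : Cmult Ci Ci = Copp (RtoC 1).
Proof. unfold Cmult, Ci, Copp, RtoC; simpl. f_equal; ring. Qed.

Lemma H_H k u : irrational k -> ranalytic u ->
  H k (H k u) = (fun x y => P0 u - u x y).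
Proof.
  intros Hk Hu. destruct (H_ranalytic k u Hu) as [A1 C1].
  destruct (H_ranalytic k _ A1) as [A2 C2].
  replace (fun x y => P0 u - u x y) with (fun x y => -1 * (u x y - P0 u)) by (fext; ring).
  assert (Hm : ranalytic (fun x y => u x y - P0 u)).
  { now apply ranalytic_minus_mean. }
  apply ranalytic_eq; [apply A2 | apply ranalytic_scal; auto |].
  intros p q. rewrite C2, C1, cplx_scal, coef_scal, coef_minus_mean by (auto; apply Hm).
  unfold hilbert_symbol. destruct (excluded_middle_informative _) as [E|E].
  - injection E; intros -> ->. unfold freq. replace (0 + 0 * k) with 0 by ring.
    rewrite sign_0. ring.
  - assert (S := sign_sqr _ (freq_neq_0 k p q Hk E)).
    set (s := sign (freq k p q)) in *.
    replace (Cmult (Cmult (Copp Ci) (RtoC s)) (Cmult (Cmult (Copp Ci) (RtoC s)) (coef (cplx u) p q)))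
      with (Cmult (Cmult Ci Ci) (Cmult (Cmult (RtoC s) (RtoC s)) (coef (cplx u) p q))) by ring.
    rewrite Ci_sqr, <- RtoC_mult, S, RtoC_m1. ring.
Qed.

Lemma H_D k u : ranalytic u -> H k (D k u) = D k (H k u).
Proof.
  intros Hu. destruct (H_ranalytic k u Hu) as [A1 C1]. destruct (D_ranalytic k u Hu) as [_ [A2 [C2 _]]].
  destruct (H_ranalytic k _ A2) as [A3 C3]. destruct (D_ranalytic k _ A1) as [_ [A4 [C4 _]]].
  apply ranalytic_eq; [apply A3 | apply A4 |]. intros. rewrite C3, C2, C4, C1. ring.
Qed.

(** * One-sided spectra and conjugate functions *)

Definition nonpos_freq (k : R) (p q : Z) : Prop := freq k p q <= 0.

Lemma additive_nonpos_freq k : additive (nonpos_freq k).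
Proof. intros p q p' q'. unfold nonpos_freq, freq. rewrite !plus_IZR. lra. Qed.

Lemma nonpos_freq_0 k : nonpos_freq k 0 0.
Proof. unfold nonpos_freq, freq. lra. Qed.

(** At positive frequency the coefficients of [U] are [Ci] times those of [V]; reality carries this
    to negative frequency with [Ci] replaced by [- Ci]. Together this is the symbol of [- H], away
    from the mean. *)
Lemma H_conjugate k U V : irrational k -> ranalytic U -> ranalytic V ->
  AP (nonpos_freq k) (fun x y => Cminus (cplx U x y) (Cmult Ci (cplx V x y))) ->
  H k V = (fun x y => P0 U - U x y).
Proof.
  intros Hk HU HV HQ. destruct (H_ranalytic k V HV) as [A1 C1].
  assert (Hpos : forall p q, 0 < freq k p q -> coef (cplx U) p q = Cmult Ci (coef (cplx V) p q)).
  { intros p q Hf.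
    assert (Z := coef_off _ _ p q HQ). unfold nonpos_freq in Z. specialize (Z ltac:(lra)).
    rewrite coef_minus, coef_scal in Z by (try apply AP_scal; apply HU || apply HV).
    now apply Ceq_minus. }
  replace (fun x y => P0 U - U x y) with (fun x y => -1 * (U x y - P0 U)) by (fext; ring).
  assert (Hm : ranalytic (fun x y => U x y - P0 U)).
  { now apply ranalytic_minus_mean. }
  apply ranalytic_eq; [apply A1 | apply ranalytic_scal; auto |].
  intros p q. rewrite C1, cplx_scal, coef_scal, coef_minus_mean by (auto; apply Hm).
  unfold hilbert_symbol. destruct (excluded_middle_informative _) as [E|E].
  - injection E; intros -> ->. unfold freq. replace (0 + 0 * k) with 0 by ring.
    rewrite sign_0. ring.
  - rewrite RtoC_m1. destruct (Rtotal_order (freq k p q) 0) as [Hn|[Hz|Hp]].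
    + rewrite sign_eq_m1, RtoC_m1 by auto.
      assert (Hp : 0 < freq k (- p) (- q)) by (rewrite freq_opp; lra).
      specialize (Hpos _ _ Hp). rewrite !coef_real in Hpos by (apply HU || apply HV).
      apply (f_equal Cconj) in Hpos. rewrite Cmult_conj, !Cconj_conj in Hpos.
      rewrite Hpos.
      replace (Cconj Ci) with (Copp Ci) by (unfold Cconj, Copp, Ci; simpl; f_equal; ring). ring.
    + now destruct (freq_neq_0 k p q Hk E).
    + rewrite sign_eq_1 by auto. rewrite (Hpos _ _ Hp). ring.
Qed.

Lemma ranalytic_period u : ranalytic u -> forall (n : Z) x y, u x (y + IZR n * (2 * PI)) = u x y.
Proof.
  intros Hu n x y. apply RtoC_inj.
  assert (E := AP_period _ _ (proj1 Hu) 0 n x y). unfold cplx in E.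
  now rewrite Rmult_0_l, Rplus_0_r in E.
Qed.

Lemma ranalytic_of_series a u K eps k : 0 < eps ->
  (forall x y, fourier_sum a x y (RtoC (u x y))) ->
  (forall j1 j2, Cmod (a j1 j2) <=
     K * exp (- (3 * eps * Rmax k 1 * IZR (Z.max (Z.abs j1) (Z.abs j2))))) ->
  ranalytic u.
Proof.
  intros He Hs Ha.
  assert (K0 : 0 <= K).
  { specialize (Ha 0%Z 0%Z). assert (P := Cmod_ge_0 (a 0%Z 0%Z)).
    assert (P' := exp_pos (- (3 * eps * Rmax k 1 * IZR (Z.max (Z.abs 0) (Z.abs 0))))). nra. }
  (* Since |p| + |q| is at most twice the maximum and [Rmax k 1 >= 1], the assumed exponent with its
     factor 3 dominates that of [wt r]. *)
  set (r := exp (- eps)).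
  assert (Hr : 0 < r < 1).
  { split; [apply exp_pos|]. unfold r. rewrite <- exp_0. apply exp_increasing. lra. }
  assert (Pw : forall n, r ^ n = exp (- (INR n * eps))).
  { induction n as [|n IH]; [simpl; rewrite Rmult_0_l, Ropp_0, exp_0; auto|].
    rewrite S_INR. simpl. rewrite IH. unfold r. rewrite <- exp_plus. f_equal. ring. }
  assert (Hd : forall p q, Cmod (a p q) <= K * wt r p q).
  { intros p q. eapply Rle_trans; [apply Ha|]. apply Rmult_le_compat_l; auto.
    unfold wt. rewrite Pw.
    assert (L : INR (Z.abs_nat p + Z.abs_nat q) <= 2 * IZR (Z.max (Z.abs p) (Z.abs q))).
    { rewrite INR_IZR_INZ, <- mult_IZR. apply IZR_le. lia. }
    assert (M0 : 0 <= IZR (Z.max (Z.abs p) (Z.abs q))) by (apply IZR_le; lia).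
    assert (M1 := Rmax_r k 1).
    set (n := INR (Z.abs_nat p + Z.abs_nat q)) in *.
    set (m := IZR (Z.max (Z.abs p) (Z.abs q))) in *. set (w := Rmax k 1) in *.
    assert (X : n * eps <= 3 * eps * w * m).
    { apply Rle_trans with (3 * eps * m); [nra|].
      replace (3 * eps * w * m) with (3 * eps * m * w) by ring.
      assert (0 <= 3 * eps * m) by (apply Rmult_le_pos; lra). nra. }
    destruct X as [X| ->]; [apply Rlt_le, exp_increasing; lra | apply Rle_refl]. }
  destruct (gsum_AP Any a (cplx u) K r Hr Hd) as [H1 H2].
  - intros p q N. destruct N. exact I.
  - intros x y. apply gsum_filterlim, Hs.
  - split; auto. exists K, r. repeat split; try lra. intros. rewrite H2. auto.
Qed.

Lemma torus_traveling_wave_const k c g tau eta : torus_traveling_wave k c g tau eta ->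
  exists B, forall x y, c ^ 2 / (2 * Jac k eta x y) + g * eta x y - tau * kappa k eta x y = B.
Proof.
  intros HT. eexists. intros x y. specialize (HT x y). unfold Pr in HT.
  apply Rminus_diag_uniq in HT. exact HT.
Qed.

(** * Tangents and chords of the conformal map *)

Definition zeta_alpha (k : R) (eta : R -> R -> R) (x y : R) : C :=
  Cplus (RtoC (Xi k eta x y)) (Cmult Ci (RtoC (D k eta x y))).

Definition zeta_tilde (k : R) (eta : R -> R -> R) (x y : R) : C :=
  Cplus (cplx (H k eta) x y) (Cmult Ci (cplx eta x y)).

Lemma RtoC_Ci a b : Cplus (RtoC a) (Cmult Ci (RtoC b)) = (a, b).
Proof. unfold Cplus, Cmult, Ci, RtoC; simpl. f_equal; ring. Qed.

Lemma Xi_eq k eta : ranalytic eta -> Xi k eta = (fun x y => 1 + D k (H k eta) x y).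
Proof. intros He. unfold Xi. now rewrite H_D. Qed.

Lemma ranalytic_Xi k eta : ranalytic eta -> ranalytic (Xi k eta).
Proof.
  intros He. rewrite Xi_eq by auto.
  apply (ranalytic_plus (fun _ _ => 1)); [apply ranalytic_const|].
  apply D_ranalytic, H_ranalytic, He.
Qed.

Lemma Cmod_zeta_alpha k eta x y : Cmod (zeta_alpha k eta x y) ^ 2 = Jac k eta x y.
Proof.
  unfold zeta_alpha, Jac. rewrite RtoC_Ci. unfold Cmod. rewrite pow2_sqrt; auto.
  apply Rplus_le_le_0_compat; apply pow2_ge_0.
Qed.

(** At positive frequency the symbol of [H] is [- Ci], which cancels the factor [Ci] in front of
    [eta]. *)
Lemma zeta_tilde_AP k eta : ranalytic eta -> AP (nonpos_freq k) (zeta_tilde k eta).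
Proof.
  intros He. destruct (H_ranalytic k eta He) as [A C1].
  apply analytic_AP.
  - apply (analytic_plus (cplx (H k eta)) (fun x y => Cmult Ci (cplx eta x y)) A).
    exact (analytic_scal Ci (cplx eta) He).
  - intros p q Hf. unfold nonpos_freq in Hf. unfold zeta_tilde.
    rewrite (coef_plus (cplx (H k eta)) (fun x y => Cmult Ci (cplx eta x y)));
      [|apply A | apply AP_scal, He].
    rewrite (coef_scal Ci (cplx eta)) by apply He. rewrite C1. unfold hilbert_symbol.
    rewrite sign_eq_1 by lra. ring.
Qed.

Lemma zeta_alpha_AP k eta : ranalytic eta -> AP (nonpos_freq k) (zeta_alpha k eta).
Proof.
  intros He. destruct (H_ranalytic k eta He) as [A C1].
  destruct (D_ranalytic k _ A) as [_ [B [C2 _]]]. destruct (D_ranalytic k eta He) as [_ [B' [C3 _]]].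
  set (v := cplx (D k (H k eta))) in *. set (w := cplx (D k eta)) in *.
  replace (zeta_alpha k eta) with (fun x y => Cplus (RtoC 1) (Cplus (v x y) (Cmult Ci (w x y)))).
  - apply (AP_plus _ (fun _ _ => RtoC 1)); [apply AP_const, nonpos_freq_0|].
    apply analytic_AP.
    + apply (analytic_plus v (fun x y => Cmult Ci (w x y)) B). exact (analytic_scal Ci w B').
    + intros p q Hf. unfold nonpos_freq in Hf.
      rewrite (coef_plus v (fun x y => Cmult Ci (w x y))); [|apply B | apply AP_scal, B'].
      rewrite (coef_scal Ci w) by apply B'. rewrite C2, C3, C1. unfold hilbert_symbol.
      rewrite sign_eq_1 by lra. ring.
  - fext. unfold zeta_alpha. rewrite Xi_eq, RtoC_plus by auto. unfold v, w, cplx. ring.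
Qed.

Lemma chord_tangent k eta : ranalytic eta -> exists K, 0 <= K /\ forall s x y,
  Cmod (Cminus (Cmult (RtoC s) (zeta_alpha k eta x y))
     (Cplus (RtoC s) (Cminus (zeta_tilde k eta (x + s) (y + k * s)) (zeta_tilde k eta x y))))
  <= K * s ^ 2.
Proof.
  intros He. destruct (H_ranalytic k eta He) as [A _].
  destruct (D_ranalytic k _ A) as [_ [_ [_ [K1 [K10 B1]]]]].
  destruct (D_ranalytic k eta He) as [_ [_ [_ [K2 [K20 B2]]]]].
  exists (K1 + K2). split; [lra|]. intros s x y.
  specialize (B1 x y s). specialize (B2 x y s).
  eapply Rle_trans; [apply Cmod_le_abs|].
  replace (Cminus _ _) with
    (Copp (H k eta (x + s) (y + k * s) - H k eta x y - s * D k (H k eta) x y,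
           eta (x + s) (y + k * s) - eta x y - s * D k eta x y)).
  - unfold Copp. simpl. rewrite !Rabs_Ropp. lra.
  - unfold zeta_alpha, zeta_tilde, cplx. rewrite Xi_eq, !RtoC_Ci by auto.
    unfold Cminus, Cplus, Copp, Cmult, RtoC; simpl. f_equal; ring.
Qed.

(** The line of slope [k] through (x, y) has intercept [y - k * x], reduced modulo the period.
    Hypotheses on lines thereby become statements at every torus point. *)
Lemma torus_point k x y : exists theta (n : Z),
  0 <= theta < 2 * PI /\ theta + k * x = y + IZR n * (2 * PI).
Proof.
  destruct (reduce_mod_2PI (y - k * x)) as [n Hn].
  exists (y - k * x + IZR n * (2 * PI)), n. split; [auto | ring].
Qed.

(** A vanishing chord says that [zeta0] takes the same value at [x + s] and [x] on the line through
    the point. *)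
Lemma chord_nonzero k eta : ranalytic eta ->
  (forall theta, 0 <= theta < 2 * PI -> forall alpha beta,
     zeta0 k eta theta alpha = zeta0 k eta theta beta -> alpha = beta) ->
  forall s x y, 0 < s ->
    Cplus (RtoC s) (Cminus (zeta_tilde k eta (x + s) (y + k * s)) (zeta_tilde k eta x y)) <> RtoC 0.
Proof.
  intros He Hinj s x y Hs E. destruct (torus_point k x y) as [theta [n [Ht Ey]]].
  assert (A := proj1 (H_ranalytic k eta He)).
  enough (x + s = x) by lra. apply (Hinj theta Ht). unfold zeta0.
  replace (theta + k * (x + s)) with (y + k * s + IZR n * (2 * PI)) by lra.
  rewrite Ey, !(ranalytic_period _ A), !(ranalytic_period _ He).
  unfold zeta_tilde, cplx in E. rewrite !RtoC_Ci in E.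
  unfold Cminus, Cplus, Copp, RtoC in E. simpl in E. injection E. intros E2 E1.
  f_equal; lra.
Qed.

Lemma is_derive_line k u theta alpha : ranalytic u ->
  is_derive (fun s => u s (theta + k * s)) alpha (D k u alpha (theta + k * alpha)).
Proof.
  intros Hu. destruct (D_ranalytic k u Hu) as [_ [_ [_ [K [_ B]]]]].
  apply is_derive_quadratic with K. intros h.
  replace (theta + k * (alpha + h)) with (theta + k * alpha + k * h) by ring. apply B.
Qed.

Lemma Derive_zeta0 k eta theta alpha : ranalytic eta ->
  Derive_RC (zeta0 k eta theta) alpha = zeta_alpha k eta alpha (theta + k * alpha).
Proof.
  intros He. unfold zeta_alpha. rewrite RtoC_Ci, Xi_eq by auto.
  assert (A := proj1 (H_ranalytic k eta He)).
  unfold Derive_RC, zeta0. simpl. f_equal.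
  - apply is_derive_unique.
    apply (is_derive_plus (V := R_NormedModule) (fun s => s)); [auto_derive; auto | now apply is_derive_line].
  - apply is_derive_unique. now apply is_derive_line.
Qed.

Lemma zeta_alpha_nonzero k eta : ranalytic eta ->
  (forall theta, 0 <= theta < 2 * PI -> forall alpha,
     Derive_RC (zeta0 k eta theta) alpha <> RtoC 0) ->
  forall x y, zeta_alpha k eta x y <> RtoC 0.
Proof.
  intros He Hd x y E. destruct (torus_point k x y) as [theta [n [Ht Ey]]].
  apply (Hd theta Ht x). rewrite Derive_zeta0, Ey by auto. rewrite <- E.
  destruct (D_ranalytic k eta He) as [_ [B _]].
  unfold zeta_alpha. now rewrite (ranalytic_period _ (ranalytic_Xi k eta He)), (ranalytic_period _ B).
Qed.

Lemma conformal_map_inverse k eta : 0 < k -> irrational k -> ranalytic eta ->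
  (forall theta, 0 <= theta < 2 * PI -> forall alpha beta,
     zeta0 k eta theta alpha = zeta0 k eta theta beta -> alpha = beta) ->
  (forall x y, zeta_alpha k eta x y <> RtoC 0) ->
  (forall x y, 0 < Jac k eta x y) /\
  ranalytic (fun x y => Xi k eta x y / Jac k eta x y) /\
  ranalytic (fun x y => D k eta x y / Jac k eta x y) /\
  H k (fun x y => D k eta x y / Jac k eta x y)
  = (fun x y => P0 (fun x y => Xi k eta x y / Jac k eta x y) - Xi k eta x y / Jac k eta x y).
Proof.
  intros Hk Hirr He Hinj Hne.
  assert (HZ := zeta_alpha_AP k eta He).
  (* Division within the analytic class needs a uniform lower bound for [Jac], not only
     positivity. *)
  destruct (AP_lower_bound _ _ HZ Hne) as [m [M0 Hm]].
  assert (HJ : forall x y, m ^ 2 <= Jac k eta x y).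
  { intros x y. rewrite <- Cmod_zeta_alpha. apply pow_incr. split; [lra | auto]. }
  assert (M2 : 0 < m ^ 2) by (apply pow_lt; auto).
  assert (JP : forall x y, 0 < Jac k eta x y) by (intros x y; specialize (HJ x y); lra).
  assert (AX := ranalytic_Xi k eta He).
  assert (AD : ranalytic (D k eta)) by apply (D_ranalytic k eta He).
  assert (AJ : ranalytic (Jac k eta)).
  { replace (Jac k eta) with (fun x y => Xi k eta x y * Xi k eta x y + D k eta x y * D k eta x y)
      by (fext; unfold Jac; ring).
    apply (ranalytic_plus (fun x y => Xi k eta x y * Xi k eta x y) (fun x y => D k eta x y * D k eta x y));
      now apply ranalytic_mult. }
  assert (AU := ranalytic_div _ _ _ AX AJ M2 HJ).
  assert (AV := ranalytic_div _ _ _ AD AJ M2 HJ).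
  split; [exact JP | split; [exact AU | split; [exact AV|]]].
  apply (H_conjugate k _ _ Hirr AU AV).
  destruct (chord_tangent k eta He) as [K [K0 HK]].
  apply AP_ext with (fun x y => Cinv (zeta_alpha k eta x y)).
  - intros x y. specialize (JP x y). unfold zeta_alpha, cplx. rewrite !RtoC_Ci.
    unfold Jac in *. unfold Cinv, Cminus, Cplus, Copp, RtoC; simpl. simpl in JP.
    f_equal; field; lra.
  - apply (AP_inv_tangent _ k (zeta_tilde k eta) (zeta_alpha k eta) K); auto.
    + apply additive_nonpos_freq.
    + apply nonpos_freq_0.
    + now apply zeta_tilde_AP.
    + now apply chord_nonzero.
Qed.

Theorem theoremA3 :
  forall (k c g tau : R), 0 < k -> irrational k ->
  forall (a : Z -> Z -> C) (eta0 : R -> R -> R),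
  (forall x y : R, fourier_sum a x y (RtoC (eta0 x y))) ->
  (forall j1 j2 : Z, a (- j1)%Z (- j2)%Z = Cconj (a j1 j2)) ->
  (exists K eps : R, 0 < eps /\
     forall j1 j2 : Z,
       Cmod (a j1 j2) <=
       K * exp (- (3 * eps * Rmax k 1 * IZR (Z.max (Z.abs j1) (Z.abs j2))))) ->
  (forall theta : R, 0 <= theta < 2 * PI ->
     (forall alpha beta : R,
        zeta0 k eta0 theta alpha = zeta0 k eta0 theta beta -> alpha = beta) /\
     (forall alpha : R, Derive_RC (zeta0 k eta0 theta) alpha <> RtoC 0)) ->
  torus_traveling_wave k c g tau eta0 ->
  forall theta : R,
    conformal_water_wave k theta g tau
      (fun _ => c * P0 (fun x y => Xi k eta0 x y / Jac k eta0 x y))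
      (fun alpha t => Cplus (zeta0 k eta0 theta alpha) (RtoC (c * t)))
      (fun alpha t => phi0 k c eta0 theta alpha).
Proof.
  intros k c g tau Hk Hirr a eta Hsum _ [K [eps [Heps Ha]]] Hinj Htw theta.
  assert (He := ranalytic_of_series a eta K eps k Heps Hsum Ha).
  destruct (conformal_map_inverse k eta Hk Hirr He) as [JP [AU [AV HV]]].
  { intros t Ht. apply (Hinj t Ht). }
  { apply zeta_alpha_nonzero; auto. intros t Ht. apply (Hinj t Ht). }
  set (U := fun x y => Xi k eta x y / Jac k eta x y) in *.
  set (V := fun x y => D k eta x y / Jac k eta x y) in *.
  destruct (H_ranalytic k eta He) as [Axi _]. set (xi := H k eta) in *.
  assert (EX : Xi k eta = (fun x y => 1 + D k xi x y)) by now apply Xi_eq.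
  destruct (D_ranalytic k eta He) as [De [ADe _]].
  destruct (D_ranalytic k _ ADe) as [DDe _].
  destruct (D_ranalytic k _ (ranalytic_Xi k eta He)) as [DX _].
  set (phi := fun x y => c * xi x y).
  assert (Aphi : ranalytic phi) by now apply ranalytic_scal.
  destruct (D_ranalytic k _ Aphi) as [Dphi _].
  assert (EDphi : D k phi = (fun x y => c * D k xi x y)) by apply D_scal.
  (* Since [phi] is [c * H eta], applying [- H] returns [c] times [eta] without its mean, and [D]
     forgets the mean. *)
  assert (EPsi : Psi k phi = (fun x y => c * (eta x y - P0 eta))).
  { unfold Psi, phi. rewrite H_scal by auto. unfold xi. rewrite H_H by auto. fext. ring. }
  assert (Am := ranalytic_minus_mean eta He).
  assert (APsi : ranalytic (Psi k phi)) by (rewrite EPsi; exact (ranalytic_scal c _ Am)).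
  destruct (D_ranalytic k _ APsi) as [DPsi _].
  assert (EDPsi : D k (Psi k phi) = (fun x y => c * D k eta x y)).
  { rewrite EPsi, (D_scal k c (fun x y => eta x y - P0 eta)), D_minus_mean by auto. reflexivity. }
  assert (EChi : Chi k eta phi = (fun x y => c * V x y)).
  { unfold Chi. rewrite EDPsi. fext. unfold V, Rdiv. ring. }
  assert (EHChi : H k (Chi k eta phi) = (fun x y => c * (P0 U - U x y))).
  { rewrite EChi, H_scal, HV by auto. reflexivity. }
  set (C1 := c * P0 U).
  (* The terms with [P0 U] cancel by the choice of [C1], leaving
     [c * (Xi ^ 2 + (D eta) ^ 2) / Jac]. *)
  assert (Ex0 : x0_rhs k C1 eta phi = (fun _ _ => c)).
  { unfold x0_rhs. rewrite EHChi, EChi. fext. unfold C1, U, V.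
    specialize (JP x y). unfold Jac in *. field. lra. }
  (* What remains is [c * (D eta * U - Xi * V)], which is zero. *)
  assert (Eeta : forall x y, eta_rhs k C1 eta phi x y = 0).
  { intros x y. unfold eta_rhs. rewrite EHChi, EChi. unfold C1, U, V.
    specialize (JP x y). field. lra. }
  destruct (torus_traveling_wave_const _ _ _ _ _ Htw) as [B HB].
  (* With [D phi = c * (Xi - 1)] the quadratic terms add up to [c ^ 2 / 2 - c ^ 2 / (2 * Jac)], so
     the right-hand side is [c ^ 2 / 2] minus the traveling wave expression, a constant that [Pr]
     removes. *)
  assert (Ephi : phi_rhs k g tau C1 eta phi = (fun _ _ => c ^ 2 / 2 - B)).
  { unfold phi_rhs. rewrite EHChi, EDPsi, EDphi. fext. rewrite <- (HB x y).
    unfold C1, U. specialize (JP x y).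
    assert (E1 : D k xi x y = Xi k eta x y - 1) by (rewrite EX; ring).
    rewrite E1. generalize (kappa k eta x y). intros kap. unfold Jac in *. field. lra. }
  assert (Tc : forall r, torus_fun (fun _ _ => r)) by (intros; apply ranalytic_torus_fun, ranalytic_const).
  (* The translation by [c * t] goes entirely into [x0] and the lift of xi - alpha; the lifts of eta
     and phi do not move in time. *)
  exists (fun t => c * t), (fun t x y => c * t + xi x y), (fun _ => eta), (fun _ => phi).
  split; [|split; [|split; [|split]]].
  - intros t. assert (Te := ranalytic_torus_fun _ He). assert (Tphi := ranalytic_torus_fun _ Aphi).
    refine (conj (conj _ _) (conj (conj Te _) (conj (conj Tphi _) (conj (conj Te De)
      (conj (conj (ranalytic_torus_fun _ ADe) DDe) (conj DX (conj (conj Tphi Dphi)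
      (conj DPsi (conj JP (conj _ (conj _ _))))))))))).
    + apply ranalytic_torus_fun.
      exact (ranalytic_plus (fun _ _ => c * t) xi (ranalytic_const _) Axi).
    + intros alpha. unfold zeta0. simpl. unfold xi. ring.
    + intros alpha. unfold zeta0. simpl. ring.
    + reflexivity.
    + rewrite EChi. apply ranalytic_torus_fun. exact (ranalytic_scal c V AV).
    + fold U C1. rewrite Ex0. apply Tc.
    + fold U C1. rewrite Ephi. apply Tc.
  - intros alpha t. unfold zeta0. simpl. fold xi. ring.
  - intros t. fold U C1. rewrite Ex0, P0_const.
    auto_derive; auto. ring.
  - intros alpha t. fold U C1. rewrite Eeta.
    apply (is_derive_ext (fun _ => eta alpha (theta + k * alpha))).
    + intros s. unfold zeta0. simpl. ring.
    + apply (is_derive_const (V := R_NormedModule) (eta alpha (theta + k * alpha)) t).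
  - intros alpha t. fold U C1. rewrite Ephi. unfold Pr. rewrite P0_const, Rminus_diag.
    apply (is_derive_const (V := R_NormedModule) (phi0 k c eta theta alpha) t).
Qed.
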